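(* Let $\delta>0$ and let $(A,B,(0,\delta))$ be a skew-adjoint discrete-spectrum control system on a complex Hilbert space $\mathscr{H}$, with $(\phi_n)_{n\in\mathbf{N}}$ the associated orthonormal basis of eigenvectors of $A$ and $A\phi_n=i\lambda_n\phi_n$, $\lambda_n\in\mathbf{R}$. Assume that the elements of the sequence $(\lambda_{n+1}-\lambda_n)_{n\in\mathbf{N}}$ are $\mathbf{Q}$-linearly independent and that $\langle B\phi_n,\phi_{n+1}\rangle\neq 0$ for every $n\in\mathbf{N}$. Let $\rho_0$ and $\rho_1$ be two unitarily equivalent density matrices on $\mathscr{H}$. Then for every $\varepsilon>0$ there exist $k\in\mathbf{N}$, $t_1,\dots,t_k>0$ and $u_1,\dots,u_k\in(0,\delta)$ such that, setting $\mathbf{V}=e^{t_k(A+u_kB)}\circ\cdots\circ e^{t_1(A+u_1B)}$, one has $\|\rho_1-\mathbf{V}\rho_0\mathbf{V}^*\|<\varepsilon$, where $\|\cdot\|$ denotes the operator norm on $\mathscr{H}$.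
   Context: $\mathbf{N}$ is the set of strictly positive integers. Let $\mathscr{H}$ be a complex Hilbert space, $U\subset\mathbf{R}$, and $A,B$ two possibly unbounded operators on $\mathscr{H}$ with domains $D(A),D(B)$. The triple $(A,B,U)$ stands for the formal controlled equation $\frac{d\psi}{dt}(t)=A\psi(t)+u(t)B\psi(t)$, $u(t)\in U$. It is called a skew-adjoint discrete-spectrum control system if: (1) $A$ and $B$ are skew-adjoint; (2) there exists an orthonormal basis $(\phi_n)_{n\in\mathbf{N}}$ of $\mathscr{H}$ made of eigenvectors of $A$; (3) $\phi_n\in D(B)$ for every $n\in\mathbf{N}$. Such a basis is fixed. Meaning of $A+uB$: let $V=\mathrm{span}\{\phi_n\mid n\in\mathbf{N}\}$ (finite linear combinations). For $u\in U$, the operator $A|_V+uB|_V:V\to\mathscr{H}$ is skew-Hermitian and (standing convention) it admits a unique skew-adjoint extension; $A+uB$ denotes this extension. It generates a group of unitary transformations $e^{t(A+uB)}$, $t\in\mathbf{R}$. Real numbers $(x_n)_{n\in\mathbf{N}}$ are $\mathbf{Q}$-linearly independent if for every $N\in\mathbf{N}$ and $(q_1,\dots,q_N)\in\mathbf{Q}^N\setminus\{0\}$ one has $\sum_{n=1}^N q_nx_n\neq 0$. A density matrix on $\mathscr{H}$ is a non-negative, self-adjoint, trace class operator on $\mathscr{H}$ with trace $1$. Two density matrices $\rho_0,\rho_1$ are unitarily equivalent if there exists a unitary transformation $\mathbf{U}$ of $\mathscr{H}$ such that $\rho_1=\mathbf{U}\rho_0\mathbf{U}^*$. *)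

(* Defs.v *)
From HB Require Import structures.
From mathcomp Require Import all_boot all_order all_algebra.
From mathcomp Require Import sesquilinear complex.
From mathcomp Require Import all_classical all_reals all_analysis.

Set Implicit Arguments.
Unset Strict Implicit.
Unset Printing Implicit Defensive.

Import Order.TTheory GRing.Theory Num.Theory.
Import numFieldNormedType.Exports.

Local Open Scope classical_set_scope.
Local Open Scope ring_scope.
Local Open Scope complex_scope.

(* The norm of a module over R[i] takes its values in R[i]. The inner product
   is linear on the left and conjugate-linear on the right. *)
HB.mixin Record CompleteNormedModule_isHilbert (R : realType) H
    & CompleteNormedModule R[i] H := {
  dotp : {dot H for @conjc R} ;
  dotp_norm : forall x : H, `|x| ^+ 2 = dotp x x
}.

#[short(type="hilbertType")]
HB.structure Definition Hilbert (R : realType) :=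
  {H of CompleteNormedModule_isHilbert R H & CompleteNormedModule R[i] H}.

(* A possibly unbounded operator: only the values of op_fun on op_dom matter,
   so that operators are compared with op_le and op_eq, not with Leibniz
   equality. Bounded operators are plain functions H -> H. *)
Record operator (R : realType) (H : hilbertType R) := Operator {
  op_dom : set H ;
  op_fun :> H -> H
}.

HB.instance Definition _ (R : realType) (H : hilbertType R) :=
  gen_eqMixin (operator H).
HB.instance Definition _ (R : realType) (H : hilbertType R) :=
  gen_choiceMixin (operator H).

Section Operators.
Context (R : realType) (H : hilbertType R).
Implicit Types (A B L T : operator H) (V : set H).

Definition op_linear A :=
  op_dom A 0 /\
  forall (a : R[i]) (x y : H), op_dom A x -> op_dom A y ->
    op_dom A (a *: x + y) /\ A (a *: x + y) = a *: A x + A y.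

Definition op_le A B :=
  op_dom A `<=` op_dom B /\ forall x, op_dom A x -> B x = A x.

Definition op_eq A B := op_le A B /\ op_le B A.

Definition op_restrict A V := Operator (op_dom A `&` V) A.

Definition op_add A B :=
  Operator (op_dom A `&` op_dom B) (fun x => A x + B x).

Definition op_scale (c : R[i]) A := Operator (op_dom A) (fun x => c *: A x).

(* y is in the domain of the adjoint of A, which maps y to z (z is determined
   by y when A is densely defined) *)
Definition op_adjoint A (y z : H) :=
  forall x, op_dom A x -> dotp (A x) y = dotp x z.

Definition skew_adjoint A :=
  [/\ op_linear A, dense (op_dom A) &
      forall y z, op_adjoint A y z <-> op_dom A y /\ z = - A y].

Definition skew_adjoint_extension T L := skew_adjoint L /\ op_le T L.

Definition has_unique_skew_adjoint_extension T :=
  exists2 L, skew_adjoint_extension T L &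
    forall L', skew_adjoint_extension T L' -> op_eq L L'.

(* the value is T itself if T has no skew-adjoint extension *)
Definition skew_adjoint_closure T : operator H :=
  xget T [set L | skew_adjoint_extension T L].

Definition unitary (U : H -> H) :=
  [/\ linear U, forall x y, dotp (U x) (U y) = dotp x y &
      forall y, exists x, U x = y].

Definition unitary_group (G : R -> H -> H) :=
  [/\ forall t, unitary (G t), G 0 = id,
      forall s t, G (s + t) = G s \o G t &
      forall x, continuous (fun t => G t x)].

Definition generator (G : R -> H -> H) L :=
  forall x y : H,
    ((h^-1)%:C *: (G h x - x)) @[h --> (0 : R)^'] --> y <->
    op_dom L x /\ y = L x.

(* e^{tL} is op_exp L t, given by Stone's theorem for a skew-adjoint L *)
Definition op_exp L : R -> H -> H :=
  xget (fun=> id : H -> H) [set G : R -> H -> H | unitary_group G /\ generator G L].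

Definition span_seq (e : nat -> H) : set H :=
  [set x | exists N (c : 'I_N -> R[i]), x = \sum_(n < N) c n *: e n].

Definition orthonormal_basis (e : nat -> H) :=
  (forall m n, dotp (e m) (e n) = (m == n)%:R) /\ dense (span_seq e).

Definition bounded_op (T : H -> H) := linear T /\ continuous T.

(* the adjoint of a bounded operator (it exists by Riesz's theorem) *)
Definition adjoint (T : H -> H) : H -> H :=
  fun y => xget 0 [set z | forall x, dotp (T x) y = dotp x z].

Definition self_adjoint (T : H -> H) :=
  forall x y, dotp (T x) y = dotp x (T y).

Definition nonneg_op (T : H -> H) := forall x, 0 <= dotp (T x) x.

Definition op_abs (T S : H -> H) :=
  [/\ bounded_op S, self_adjoint S, nonneg_op S & S \o S = adjoint T \o T].

(* The sums below do not depend on the basis. Since bases are sequences, H is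
   implicitly separable and infinite-dimensional here; the trace is not
   meaningful otherwise. *)
Definition trace_class (T : H -> H) :=
  bounded_op T /\
  exists2 S, op_abs T S &
    forall e, orthonormal_basis e ->
      (\sum_(0 <= n <oo) (complex.Re (dotp (S (e n)) (e n)))%:E < +oo)%E.

Definition has_trace (T : H -> H) (c : R[i]) :=
  forall e, orthonormal_basis e ->
    series (fun n => dotp (T (e n)) (e n) : R[i]^o) @ \oo --> (c : R[i]^o).

Definition density_matrix (rho : H -> H) :=
  [/\ nonneg_op rho, self_adjoint rho, trace_class rho & has_trace rho 1].

Definition unitarily_equivalent (rho0 rho1 : H -> H) :=
  exists2 U, unitary U & rho1 = U \o rho0 \o adjoint U.

Definition op_norm (T : H -> H) : \bar R :=
  ereal_sup [set (complex.Re `|T x|)%:E | x in [set x : H | `|x| <= 1]].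

(* The basis e is indexed from 0. *)
Definition skew_adjoint_discrete_spectrum_system
    A B (U : set R) (e : nat -> H) :=
  [/\ skew_adjoint A /\ skew_adjoint B,
      orthonormal_basis e,
      forall n, op_dom A (e n) /\ exists c : R[i], A (e n) = c *: e n &
      forall n, op_dom B (e n)].

(* A|_V + u B|_V, where V is the span of e *)
Definition pre_controlled_op A B (e : nat -> H) (u : R) : operator H :=
  op_add (op_restrict A (span_seq e))
         (op_scale u%:C (op_restrict B (span_seq e))).

Definition controlled_op_well_defined A B (U : set R) (e : nat -> H) :=
  forall u, U u -> has_unique_skew_adjoint_extension (pre_controlled_op A B e u).

(* A + u B *)
Definition controlled_op A B (e : nat -> H) (u : R) : operator H :=
  skew_adjoint_closure (pre_controlled_op A B e u).

(* e^{t_k (A + u_k B)} o ... o e^{t_1 (A + u_1 B)}, with t_j and u_j stored as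
   t (j - 1) and u (j - 1) *)
Fixpoint propagator A B (e : nat -> H) (t u : nat -> R) (k : nat) : H -> H :=
  if k is k'.+1 then
    op_exp (controlled_op A B e (u k')) (t k') \o propagator A B e t u k'
  else id.

End Operators.

Definition Q_linearly_independent (R : realType) (x : nat -> R) :=
  forall (N : nat) (q : 'I_N -> rat), (exists i, q i != 0) ->
    \sum_(n < N) ratr (q n) * x n != 0.

(* Main.v *)
Require Import Defs.
From HB Require Import structures.
From mathcomp Require Import all_boot all_order all_algebra.
From mathcomp Require Import sesquilinear complex.
From mathcomp Require Import all_classical all_reals all_analysis.
From mathcomp Require Import ring lra.

Set Implicit Arguments.
Unset Strict Implicit.
Unset Printing Implicit Defensive.

Import Order.TTheory GRing.Theory Num.Theory.
Import numFieldNormedType.Exports.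

Local Open Scope classical_set_scope.
Local Open Scope ring_scope.
Local Open Scope complex_scope.

(* Since rho0 is approximated in norm by a finite-rank operator, it suffices to
   approximate a given unitary on finitely many vectors of the basis phi by
   propagators. The set of operators that are strong limits of propagators is
   closed under composition and contains:
   - e^{tA} for t > 0 (let u tend to 0), hence for all t, by recurrence;
   - the exponentials of the averages over s of e^{-sA}(A + uB)e^{sA} on any span
     of finitely many phi_n, by Chernoff's product formula. For s running
     through an arithmetic progression of step 2 pi / (l_{p+1} - l_p), with l_n
     the eigenvalues, the average keeps by nonresonance only the diagonal and the
     transition between phi_p and phi_{p+1}; for half that step, only the
     diagonal;
   - the inverses of the diagonal exponentials so obtained, again by recurrence,
     hence the rotations of the plane (phi_p, phi_{p+1}), with any phase (given
     by the origin of the progression).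
   Products of these rotations map the first vectors of phi arbitrarily close to
   any orthonormal family: they have determinant 1, but one more basis vector
   absorbs the missing phase. *)
(** * Hilbert spaces *)

(** Stone's theorem has to be proved because [op_exp] is a choice whose default is the identity: a
    group with the prescribed generator must exist before anything can be said of it. The main
    obstacle is unboundedness. Of [A + uB] only skew-adjointness and the values on the basis are
    known, and [B phi_j] may leave every finite span. Generators are therefore replaced by
    first-order expansions at finitely many basis vectors, and the product formula is used only
    where the limiting flow preserves a finite span. The drift cannot be switched off: every average
    keeps the diagonal of [A + uB]. Hence the need to produce the opposite diagonal separately and
    to add it. Halving the step isolates this diagonal because resonance would then make a
    difference of eigenvalues an even multiple of a gap, while independence only allows the
    multiples 1 and -1. Strong limits control [V rho0]; the factor [V^*] on the right is recovered
    from the self-adjointness of [rho0]. *)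

Notation normc := Normc.normc.

Section HilbertBasics.
Context (R : realType) (H : hilbertType R).
Implicit Types (x y z : H) (a b c : R[i]) (r s t : R).

Definition nrm x : R := complex.Re `|x|.

Lemma nrmE x : `|x| = (nrm x)%:C.
Proof. by rewrite /nrm RRe_real ?normr_real. Qed.

Lemma nrm_ge0 x : 0 <= nrm x.
Proof. by rewrite -ler0c -nrmE normr_ge0. Qed.

Lemma Re0 : complex.Re (0 : R[i]) = 0. Proof. reflexivity. Qed.
Lemma ReD a b : complex.Re (a + b) = complex.Re a + complex.Re b.
Proof. by case: a; case: b. Qed.
Lemma ReN a : complex.Re (- a) = - complex.Re a.
Proof. by case: a. Qed.
Lemma ReB a b : complex.Re (a - b) = complex.Re a - complex.Re b.
Proof. by case: a; case: b. Qed.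
Lemma ReMr r a : complex.Re (r%:C * a) = r * complex.Re a.
Proof. by case: a => a b /=; rewrite mul0r subr0. Qed.

Lemma conjcD a b : (a + b)^*%C = a^*%C + b^*%C. Proof. exact: rmorphD. Qed.
Lemma conjcN a : (- a)^*%C = - a^*%C. Proof. exact: rmorphN. Qed.
Lemma conjcM a b : (a * b)^*%C = a^*%C * b^*%C. Proof. exact: rmorphM. Qed.

Lemma nrm0 : nrm 0 = 0.
Proof. by rewrite /nrm normr0 Re0. Qed.

Lemma nrm_eq0 x : nrm x = 0 -> x = 0.
Proof. by move=> h; apply/eqP; rewrite -normr_eq0 nrmE h. Qed.

Lemma nrmD x y : nrm (x + y) <= nrm x + nrm y.
Proof. by rewrite -lecR rmorphD /= -!nrmE ler_normD. Qed.

Lemma nrmN x : nrm (- x) = nrm x.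
Proof. by rewrite /nrm normrN. Qed.

Lemma nrmBC x y : nrm (x - y) = nrm (y - x).
Proof. by rewrite /nrm distrC. Qed.

Lemma nrmB_le x y z : nrm (x - z) <= nrm (x - y) + nrm (y - z).
Proof. by apply: le_trans (nrmD _ _); rewrite addrA subrK. Qed.

Lemma normr_normc a : `|a| = (normc a)%:C.
Proof. by []. Qed.

Lemma normc_ge0 a : 0 <= normc a.
Proof. by rewrite -ler0c -normr_normc normr_ge0. Qed.

Lemma normcR r : normc r%:C = `|r|.
Proof. by rewrite /= expr0n addr0 sqrtr_sqr. Qed.

Lemma nrmZ a x : nrm (a *: x) = normc a * nrm x.
Proof. by apply: complexI; rewrite rmorphM /= -!nrmE -normr_normc normrZ. Qed.

Lemma nrmZr r x : nrm (r%:C *: x) = `|r| * nrm x.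
Proof. by rewrite nrmZ normcR. Qed.

Lemma nrm_sum (I : Type) (s : seq I) (P : pred I) (F : I -> H) :
  nrm (\sum_(i <- s | P i) F i) <= \sum_(i <- s | P i) nrm (F i).
Proof.
elim/big_rec2: _ => [|i v u _ le]; first by rewrite nrm0.
by apply: le_trans (nrmD _ _) _; rewrite lerD2l.
Qed.

Lemma dotDl x y z : dotp (x + y) z = dotp x z + dotp y z.
Proof. exact: linearDl. Qed.
Lemma dotDr x y z : dotp x (y + z) = dotp x y + dotp x z.
Proof. exact: linearDr. Qed.
Lemma dotBl x y z : dotp (x - y) z = dotp x z - dotp y z.
Proof. exact: linearBl. Qed.
Lemma dotBr x y z : dotp x (y - z) = dotp x y - dotp x z.
Proof. exact: linearBr. Qed.
Lemma dotNl x y : dotp (- x) y = - dotp x y.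
Proof. exact: linearNl. Qed.
Lemma dotNr x y : dotp x (- y) = - dotp x y.
Proof. exact: linearNr. Qed.
Lemma dot0l x : dotp 0 x = 0.
Proof. exact: linear0l. Qed.
Lemma dotZl a x y : dotp (a *: x) y = a * dotp x y.
Proof. exact: linearZl_LR. Qed.
Lemma dotZr a x y : dotp x (a *: y) = a^*%C * dotp x y.
Proof. exact: linearZr_LR. Qed.
Lemma dotC x y : dotp x y = (dotp y x)^*%C.
Proof. by rewrite hermC expr0 mul1r. Qed.

Lemma dot_suml (I : Type) (s : seq I) (P : pred I) (F : I -> H) y :
  dotp (\sum_(i <- s | P i) F i) y = \sum_(i <- s | P i) dotp (F i) y.
Proof.
elim/big_rec2: _ => [|i v u _ <-]; first exact: dot0l.
by rewrite dotDl.
Qed.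

Lemma dot_nrm x : dotp x x = (nrm x ^+ 2)%:C.
Proof. by rewrite -dotp_norm nrmE rmorphXn. Qed.

Lemma nrm_sq x : nrm x ^+ 2 = complex.Re (dotp x x).
Proof. by rewrite dot_nrm. Qed.

Lemma dot_Re_sym x y : complex.Re (dotp x y) = complex.Re (dotp y x).
Proof. by rewrite dotC; case: (dotp y x). Qed.

Lemma nrmD_sq x y :
  nrm (x + y) ^+ 2 = nrm x ^+ 2 + 2 * complex.Re (dotp x y) + nrm y ^+ 2.
Proof.
rewrite !nrm_sq dotDl !dotDr !ReD (dot_Re_sym y x); ring.
Qed.

Lemma nrmB_sq x y :
  nrm (x - y) ^+ 2 = nrm x ^+ 2 - 2 * complex.Re (dotp x y) + nrm y ^+ 2.
Proof. by rewrite nrmD_sq nrmN dotNr ReN mulrN. Qed.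

Lemma normc_sq a : normc a ^+ 2 = complex.Re a ^+ 2 + complex.Im a ^+ 2.
Proof. by case: a => a b /=; rewrite sqr_sqrtr// addr_ge0 ?sqr_ge0. Qed.

Lemma mul_conjc a : a * a^*%C = (normc a ^+ 2)%:C.
Proof. by rewrite -sqr_normc normr_normc rmorphXn. Qed.

Lemma normc_conj a : normc (a^*%C) = normc a.
Proof. by case: a => a b /=; rewrite sqrrN. Qed.

Lemma Re_normc a : `|complex.Re a| <= normc a.
Proof.
rewrite -(ler_pXn2r (n:=2)) ?nnegrE ?normc_ge0// -normrX normc_sq.
by rewrite ger0_norm ?sqr_ge0// lerDl sqr_ge0.
Qed.

(* The discriminant argument is stated for semi-definite forms since it is
   also applied to <rho x, y> with rho a density matrix. *)
Lemma cauchy_schwarz_psd (f : H -> H -> R[i]) :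
  (forall a x y z, f (a *: x + y) z = a * f x z + f y z) ->
  (forall x y, f x y = (f y x)^*%C) ->
  (forall x, 0 <= f x x) ->
  forall x y, normc (f x y) ^+ 2 <= complex.Re (f x x) * complex.Re (f y y).
Proof.
move=> lin herm pos x y.
have rea z : f z z = (complex.Re (f z z))%:C.
  by rewrite RRe_real// realE pos.
have re0 z : 0 <= complex.Re (f z z) by rewrite -ler0c -rea.
set c := f x y; set p := complex.Re (f x x); set q := complex.Re (f y y).
(* Positivity of [f] at [x - s c y]. The value [s = 1/q] gives the claim if [q > 0]; if [q = 0], a
   large [s] contradicts positivity unless [c = 0]. *)
have key (s : R) : 0 <= p - 2 * s * normc c ^+ 2 + s ^+ 2 * normc c ^+ 2 * q.
  have := re0 ((- (s%:C * c)) *: y + x).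
  set u := _ + _.
  have -> : f u u = f x x - s%:C * (c * c^*%C ) - s%:C * (c * c^*%C)
                   + s%:C ^+ 2 * (c * c^*%C) * f y y.
    rewrite {1}/u lin (herm y) (herm x) /u !lin (herm y x) -/c.
    rewrite !(conjcD, conjcM, conjcN) conjc_real conjcK -(herm y y) -(herm x x).
    ring.
  rewrite mul_conjc [f x x]rea [f y y]rea -rmorphXn -!rmorphM -!rmorphB -rmorphD /=.
  rewrite -/p -/q; set m := normc c ^+ 2; move=> h; apply: le_trans h _.
  by rewrite le_eqVlt; apply/orP; left; apply/eqP; ring.
have m0 : 0 <= normc c ^+ 2 by rewrite sqr_ge0.
have p0 : 0 <= p by exact: re0.
have q0 : 0 <= q by exact: re0.
move: m0 key; set m := normc c ^+ 2 => m0 key.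
have [q_gt0|] := ltP 0 q.
  have := key q^-1.
  have -> : p - 2 * q^-1 * m + q^-1 ^+ 2 * m * q = (p * q - m) / q.
    by field; rewrite gt_eqF.
  by rewrite pmulr_lge0 ?invr_gt0// subr_ge0.
move=> q_le0; have -> : q = 0 by lra.
rewrite mulr0; rewrite leNgt; apply/negP => m_gt0.
have := key ((p + 1) / m).
have -> : q = 0 by lra.
rewrite mulr0 addr0 -mulrA divfK ?gt_eqF//; lra.
Qed.

Lemma cauchy_schwarz x y : normc (dotp x y) <= nrm x * nrm y.
Proof.
rewrite -(ler_pXn2r (n:=2)) ?nnegrE ?normc_ge0 ?mulr_ge0 ?nrm_ge0// exprMn.
rewrite !nrm_sq; apply: cauchy_schwarz_psd => {x y}.
- by move=> a x y z; rewrite dotDl dotZl.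
- exact: dotC.
- by move=> x; rewrite dot_nrm ler0c sqr_ge0.
Qed.

Lemma dot_ext x y : (forall z, dotp z x = dotp z y) -> x = y.
Proof.
move=> h; apply/eqP; rewrite -subr_eq0; apply/eqP/nrm_eq0/eqP.
by rewrite -sqrf_eq0 nrm_sq dotBr h subrr.
Qed.

Lemma dot_extl x y : (forall z, dotp x z = dotp y z) -> x = y.
Proof. by move=> h; apply: dot_ext => z; rewrite dotC h -dotC. Qed.

End HilbertBasics.

(* Identities between linear combinations of vectors are reduced to ring
   identities by pairing both sides with an arbitrary vector. *)
Ltac vec := apply: dot_extl => ?; rewrite ?(dotDl, dotNl, dotZl, dot0l); ring.

(** * Completeness and the projection theorem *)

Section HilbertTopology.
Context (R : realType) (H : hilbertType R).
Implicit Types (x y z : H) (a b c : R[i]) (r s t : R).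

Lemma gt0_complexE a : 0 < a -> a = (complex.Re a)%:C /\ 0 < complex.Re a.
Proof. by case: a => p q; rewrite ltcE /= => /andP[/eqP-> ?]. Qed.

Lemma cvg_nrmP (T : Type) (F : set_system T) (FF : Filter F) (f : T -> H) y :
  f x @[x --> F] --> y <->
  (forall e : R, 0 < e -> \forall x \near F, nrm (y - f x) < e).
Proof.
split=> [/cvgrPdist_lt h e e0|h].
  have /h : 0 < e%:C :> R[i] by rewrite ltcR.
  by apply: filterS => x; rewrite nrmE ltcR.
apply/cvgrPdist_lt => a /gt0_complexE[-> a0].
by apply: filterS (h _ a0) => x; rewrite nrmE ltcR.
Qed.

Lemma nrm_complete (u : nat -> H) :
  (forall e : R, 0 < e -> exists N, forall m n, (N <= m)%N -> (N <= n)%N ->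
     nrm (u m - u n) < e) ->
  exists l, forall e : R, 0 < e -> exists N, forall n, (N <= n)%N ->
    nrm (u n - l) < e.
Proof.
move=> hu; have cu : cauchy (u n @[n --> \oo]).
  apply/cauchyP => a /gt0_complexE[-> a0].
  have [N hN] := hu _ a0; exists (u N); exists N => // n /= Nn.
  by rewrite -ball_normE /= nrmE ltcR; exact: hN.
have /cauchy_cvgP/cvg_ex[l hl] := cu.
exists l => e e0; have /cvg_nrmP/(_ _ e0)[N _ hN] := hl.
by exists N => n Nn; rewrite nrmBC; exact: hN.
Qed.

Lemma dense_nrm (D : set H) x (e : R) : dense D -> 0 < e ->
  exists2 y, D y & nrm (x - y) < e.
Proof.
move=> dD e0; pose O := (ball x e%:C)^°.
have nO : nbhs x (ball x e%:C) by apply: nbhsx_ballx; rewrite ltcR.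
have [|y [Oy Dy]] := dD O _ (open_interior _); first by exists x.
exists y => //; move: (interior_subset Oy).
by rewrite -ball_normE /= nrmE ltcR.
Qed.

Lemma parallelogram x y :
  nrm (x + y) ^+ 2 + nrm (x - y) ^+ 2 = 2 * nrm x ^+ 2 + 2 * nrm y ^+ 2.
Proof. rewrite nrmD_sq nrmB_sq; ring. Qed.

Lemma nrm_eps x : (forall e : R, 0 < e -> nrm x <= e) -> x = 0.
Proof.
move=> h; apply: nrm_eq0; apply/eqP; rewrite eq_le nrm_ge0 andbT.
by apply/ler_addgt0Pr => e e0; rewrite add0r h.
Qed.

Lemma invS_small (e : R) : 0 < e -> exists N, forall n, (N <= n)%N -> n.+1%:R^-1 < e.
Proof.
move=> e0; exists (Num.trunc e^-1) => n Nn.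
rewrite invf_plt ?posrE ?ltr0Sn//.
by apply: lt_le_trans (truncnS_gt _) _; rewrite ler_nat ltnS.
Qed.

(** Projection theorem: a minimizing sequence for the distance from [z] to [S] is Cauchy by the
    parallelogram identity, and [z] minus its limit is orthogonal to [S], hence zero. It serves to
    prove [1 - h L] surjective. *)
Lemma closed_subspace_full (S : set H) :
  S 0 -> (forall a x y, S x -> S y -> S (a *: x + y)) ->
  (forall z, (forall e : R, 0 < e -> exists2 x, S x & nrm (z - x) < e) -> S z) ->
  (forall y, (forall x, S x -> dotp x y = 0) -> y = 0) ->
  forall z, S z.
Proof.
move=> S0 Slin Scl Sorth z.
pose E := [set nrm (z - x) ^+ 2 | x in S].
have E0 : E !=set0 by exists (nrm (z - 0) ^+ 2), 0.
have lE : has_lbound E by exists 0 => _ [x _ <-]; rewrite sqr_ge0.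
pose d := inf E.
have dle x : S x -> d <= nrm (z - x) ^+ 2 by move=> Sx; apply: ge_inf => //; exists x.
have ad n : exists x, S x /\ nrm (z - x) ^+ 2 < d + n.+1%:R^-1.
  have n0 : 0 < n.+1%:R^-1 :> R by rewrite invr_gt0 ltr0Sn.
  by have [_ [x Sx <-] xd] := inf_adherent n0 (conj E0 lE); exists x.
have [u /all_and2[Su hu]] := choice ad.
have par m n : nrm (u m - u n) ^+ 2 <= 2 * (m.+1%:R^-1 + n.+1%:R^-1).
  have := parallelogram (z - u m) (z - u n).
  have -> : z - u m - (z - u n) = u n - u m by rewrite opprB addrC addrA subrK.
  have -> : z - u m + (z - u n) = 2%:R%:C *: (z - 2^-1%:C *: (u m + u n)).
    rewrite scalerBr scalerA -rmorphM /= divff ?pnatr_eq0// scale1r.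
    rewrite -[(2)%:C]/((1 + 1)%:C) rmorphD /= scalerDl !scale1r.
    by rewrite opprD addrACA.
  rewrite nrmZr exprMn real_normK ?num_real// (nrmBC (u n)).
  have /dle : S (2^-1%:C *: (u m + u n)).
    have := Slin 2^-1%:C _ _ (Su m) (Slin 2^-1%:C _ _ (Su n) S0).
    by rewrite addr0 scalerDr.
  move: (hu m) (hu n); move: (m.+1%:R^-1) (n.+1%:R^-1) => p q; lra.
have [x hx] : exists l, forall e : R, 0 < e -> exists N, forall n, (N <= n)%N ->
    nrm (u n - l) < e.
  apply: nrm_complete => e e0.
  have e4 : 0 < e ^+ 2 / 4 by rewrite divr_gt0 ?exprn_gt0.
  have [N hN] := invS_small e4.
  exists N => m n /hN hm /hN hn.
  rewrite -(ltr_pXn2r (n:=2)) ?nnegrE ?nrm_ge0 ?ltW//.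
  apply: le_lt_trans (par _ _) _; move: (m.+1%:R^-1) (n.+1%:R^-1) hm hn => p q.
  lra.
have Sx : S x.
  by apply: Scl => e /hx[N hN]; exists (u N) => //; rewrite nrmBC hN.
have dx : nrm (z - x) ^+ 2 <= d.
  apply/ler_addgt0Pr => e e0.
  pose b := nrm (z - x).
  have b0 : 0 <= b by exact: nrm_ge0.
  have b2 : 0 < 2 * b + 1 by lra.
  have e4 : 0 < e / 2 / (2 * b + 1) by rewrite divr_gt0// divr_gt0.
  have [N hN] := hx _ e4; have [N' hN'] := @invS_small (e / 2) (divr_gt0 e0 (ltr0n _ 2)).
  pose n := maxn N N'.
  have h1 := hN n (leq_maxl _ _); have h2 := hN' n (leq_maxr _ _).
  have h3 : b <= nrm (z - u n) + nrm (u n - x) by exact: nrmB_le.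
  have h4 : nrm (z - u n) ^+ 2 < d + e / 2 by apply: lt_trans (hu n) _; rewrite ltrD2l.
  have h5 : nrm (u n - x) * (2 * b + 1) < e / 2 by rewrite -ltr_pdivlMr.
  have := nrm_ge0 (u n - x); have := nrm_ge0 (z - u n).
  rewrite -/b; move: (nrm (z - u n)) (nrm (u n - x)) h1 h3 h4 h5 => p q h1 h3 h4 h5 p0 q0.
  have [bq|bq] := lerP b q; last first.
    have : (b - q) ^+ 2 <= p ^+ 2 by rewrite ler_pXn2r ?nnegrE//; lra.
    move: (sqr_ge0 q); nra.
  have : b ^+ 2 <= q * b by rewrite expr2 ler_wpM2r.
  have := dle x Sx; have := sqr_ge0 p; nra.
suff : z - x = 0 by move/eqP; rewrite subr_eq0 => /eqP->.
apply: Sorth => v Sv; apply/eqP; apply/negPn/negP => nz.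
set w := z - x in nz dx; set c := dotp v w in nz.
(* [x] is compared with [x + s c^* v], whose phase makes the first-order term equal to
   [- 2 s |c|^2]; for the small [s] chosen below it outweighs the second-order term. *)
have key (s : R) : 0 <= s ^+ 2 * normc c ^+ 2 * nrm v ^+ 2 - 2 * s * normc c ^+ 2.
  have Sxv : S ((s%:C * c^*%C) *: v + x) by exact: Slin.
  have := le_trans dx (dle _ Sxv).
  have -> : z - ((s%:C * c^*%C) *: v + x) = w - (s%:C * c^*%C) *: v.
    by rewrite /w opprD addrA addrAC.
  rewrite nrmB_sq dotZr conjcM conjc_real conjcK nrmZ Normc.normcM.
  rewrite normcR normc_conj !exprMn real_normK ?num_real// -mulrA ReMr.
  have -> : c * dotp w v = c * c^*%C by rewrite (dotC w v).
  rewrite mul_conjc /=; lra.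
have c0 : 0 < normc c ^+ 2.
  rewrite exprn_gt0// lt_neqAle normc_ge0 andbT eq_sym.
  by apply: contra nz => /eqP/Normc.eq0_normc ->.
have v0 := sqr_ge0 (nrm v).
have := key (nrm v ^+ 2 + 1)^-1.
set q := nrm v ^+ 2 in v0 *; set m := normc c ^+ 2 in c0 *.
have -> : (q + 1)^-1 ^+ 2 * m * q - 2 * (q + 1)^-1 * m = - (m * (q + 2) / (q + 1) ^+ 2).
  by field; lra.
rewrite oppr_ge0 leNgt => /negP; apply.
have q1 : 0 < q + 1 by lra.
have q2 : 0 < q + 2 by lra.
by apply: divr_gt0; [exact: mulr_gt0|exact: exprn_gt0].
Qed.

End HilbertTopology.
(** * Isometries and orthonormal bases *)

Section Isometries.
Context (R : realType) (H : hilbertType R).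
Implicit Types (x y z : H) (a b c : R[i]) (U V W : H -> H).

(** Unlike unitarity, this property passes to strong limits, where surjectivity can be lost. *)
Definition isom U :=
  (forall a x y, U (a *: x + y) = a *: U x + U y) /\
  (forall x, nrm (U x) = nrm x).

Lemma isomD U x y : isom U -> U (x + y) = U x + U y.
Proof. by move=> [l _]; rewrite -[x in LHS]scale1r l scale1r. Qed.
Lemma isom0 U : isom U -> U 0 = 0.
Proof. by move=> [_ h]; apply: nrm_eq0; rewrite h nrm0. Qed.
Lemma isomZ U a x : isom U -> U (a *: x) = a *: U x.
Proof. by move=> h; rewrite -[a *: x]addr0 h.1 isom0// addr0. Qed.
Lemma isomN U x : isom U -> U (- x) = - U x.
Proof. by move=> h; rewrite -scaleN1r isomZ// scaleN1r. Qed.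
Lemma isomB U x y : isom U -> U (x - y) = U x - U y.
Proof. by move=> h; rewrite isomD// isomN. Qed.
Lemma isom_sum U (I : Type) (s : seq I) (P : pred I) (F : I -> H) : isom U ->
  U (\sum_(i <- s | P i) F i) = \sum_(i <- s | P i) U (F i).
Proof.
move=> h; elim/big_rec2: _ => [|i v u _ <-]; first exact: isom0.
by rewrite isomD.
Qed.
Lemma isom_id : isom id.
Proof. by []. Qed.
Lemma isom_comp U V : isom U -> isom V -> isom (U \o V).
Proof.
move=> hU hV; split=> [a x y|x] /=; first by rewrite hV.1 hU.1.
by rewrite hU.2 hV.2.
Qed.

Lemma isom_iter U n : isom U -> isom (iter n U).
Proof.
by move=> hU; elim: n => [|n IH]; [exact: isom_id | exact: isom_comp hU IH].
Qed.

Lemma isom_dist U x y : isom U -> nrm (U x - U y) = nrm (x - y).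
Proof. by move=> h; rewrite -isomB// h.2. Qed.

Lemma unitary_isom U : unitary U -> isom U.
Proof.
move=> [l d _]; split=> // x.
by apply/eqP; rewrite -(eqrXn2 (n:=2)) ?nrm_ge0// !nrm_sq d.
Qed.

(** Polarization; multiplying the left argument by [-i] reduces the imaginary part to the real
    one. *)
Lemma isom_dot U x y : isom U -> dotp (U x) (U y) = dotp x y.
Proof.
move=> h.
have re u v : complex.Re (dotp (U u) (U v)) = complex.Re (dotp u v).
  have := nrmD_sq (U u) (U v); have := nrmD_sq u v.
  by rewrite -isomD// !h.2 => ->; lra.
have im u v : complex.Im (dotp (U u) (U v)) = complex.Im (dotp u v).
  have := re (-'i%C *: u) v; rewrite isomZ// !dotZl.
  by case: (dotp (U u) _) => p q; case: (dotp u v) => r s /=; lra.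
by apply/eqP; rewrite eq_complex re im !eqxx.
Qed.

Lemma unitary_comp U V : unitary U -> unitary V -> unitary (U \o V).
Proof.
move=> [lU dU sU] [lV dV sV]; split=> [a x y|x y|y] /=.
- by rewrite lV lU.
- by rewrite dU dV.
- by have [z <-] := sU y; have [w <-] := sV z; exists w.
Qed.

Lemma unitary_id : unitary (id : H -> H).
Proof. by split=> // y; exists y. Qed.

(** Telescoping: [U] does not expand the errors already made. [V] is arbitrary, and the defect is
    needed only along its orbit. *)
Lemma isom_iter_diff U V n x (d : R) : isom U ->
  (forall i, (i < n)%N -> nrm (U (iter i V x) - V (iter i V x)) <= d) ->
  nrm (iter n U x - iter n V x) <= n%:R * d.
Proof.
move=> hU; elim: n => [|n IH] h; first by rewrite subrr nrm0 mul0r.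
rewrite !iterS; apply: le_trans (nrmB_le _ (U (iter n V x)) _) _.
rewrite isom_dist// -natr1 mulrDl mul1r lerD ?h//.
by apply: IH => i ni; apply: h; apply: ltnW.
Qed.

End Isometries.

(** * Orthonormal bases and truncations *)

Section OrthonormalBasis.
Context (R : realType) (H : hilbertType R) (e : nat -> H).
Hypothesis be : orthonormal_basis e.
Implicit Types (x y z : H) (a b c : R[i]) (U V W : H -> H) (N M : nat).

Lemma dot_basis m n : dotp (e m) (e n) = (m == n)%:R.
Proof. by have [h _] := be. Qed.

Lemma nrm_basis n : nrm (e n) = 1.
Proof.
apply/eqP; rewrite -(eqrXn2 (n:=2)) ?nrm_ge0// nrm_sq dot_basis eqxx.
by rewrite expr1n.
Qed.

Definition proj N x : H := \sum_(k < N) dotp x (e k) *: e k.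

Lemma proj_lin N a x y : proj N (a *: x + y) = a *: proj N x + proj N y.
Proof.
rewrite /proj scaler_sumr -big_split; apply: eq_bigr => k _ /=.
by rewrite dotDl dotZl scalerDl scalerA.
Qed.

Lemma projD N x y : proj N (x + y) = proj N x + proj N y.
Proof. by rewrite -[x in LHS]scale1r proj_lin scale1r. Qed.
Lemma proj0 N : proj N 0 = 0.
Proof. by rewrite /proj big1// => k _; rewrite dot0l scale0r. Qed.
Lemma projZ N a x : proj N (a *: x) = a *: proj N x.
Proof. by rewrite -[a *: x]addr0 proj_lin proj0 addr0. Qed.
Lemma projB N x y : proj N (x - y) = proj N x - proj N y.
Proof. by rewrite projD -scaleN1r projZ scaleN1r. Qed.

Lemma dot_proj N x j : dotp (proj N x) (e j) = if (j < N)%N then dotp x (e j) else 0.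
Proof.
rewrite dot_suml; case: ltnP => jN.
  rewrite (bigD1 (Ordinal jN))//= big1 => [|k].
    by rewrite dotZl dot_basis eqxx mulr1 addr0.
  by rewrite -val_eqE /= => /negPf kj; rewrite dotZl dot_basis kj mulr0.
rewrite big1 // => k _; rewrite dotZl dot_basis ltn_eqF ?mulr0//.
exact: leq_trans jN.
Qed.

(** The span of [e 0, ..., e (N-1)], encoded by the fixed points of its projection so that
    membership is an equation. *)
Definition inF N x := proj N x = x.

Lemma proj_proj N M x : (N <= M)%N -> proj M (proj N x) = proj N x.
Proof.
move=> NM; rewrite [RHS](big_ord_widen _ (fun k => dotp x (e k) *: e k) NM).
rewrite [RHS]big_mkcond /=; apply: eq_bigr => k _; rewrite dot_proj.
by case: ifP => // _; rewrite scale0r.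
Qed.

Lemma inF_proj N x : inF N (proj N x).
Proof. exact: proj_proj. Qed.

Lemma inFW N M x : (N <= M)%N -> inF N x -> inF M x.
Proof. by move=> NM <-; exact: proj_proj. Qed.

Lemma inF_lin N a x y : inF N x -> inF N y -> inF N (a *: x + y).
Proof. by rewrite /inF proj_lin => -> ->. Qed.

Lemma inF0 N : inF N 0. Proof. exact: proj0. Qed.
Lemma inFZ N a x : inF N x -> inF N (a *: x).
Proof. by rewrite /inF projZ => ->. Qed.
Lemma inFD N x y : inF N x -> inF N y -> inF N (x + y).
Proof. by rewrite /inF projD => -> ->. Qed.
Lemma inF_sum N (I : Type) (s : seq I) (P : pred I) (F : I -> H) :
  (forall i, P i -> inF N (F i)) -> inF N (\sum_(i <- s | P i) F i).
Proof. by move=> h; apply: big_ind => //; [exact: inF0 | exact: inFD]. Qed.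

Lemma inF_basis N j : (j < N)%N -> inF N (e j).
Proof.
move=> jN; rewrite /inF /proj (bigD1 (Ordinal jN))//= big1 => [|k].
  by rewrite dot_basis eqxx scale1r addr0.
by rewrite -val_eqE /= => /negPf kj; rewrite dot_basis eq_sym kj scale0r.
Qed.

Lemma span_inF x : span_seq e x -> exists N, inF N x.
Proof.
move=> [N [c ->]]; exists N; apply: inF_sum => k _; apply: inFZ.
exact: inF_basis.
Qed.

Lemma span_basis j : span_seq e (e j).
Proof.
exists j.+1, (fun k => dotp (e j) (e k)).
by have := @inF_basis j.+1 j (ltnSn j).
Qed.

Lemma dot_subproj N x y : inF N y -> dotp (x - proj N x) y = 0.
Proof.
move=> <-; rewrite dotC dot_suml big1 ?conjc0// => k _.
by rewrite dotZl (dotC (e k)) dotBl dot_proj ltn_ord subrr conjc0 mulr0.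
Qed.

Lemma pythagoras_proj N x y : inF N y ->
  nrm (x - y) ^+ 2 = nrm (x - proj N x) ^+ 2 + nrm (proj N x - y) ^+ 2.
Proof.
move=> Fy; rewrite -[x - y](subrKA (proj N x)) (nrmD_sq (x - _)).
rewrite dot_subproj ?Re0 ?mulr0 ?addr0//.
by rewrite /inF projB Fy inF_proj.
Qed.

Lemma proj_best N x y : inF N y -> nrm (x - proj N x) <= nrm (x - y).
Proof.
move=> /(pythagoras_proj x) h.
rewrite -(ler_pXn2r (n:=2)) ?nnegrE ?nrm_ge0//.
by rewrite h lerDl sqr_ge0.
Qed.

Lemma nrm_proj_le N x : nrm (proj N x) <= nrm x.
Proof.
rewrite -(ler_pXn2r (n:=2)) ?nnegrE ?nrm_ge0//.
have := pythagoras_proj x (inF0 N); rewrite !subr0 => ->.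
by rewrite lerDr sqr_ge0.
Qed.

Lemma proj_approx x (r : R) : 0 < r ->
  exists N, forall M, (N <= M)%N -> nrm (x - proj M x) < r.
Proof.
move=> r0; have [_ de] := be; have [y /span_inF[N Fy] xy] := dense_nrm x de r0.
exists N => M NM; apply: le_lt_trans xy; apply: proj_best; exact: inFW Fy.
Qed.

Lemma coef_le x k : normc (dotp x (e k)) <= nrm x.
Proof. by apply: le_trans (cauchy_schwarz _ _) _; rewrite nrm_basis mulr1. Qed.

Lemma nrm_proj_sub n m x : (n <= m)%N ->
  nrm (proj m x - proj n x) ^+ 2 = \sum_(n <= k < m) normc (dotp x (e k)) ^+ 2.
Proof.
elim: m => [|m IH].
  by rewrite leqn0 => /eqP->; rewrite subrr nrm0 expr0n big_geq.
rewrite leq_eqVlt => /predU1P[->|].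
  by rewrite subrr nrm0 expr0n big_geq.
rewrite ltnS => nm; rewrite big_nat_recr//= -IH// /proj big_ord_recr /= -!/(proj _ _).
rewrite addrAC (nrmD_sq (_ - _)) nrmZ nrm_basis mulr1 dotZr dotBl !dot_proj ltnn.
by rewrite ltnNge nm /= subrr mulr0 Re0 mulr0 addr0.
Qed.

(** The partial sums are the squared norms of [proj m x - proj n x], and [proj m x] tends to [x]; no
    infinite series is involved. *)
Lemma parseval_tail n x (r : R) : 0 <= r ->
  (forall m, (n <= m)%N ->
     \sum_(n <= k < m) normc (dotp x (e k)) ^+ 2 <= r ^+ 2) ->
  nrm (x - proj n x) <= r.
Proof.
move=> r0 h; apply/ler_addgt0Pr => d d0.
have [N hN] := proj_approx x d0; pose m := maxn N n.
apply: le_trans (nrmB_le _ (proj m x) _) _; rewrite addrC lerD//.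
  rewrite -(ler_pXn2r (n:=2)) ?nnegrE ?nrm_ge0//.
  by rewrite nrm_proj_sub ?leq_maxr// h ?leq_maxr.
by apply/ltW/hN; exact: leq_maxl.
Qed.

(** Triangle inequality over the coefficients of [x]. The factor [N] is crude ([sqrt N] would do),
    but [N] is always fixed before [d]. *)
Lemma nrm_diff_inF N U V x (d : R) : isom U -> isom V ->
  (forall j, (j < N)%N -> nrm (V (e j) - U (e j)) <= d) ->
  inF N x -> nrm (V x - U x) <= N%:R * d * nrm x.
Proof.
move=> hU hV h Fx.
have expand W : isom W -> W x = \sum_(k < N) dotp x (e k) *: W (e k).
  by move=> hW; rewrite -{1}Fx isom_sum//; apply: eq_bigr => k _; rewrite isomZ.
rewrite !expand// -sumrB.
apply: le_trans (nrm_sum _ _ _) _.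
have -> : N%:R * d * nrm x = \sum_(k < N) d * nrm x.
  by rewrite sumr_const card_ord -[RHS]mulr_natl mulrA.
apply: ler_sum => k _; rewrite -scalerBr nrmZ mulrC.
by apply: ler_pM; rewrite ?nrm_ge0 ?normc_ge0 ?h ?coef_le.
Qed.

End OrthonormalBasis.

(** * Stone's theorem *)

Section Limits.
Context (R : realType) (H : hilbertType R).
Implicit Types (u v : nat -> H) (x y l : H).

Definition lims u l := forall r : R, 0 < r ->
  exists N, forall n, (N <= n)%N -> nrm (u n - l) < r.

Lemma lims_le u l x (b : R) : lims u l -> (forall n, nrm (u n - x) <= b) ->
  nrm (l - x) <= b.
Proof.
move=> ul ub; apply/ler_addgt0Pr => r /ul[N hN].
apply: le_trans (nrmB_le _ (u N) _) _.
by rewrite addrC lerD// nrmBC ltW// hN.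
Qed.

Lemma lims_unique u l l' : lims u l -> lims u l' -> l = l'.
Proof.
move=> ul ul'; apply/eqP; rewrite -subr_eq0; apply/eqP/nrm_eps => r r0.
have r2 : 0 < r / 2 by rewrite divr_gt0.
have [N hN] := ul _ r2; have [N' hN'] := ul' _ r2.
apply: le_trans (nrmB_le _ (u (maxn N N')) _) _; rewrite nrmBC.
have := hN _ (leq_maxl N N'); have := hN' _ (leq_maxr N N'); lra.
Qed.

Lemma lims_cst x : lims (fun=> x) x.
Proof. by move=> r r0; exists 0 => n _; rewrite subrr nrm0. Qed.

Lemma limsD u v x y : lims u x -> lims v y -> lims (fun n => u n + v n) (x + y).
Proof.
move=> ux vy r r0; have r2 : 0 < r / 2 by rewrite divr_gt0.
have [N hN] := ux _ r2; have [N' hN'] := vy _ r2.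
exists (maxn N N') => n; rewrite geq_max => /andP[/hN h1 /hN' h2].
rewrite opprD addrACA; apply: le_lt_trans (nrmD _ _) _; lra.
Qed.

Lemma limsZ u x (a : R[i]) : lims u x -> lims (fun n => a *: u n) (a *: x).
Proof.
move=> ux r r0; have a0 := normc_ge0 a.
have a1 : 0 < normc a + 1 by lra.
have [N hN] := ux _ (divr_gt0 r0 a1).
exists N => n /hN; rewrite -scalerBr nrmZ ltr_pdivlMr// => h.
by apply: le_lt_trans h; rewrite mulrC ler_wpM2l ?nrm_ge0//; lra.
Qed.

Lemma lims_squeeze u v l (b : R) : 0 <= b -> lims v l ->
  (forall n, nrm (u n - v n) <= b / n.+1%:R) -> lims u l.
Proof.
move=> b0 vl uv r r0; have b1 : 0 < b + 1 by lra.
have r2 : 0 < r / 2 by rewrite divr_gt0.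
have [N hN] := vl _ r2; have [N' hN'] := invS_small (divr_gt0 r2 b1).
exists (maxn N N') => n; rewrite geq_max => /andP[/hN h1 /hN' h2].
apply: le_lt_trans (nrmB_le _ (v n) _) _.
have := uv n; move: h2; move: (n.+1%:R^-1) (invr_gt0 (n.+1%:R : R)) => q.
rewrite ltr0Sn => q0; rewrite ltr_pdivlMr// => h2 h3; nra.
Qed.

Lemma lims_nrm u l (b : R) : lims u l -> (forall n, nrm (u n) = b) -> nrm l = b.
Proof.
move=> ul ub; apply/eqP; rewrite eq_le; apply/andP; split.
  rewrite -(subr0 l); apply: lims_le ul _ => n; by rewrite subr0 ub.
apply/ler_addgt0Pr => r /ul[N hN].
rewrite -(ub N) -{1}(subrK l (u N)) addrC.
by apply: le_trans (nrmD _ _) _; rewrite lerD2l ltW// hN.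
Qed.

Lemma isom_ext_dense (D : set H) (U V : H -> H) : isom U -> isom V ->
  (forall x (r : R), 0 < r -> exists2 y, D y & nrm (x - y) < r) ->
  (forall x, D x -> U x = V x) -> U = V.
Proof.
move=> hU hV dD UV; apply/funext => x; apply/eqP; rewrite -subr_eq0.
apply/eqP/nrm_eps => r r0; have [y Dy xy] := dD x _ (divr_gt0 r0 (ltr0n _ 2)).
apply: le_trans (nrmB_le _ (U y) _) _; rewrite [in X in _ + X]UV// !isom_dist//.
rewrite (nrmBC y); lra.
Qed.

End Limits.

Section Stone.
Context (R : realType) (H : hilbertType R) (L : operator H).
Hypothesis sL : skew_adjoint L.
Implicit Types (x y z w : H) (h s t : R).

Let D := op_dom L.

Lemma skewE x y : D x -> D y -> dotp (L x) y = - dotp x (L y).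
Proof.
move=> Dx Dy; have [_ _ /(_ y (- L y))[_ h]] := sL.
by rewrite (h (conj Dy erefl) x Dx) dotNr.
Qed.

Lemma skew_Re x : D x -> complex.Re (dotp (L x) x) = 0.
Proof.
move=> Dx; have := skewE Dx Dx; rewrite [in RHS]dotC.
by case: (dotp (L x) x) => a b /= [] ; lra.
Qed.

Lemma skew_domL (a : R[i]) x y : D x -> D y -> D (a *: x + y).
Proof. by move=> Dx Dy; have [[_ l] _ _] := sL; have [] := l a x y Dx Dy. Qed.

Lemma skewL (a : R[i]) x y : D x -> D y -> L (a *: x + y) = a *: L x + L y.
Proof. by move=> Dx Dy; have [[_ l] _ _] := sL; have [] := l a x y Dx Dy. Qed.

Lemma skew_dom0 : D 0. Proof. by have [[]] := sL. Qed.

Lemma skewB x y : D x -> D y -> L (x - y) = L x - L y.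
Proof.
by move=> Dx Dy; rewrite -scaleN1r addrC skewL// scaleN1r addrC.
Qed.

Lemma skew_domB x y : D x -> D y -> D (x - y).
Proof. by move=> Dx Dy; rewrite -scaleN1r addrC; exact: skew_domL. Qed.

(** [L] is minus its own adjoint, and adjoints are closed. *)
Lemma skew_closed x y :
  (forall r : R, 0 < r -> exists2 w, D w & nrm (x - w) < r /\ nrm (y - L w) < r) ->
  D x /\ y = L x.
Proof.
move=> cl; have [_ _ /(_ x (- y))[h _]] := sL.
suff /h[Dx /oppr_inj] : op_adjoint L x (- y) by [].
move=> w Dw; apply/eqP; rewrite -subr_eq0; apply/eqP/Normc.eq0_normc/eqP.
rewrite eq_le normc_ge0 andbT; apply/ler_addgt0Pr => r r0; rewrite add0r.
pose b := nrm (L w) + nrm w + 1.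
have b0 : 0 < b by rewrite /b; have := nrm_ge0 (L w); have := nrm_ge0 w; lra.
have [v Dv [xv yv]] := cl _ (divr_gt0 r0 b0).
have -> : dotp (L w) x - dotp w (- y) = dotp (L w) (x - v) + dotp w (y - L v).
  rewrite dotNr !dotBr (skewE Dw Dv); ring.
apply: le_trans (le_normcD _ _) _.
apply: le_trans (lerD (cauchy_schwarz _ _) (cauchy_schwarz _ _)) _.
have -> : r = b * (r / b) by field; rewrite gt_eqF.
apply: le_trans (_ : (nrm (L w) + nrm w) * (r / b) <= _).
  by rewrite mulrDl lerD// ler_wpM2l ?nrm_ge0// ltW.
by rewrite ler_wpM2r ?divr_ge0 ?ltW// /b; lra.
Qed.

(** Since [Re <L x, x> = 0], the cross term vanishes. This identity yields injectivity, closedness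
    of the range and the contraction property of the resolvent, for both signs of [h]. *)
Lemma resolvent_nrm h x : D x ->
  nrm (x - h%:C *: L x) ^+ 2 = nrm x ^+ 2 + h ^+ 2 * nrm (L x) ^+ 2.
Proof.
move=> Dx; rewrite nrmB_sq dotZr conjc_real ReMr dot_Re_sym skew_Re//.
by rewrite nrmZr exprMn real_normK ?num_real//; ring.
Qed.

(** The range of [1 - h L] is closed, by [resolvent_nrm] and the closedness of [L]. A vector [y]
    orthogonal to it lies in the domain of the adjoint, with [y + h L y = 0], and the same identity
    for [-h] forces [y = 0]. *)
Lemma resolvent_surj h z : h != 0 -> exists2 x, D x & x - h%:C *: L x = z.
Proof.
move=> h0; pose S := [set x - h%:C *: L x | x in D].
suff : S z by move=> [x]; exists x.
have h2 : 0 < h ^+ 2 by rewrite lt_neqAle sqr_ge0 eq_sym sqrf_eq0 h0.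
have lin a x y : D x -> D y -> a *: (x - h%:C *: L x) + (y - h%:C *: L y) =
    a *: x + y - h%:C *: L (a *: x + y).
  move=> Dx Dy; rewrite skewL// scalerBr scalerDr opprD addrACA.
  by rewrite !scalerA mulrC.
apply: closed_subspace_full.
- exists 0; first exact: skew_dom0.
  have := skewB skew_dom0 skew_dom0; rewrite !subrr => ->.
  by rewrite scaler0 subr0.
- move=> a _ _ [x Dx <-] [y Dy <-].
  by exists (a *: x + y); [exact: skew_domL | rewrite lin].
- move=> {}z cl.
  have ad n : exists x, D x /\ nrm (z - (x - h%:C *: L x)) < n.+1%:R^-1.
    have [|_ [x Dx <-] xz] := cl n.+1%:R^-1; first by rewrite invr_gt0 ltr0Sn.
    by exists x.
  have [u /all_and2[Du hu]] := choice ad.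
  have cau (r : R) : 0 < r -> exists N, forall m n, (N <= m)%N -> (N <= n)%N ->
      nrm (u m - u n) ^+ 2 + h ^+ 2 * nrm (L (u m) - L (u n)) ^+ 2 < r ^+ 2.
    move=> r0; have r2 : 0 < r / 2 by rewrite divr_gt0.
    have [N hN] := invS_small r2; exists N => m n Nm Nn.
    rewrite -skewB// -resolvent_nrm; last exact: skew_domB.
    have -> : u m - u n - h%:C *: L (u m - u n) =
        (u m - h%:C *: L (u m)) - (u n - h%:C *: L (u n)).
      by rewrite skewB// scalerBr !opprB addrACA [in RHS]addrACA [- u n + _]addrC.
    rewrite ltr_pXn2r ?nnegrE ?nrm_ge0 ?ltW//.
    apply: le_lt_trans (nrmB_le _ z _) _; rewrite nrmBC.
    have := lt_trans (hu m) (hN _ Nm); have := lt_trans (hu n) (hN _ Nn); lra.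
  have [x hx] : exists x, lims u x.
    apply: nrm_complete => r r0; have [N hN] := cau r r0.
    exists N => m n /hN hm /hm {hm} hmn.
    rewrite -(ltr_pXn2r (n:=2)) ?nnegrE ?nrm_ge0 ?ltW//.
    apply: le_lt_trans hmn; rewrite lerDl mulr_ge0 ?sqr_ge0//.
  have [y hy] : exists y, lims (L \o u) y.
    apply: nrm_complete => r r0.
    have [|N hN] := cau (`|h| * r); first by rewrite mulr_gt0// normr_gt0.
    exists N => m n /hN hm /hm {hm} /= hmn.
    rewrite -(ltr_pXn2r (n:=2)) ?nnegrE ?nrm_ge0 ?ltW//.
    rewrite -(ltr_pM2l h2).
    move: hmn; rewrite exprMn real_normK ?num_real//; apply: le_lt_trans.
    by rewrite lerDr sqr_ge0.
  have [Dx yE] : D x /\ y = L x.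
    apply: skew_closed => r r0; have [N hN] := hx r r0; have [N' hN'] := hy r r0.
    exists (u (maxn N N')) => //; split; rewrite nrmBC.
      by apply: hN; exact: leq_maxl.
    by apply: hN'; exact: leq_maxr.
  exists x => //; rewrite -yE.
  have l1 : lims (fun n => u n - h%:C *: L (u n)) (x - h%:C *: y).
    have := limsD hx (limsZ (- h%:C) hy).
    rewrite scaleNr => l r /l[N hN].
    by exists N => n /hN /=; rewrite scaleNr.
  apply: lims_unique l1 _; apply: (lims_squeeze (b := 1)) (lims_cst z) _ => // n.
  by rewrite nrmBC mul1r ltW.
- move=> y hy.
  have [Dy] : D y /\ (h^-1)%:C *: y = - L y.
    have [_ _ /(_ y ((h^-1)%:C *: y))[g _]] := sL; apply: g => x Dx.
    have /eqP := hy _ (ex_intro2 _ _ x Dx erefl).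
    rewrite dotBl dotZl subr_eq0 => /eqP xy.
    by rewrite dotZr conjc_real xy mulrA -rmorphM /= mulVf// mul1r.
  move/(congr1 (fun w => h%:C *: w)); rewrite scalerA -rmorphM mulfV// scale1r => E.
  have := resolvent_nrm (- h) Dy.
  have -> : y - (- h)%:C *: L y = 0.
    by rewrite {1}E rmorphN /= scaleNr opprK scalerN addNr.
  rewrite nrm0 expr0n /= => q; apply: nrm_eq0; apply/eqP; rewrite -sqrf_eq0.
  have p1 := sqr_ge0 (nrm y).
  have p2 : 0 <= (- h) ^+ 2 * nrm (L y) ^+ 2 by rewrite mulr_ge0 ?sqr_ge0.
  rewrite eq_le p1 andbT; lra.
Qed.

(* [resolvent h] inverts [1 - h L]; at [h = 0], where the range of [1 - h L] is
   only [D], it is set to the identity. *)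
Definition resolvent h z : H :=
  if h == 0 then z else xget 0 [set x | D x /\ x - h%:C *: L x = z].
Let J := resolvent.

Lemma resolventP h z : h != 0 -> D (J h z) /\ J h z - h%:C *: L (J h z) = z.
Proof.
move=> h0; rewrite /J /resolvent (negPf h0); case: xgetP => [x _ //|].
by have [x Dx xz] := resolvent_surj z h0 => /(_ x) /(_ (conj Dx xz)).
Qed.

Lemma resolvent_uniq h x z : h != 0 -> D x -> x - h%:C *: L x = z -> J h z = x.
Proof.
move=> h0 Dx xz; have [DJ JE] := resolventP z h0.
apply/eqP; rewrite -subr_eq0; apply/eqP; apply: nrm_eq0; apply/eqP.
rewrite -sqrf_eq0; have := resolvent_nrm h (skew_domB DJ Dx).
have -> : J h z - x - h%:C *: L (J h z - x) = 0.
  rewrite skewB// scalerBr opprB addrACA [- x + _]addrC addrACA JE.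
  by rewrite -xz addrC subrKA subrr.
rewrite nrm0 expr0n /= => q.
have p1 := sqr_ge0 (nrm (J h z - x)).
have p2 : 0 <= h ^+ 2 * nrm (L (J h z - x)) ^+ 2 by rewrite mulr_ge0 ?sqr_ge0.
rewrite eq_le p1 andbT; lra.
Qed.

Lemma resolvent_lin h a x y : J h (a *: x + y) = a *: J h x + J h y.
Proof.
have [->|h0] := eqVneq h 0; first by rewrite /J /resolvent eqxx.
have [Dx xE] := resolventP x h0; have [Dy yE] := resolventP y h0.
apply: resolvent_uniq => //; first exact: skew_domL.
rewrite skewL// -[in RHS]xE -[in RHS]yE [in LHS]scalerDr [in RHS]scalerBr opprD addrACA.
by rewrite !scalerA mulrC.
Qed.

Lemma resolventB h x y : J h (x - y) = J h x - J h y.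
Proof. by rewrite addrC -scaleN1r resolvent_lin scaleN1r addrC. Qed.

Lemma resolvent_le h z : nrm (J h z) <= nrm z.
Proof.
have [->|h0] := eqVneq h 0; first by rewrite /J /resolvent eqxx.
have [DJ JE] := resolventP z h0.
rewrite -(ler_pXn2r (n:=2)) ?nnegrE ?nrm_ge0//.
by rewrite -{2}JE resolvent_nrm// lerDl mulr_ge0 ?sqr_ge0.
Qed.

Lemma resolvent_dom h x : D x -> D (J h x).
Proof.
have [->|h0] := eqVneq h 0; first by rewrite /J /resolvent eqxx.
by move=> _; have [] := resolventP x h0.
Qed.

Lemma resolvent_comm h x : D x -> L (J h x) = J h (L x).
Proof.
move=> Dx; have [->|h0] := eqVneq h 0; first by rewrite /J /resolvent eqxx.
have [DJ JE] := resolventP x h0.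
have LE : L (J h x) = (h^-1)%:C *: (J h x - x).
  by rewrite -[in X in _ - X]JE opprB addrC subrK scalerA -rmorphM mulVf// scale1r.
apply/esym; apply: resolvent_uniq => //.
  rewrite LE -[_ *: _]addr0; apply: skew_domL; last exact: skew_dom0.
  exact: skew_domB.
rewrite [in L (L _)]LE -[(h^-1)%:C *: _]addr0 skewL; [|exact: skew_domB|exact: skew_dom0].
have -> : L 0 = 0 by have := skewB skew_dom0 skew_dom0; rewrite !subrr.
rewrite addr0 scalerA -rmorphM mulfV// scale1r skewB//.
by rewrite opprB addrC subrK.
Qed.

Lemma resolvent_sub h x : D x -> J h x - x = h%:C *: J h (L x).
Proof.
move=> Dx; have [->|h0] := eqVneq h 0.
  by rewrite /J /resolvent eqxx subrr scale0r.
have [DJ JE] := resolventP x h0.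
by rewrite -resolvent_comm// -[in X in _ - X]JE opprB addrC subrK.
Qed.

Lemma resolvent_commute s t z : J s (J t z) = J t (J s z).
Proof.
have [->|s0] := eqVneq s 0; first by rewrite /J /resolvent eqxx.
have [->|t0] := eqVneq t 0; first by rewrite /J /resolvent eqxx.
have [Dw wE] := resolventP z t0; set w := J t z in Dw wE *.
apply/esym; apply: resolvent_uniq => //; first exact: resolvent_dom.
rewrite resolvent_comm// -[in RHS]wE -!scaleNr ![_ + (- _) *: _]addrC.
by rewrite resolvent_lin.
Qed.


(* The Cayley transform (1 + (h/2) L) / (1 - (h/2) L) is unitary, and the group
   generated by L is the strong limit of its powers C_{t/2^k}^{2^k}: on D(L^2) two
   consecutive terms differ by O(2^-k). *)
Definition cayley h z : H := 2%:C *: J (h / 2) z - z.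
Let C := cayley.

Let scale2 z : 2%:C *: z = z + z.
Proof. by rewrite -[2%:C]/((1 + 1)%:C) rmorphD /= scalerDl !scale1r. Qed.

Lemma cayley_lin h a x y : C h (a *: x + y) = a *: C h x + C h y.
Proof.
by rewrite /C /cayley resolvent_lin; vec.
Qed.

(** With [x = J (h/2) z], one has [z = x - (h/2) L x] and [C h z = x + (h/2) L x], two vectors of
    the same norm by [resolvent_nrm]. *)
Lemma cayley_isom h : isom (C h).
Proof.
split; first exact: cayley_lin.
move=> z; rewrite /C /cayley; have [->|h0] := eqVneq h 0.
  by rewrite mul0r /J /resolvent eqxx scale2 addrK.
have h20 : h / 2 != 0 by rewrite mulf_neq0// invr_neq0// pnatr_eq0.
have [Dx xE] := resolventP z h20; set x := J (h / 2) z in Dx xE *.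
have -> : 2%:C *: x - z = x - (- (h / 2))%:C *: L x.
  by rewrite -xE; vec.
apply/eqP; rewrite -(eqrXn2 (n:=2)) ?nrm_ge0// -[in X in _ == X]xE.
by rewrite !resolvent_nrm// sqrrN.
Qed.

Lemma cayley_sub h x : D x -> C h x - x = h%:C *: J (h / 2) (L x).
Proof.
move=> Dx; rewrite /C /cayley -addrA -opprD -scale2 -scalerBr resolvent_sub//.
by rewrite scalerA -rmorphM mulrC divfK// pnatr_eq0.
Qed.

Lemma cayley_dom h x : D x -> D (C h x).
Proof.
move=> Dx; rewrite /C /cayley; apply: skew_domB => //.
rewrite -[_ *: _]addr0; apply: skew_domL; last exact: skew_dom0.
exact: resolvent_dom.
Qed.

Lemma cayley_comm h x : D x -> L (C h x) = C h (L x).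
Proof.
move=> Dx; rewrite /C /cayley skewB//.
  rewrite -resolvent_comm// scale2.
  have := skewL 1 (resolvent_dom (h / 2) Dx) (resolvent_dom (h / 2) Dx).
  by rewrite !scale1r scale2 => ->.
rewrite -[_ *: _]addr0; apply: skew_domL; last exact: skew_dom0.
exact: resolvent_dom.
Qed.

Lemma cayley_commute s t z : C s (C t z) = C t (C s z).
Proof.
have Jc h w a b : J h (a *: w - b) = a *: J h w - J h b.
  have J0 : J h 0 = 0.
    by have := resolvent_lin h (-1) 0 0; rewrite scaler0 addr0 scaleN1r addNr.
  rewrite -scaleN1r addrC resolvent_lin -{1}[a *: w]addr0 resolvent_lin J0; vec.
rewrite /C /cayley !Jc resolvent_commute; vec.
Qed.

(** The domain of [L^2], a dense set stable under the Cayley transforms on which expansions have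
    quadratic remainders. *)
Let D2 x := D x /\ D (L x).

Lemma cayley_le h x : D x -> nrm (C h x - x) <= `|h| * nrm (L x).
Proof.
by move=> Dx; rewrite cayley_sub// nrmZr ler_wpM2l// resolvent_le.
Qed.

Lemma cayley_taylor h x : D2 x ->
  nrm (C h x - x - h%:C *: L x) <= h ^+ 2 / 2 * nrm (L (L x)).
Proof.
move=> [Dx DLx]; rewrite cayley_sub// -scalerBr resolvent_sub// scalerA -rmorphM.
have h2 : 0 <= h ^+ 2 / 2 by rewrite divr_ge0 ?sqr_ge0.
rewrite nrmZr mulrA -expr2 ger0_norm//.
by rewrite ler_wpM2l ?resolvent_le.
Qed.

Lemma cayley_dom2 h x : D2 x -> D2 (C h x).
Proof.
move=> [Dx DLx]; split; first exact: cayley_dom.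
by rewrite cayley_comm//; exact: cayley_dom.
Qed.

Lemma cayley_L2 h x : D2 x -> L (L (C h x)) = C h (L (L x)).
Proof. by move=> [Dx DLx]; rewrite cayley_comm// cayley_comm. Qed.

(** The expansions of both sides agree to first order. What is left is quadratic: the three
    remainders and [t (C s (L x) - L x)], which is [O(s t)]. *)
Lemma cayley_semi s t x : D2 x ->
  nrm (C s (C t x) - C (s + t) x) <= (`|s| + `|t|) ^+ 2 * nrm (L (L x)).
Proof.
move=> D2x; have [Dx DLx] := D2x; set q := nrm (L (L x)).
have ht := cayley_taylor t D2x; have hs := cayley_taylor s D2x.
have hst := cayley_taylor (s + t) D2x; have hl := cayley_le s DLx.
rewrite -/q in ht hs hst hl.
set rt := C t x - x - t%:C *: L x in ht; set rs := C s x - x - s%:C *: L x in hs.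
set rst := C (s + t) x - x - (s + t)%:C *: L x in hst.
have E : C s (C t x) - C (s + t) x =
    C s rt + t%:C *: (C s (L x) - L x) + rs - rst.
  have -> : C t x = rt + (t%:C *: L x + x) by rewrite /rt; vec.
  have -> : C (s + t) x = rst + ((s + t)%:C *: L x + x).
    by rewrite /rst; vec.
  rewrite (isomD _ _ (cayley_isom s)) (cayley_isom s).1.
  have -> : C s x = rs + (s%:C *: L x + x) by rewrite /rs; vec.
    move: (C s rt) (C s (L x)) (L x) => a b c.
  vec.
rewrite E.
have q0 : 0 <= q by exact: nrm_ge0.
apply: le_trans (nrmB_le _ 0 _) _; rewrite subr0 sub0r nrmN.
have h1 : nrm (C s rt + t%:C *: (C s (L x) - L x) + rs) <=
   t ^+ 2 / 2 * q + `|t| * (`|s| * q) + s ^+ 2 / 2 * q.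
  apply: le_trans (nrmD _ _) _; rewrite lerD//.
  apply: le_trans (nrmD _ _) _; rewrite lerD// ?(cayley_isom s).2//.
  by rewrite nrmZr ler_wpM2l.
apply: le_trans (lerD h1 hst) _.
have -> : t ^+ 2 / 2 * q + `|t| * (`|s| * q) + s ^+ 2 / 2 * q + (s + t) ^+ 2 / 2 * q =
    (t ^+ 2 / 2 + `|t| * `|s| + s ^+ 2 / 2 + (s + t) ^+ 2 / 2) * q by ring.
rewrite ler_wpM2r//.
have n1 := normr_ge0 s; have n2 := normr_ge0 t.
rewrite -(real_normK (num_real s)) -(real_normK (num_real t)) -(real_normK (num_real (s + t))).
have n3 := ler_normD s t; have n4 := normr_ge0 (s + t).
move: (`|s|) (`|t|) (`|s + t|) n1 n2 n3 n4 => a b c *; nra.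
Qed.

Lemma iter_commute (T : Type) (f g : T -> T) n (x : T) : (forall y : T, f (g y) = g (f y)) ->
  iter n (f \o g) x = iter n f (iter n g x).
Proof.
move=> fg; elim: n x => // n IH x; rewrite !iterS IH /=; congr f.
by elim: n (iter n g x) {IH} => //= n IH y; rewrite -IH fg.
Qed.

Lemma cayley_iter_dom2 h n x : D2 x ->
  D2 (iter n (C h) x) /\ nrm (L (L (iter n (C h) x))) = nrm (L (L x)).
Proof.
move=> D2x; elim: n => //= n [D2n IH]; split; first exact: cayley_dom2.
by rewrite cayley_L2// (cayley_isom h).2.
Qed.

Lemma cayley_iter_semi n s t x : D2 x ->
  nrm (iter n (C s \o C t) x - iter n (C (s + t)) x) <=
  n%:R * ((`|s| + `|t|) ^+ 2 * nrm (L (L x))).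
Proof.
move=> D2x; apply: isom_iter_diff => [|i _].
  by apply: isom_comp; exact: cayley_isom.
by have [D2i <-] := cayley_iter_dom2 (s + t) i D2x; exact: cayley_semi.
Qed.

Lemma cayley_iter_le n h x : D x ->
  nrm (iter n (C h) x - x) <= n%:R * `|h| * nrm (L x).
Proof.
move=> Dx; have := @isom_iter_diff _ _ (C h) id n x (`|h| * nrm (L x)) (cayley_isom h).
have iter_id i : iter i id x = x by elim: i => //= i ->.
by rewrite mulrA iter_id; apply => i _; rewrite iter_id; exact: cayley_le.
Qed.

(** For [h = t/n] the bound does not depend on [n], so it survives in the limit and gives the
    derivative of the group at 0. The induction adds [h^2/2 + n h^2], at most [(2 n + 1) h^2]. *)
Lemma cayley_iter_taylor n h x : D2 x ->
  nrm (iter n (C h) x - x - (n%:R * h)%:C *: L x) <=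
  n%:R ^+ 2 * h ^+ 2 * nrm (L (L x)).
Proof.
move=> D2x; have [Dx DLx] := D2x; set q := nrm (L (L x)).
have q0 : 0 <= q by exact: nrm_ge0.
elim: n => [|n IH].
  by rewrite mul0r subrr expr0n mul0r mul0r scale0r subrr nrm0.
rewrite iterS; set y := iter n (C h) x in IH *.
have -> : C h y - x - (n.+1%:R * h)%:C *: L x =
    C h (y - x - (n%:R * h)%:C *: L x) + (C h x - x - h%:C *: L x)
     + (n%:R * h)%:C *: (C h (L x) - L x).
  have ci := cayley_isom h; rewrite 2!(isomB _ _ ci) (isomZ _ _ ci) -natr1.
  move: (n%:R : R) (C h y) (C h x) (C h (L x)) (L x) => m a b c d; vec.
apply: le_trans (nrmD _ _) _; apply: le_trans (lerD (nrmD _ _) (lexx _)) _.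
rewrite (cayley_isom h).2 nrmZr normrM (ger0_norm (ler0n _ n)).
have h1 := cayley_taylor h D2x; rewrite -/q in h1.
have h2 : n%:R * `|h| * nrm (C h (L x) - L x) <= n%:R * h ^+ 2 * q.
  rewrite -(real_normK (num_real h)) expr2 -!mulrA ler_wpM2l// ler_wpM2l// .
  exact: cayley_le.
have n0 : 0 <= n%:R :> R by [].
have hq : 0 <= h ^+ 2 * q by rewrite mulr_ge0 ?sqr_ge0.
rewrite -natr1; move: (n%:R : R) n0 IH h2 => m m0 IH h2.
apply: le_trans (lerD (lerD IH h1) h2) _; rewrite -subr_ge0.
have -> : (m + 1) ^+ 2 * h ^+ 2 * q - (m ^+ 2 * h ^+ 2 * q + h ^+ 2 / 2 * q + m * h ^+ 2 * q) =
  (m + 2^-1) * (h ^+ 2 * q) by field.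
by rewrite mulr_ge0//; lra.
Qed.

Lemma resolvent_cvg x (r : R) : 0 < r ->
  exists2 h0, 0 < h0 & forall h, `|h| < h0 -> nrm (J h x - x) < r.
Proof.
move=> r0; have r4 : 0 < r / 4 by rewrite divr_gt0.
have [_ dD _] := sL; have [y Dy xy] := dense_nrm x dD r4.
have p0 := nrm_ge0 (L y); have p1 : 0 < nrm (L y) + 1 by lra.
exists (r / 4 / (nrm (L y) + 1)); first by rewrite divr_gt0.
move=> h; rewrite ltr_pdivlMr// => hh.
have h1 : nrm (J h y - y) < r / 4.
  rewrite resolvent_sub// nrmZr; apply: le_lt_trans hh.
  apply: ler_pM => //; first exact: nrm_ge0.
  by apply: le_trans (resolvent_le _ _) _; lra.
have h2 : nrm (J h x - J h y) < r / 4.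
  have -> : J h x - J h y = J h (x - y).
    by rewrite resolventB.
  exact: le_lt_trans (resolvent_le _ _) xy.
apply: le_lt_trans (nrmB_le _ (J h y) _) _.
apply: le_lt_trans (lerD (lexx _) (nrmB_le _ y _)) _.
rewrite nrmBC in xy; lra.
Qed.

(** [D(L^2)] is a core: [J h x] belongs to it and, for small [h], is close to [x] in graph norm
    because [J h] commutes with [L] and tends strongly to the identity. *)
Lemma dom2_core x (r : R) : D x -> 0 < r ->
  exists y, [/\ D2 y, nrm (x - y) < r & nrm (L x - L y) < r].
Proof.
move=> Dx r0; have [h1 p1 H1] := resolvent_cvg x r0.
have [h2 p2 H2] := resolvent_cvg (L x) r0.
pose h := Num.min h1 h2 / 2.
have m0 : 0 < Num.min h1 h2 by rewrite lt_min p1.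
have h0 : 0 < h by rewrite divr_gt0.
have hm : `|h| < Num.min h1 h2 by rewrite gtr0_norm// /h; lra.
move: hm; rewrite lt_min => /andP[l1 l2].
exists (J h x); split.
- split; first exact: resolvent_dom.
  by rewrite resolvent_comm//; have [] := resolventP (L x) (lt0r_neq0 h0).
- by rewrite nrmBC H1.
- by rewrite resolvent_comm// nrmBC H2.
Qed.

Lemma dom2_dense x (r : R) : 0 < r -> exists2 y, D2 y & nrm (x - y) < r.
Proof.
move=> r0; have r2 : 0 < r / 2 by rewrite divr_gt0.
have [_ dD _] := sL; have [z Dz xz] := dense_nrm x dD r2.
have [y [D2y zy _]] := dom2_core Dz r2; exists y => //.
apply: le_lt_trans (nrmB_le _ z _) _; lra.
Qed.

(** * Convergence of the Cayley approximations and the unitary group *)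

Definition cayley_approx k t := iter (2 ^ k) (C (t / (2 ^ k)%:R)).
Let Gk := cayley_approx.

Lemma cayley_approx_isom k t : isom (Gk k t).
Proof. by apply: isom_iter; exact: cayley_isom. Qed.

Let pow2_gt0 k : 0 < (2 ^ k)%:R :> R.
Proof. by rewrite ltr0n expn_gt0. Qed.

Let pow2_inv k : (2 ^ k)%:R^-1 <= k.+1%:R^-1 :> R.
Proof. by rewrite lef_pV2 ?posrE ?ltr0Sn// ler_nat ltn_expl. Qed.

(** Halving the step replaces each of the [2^k] factors [C (2 s)] by [C s] twice; [cayley_semi]
    charges [(t / 2^k)^2] per factor. *)
Lemma cayley_approx_step k t x : D2 x ->
  nrm (Gk k.+1 t x - Gk k t x) <= t ^+ 2 / (2 ^ k)%:R * nrm (L (L x)).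
Proof.
move=> D2x; have p0 := pow2_gt0 k.
set s := t / (2 ^ k.+1)%:R.
have ss : s + s = t / (2 ^ k)%:R.
  by rewrite /s expnS natrM; field; rewrite gt_eqF.
have -> : Gk k.+1 t x = iter (2 ^ k) (C s \o C s) x.
  by rewrite iter_commute// -iterD addnn -mul2n -expnS.
rewrite /Gk /cayley_approx -ss; apply: le_trans (cayley_iter_semi _ _ _ D2x) _.
have -> : `|s| + `|s| = `|t| / (2 ^ k)%:R.
  by rewrite -mulr2n -normrMn mulr2n ss normf_div normr_nat.
rewrite exprMn real_normK ?num_real// mulrA ler_wpM2r ?nrm_ge0//.
by rewrite le_eqVlt; apply/orP; left; apply/eqP; field; rewrite gt_eqF.
Qed.

Lemma cayley_approx_cauchy k j t x : D2 x ->
  nrm (Gk (k + j) t x - Gk k t x) <= 2 * t ^+ 2 * nrm (L (L x)) / k.+1%:R.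
Proof.
move=> D2x; set q := nrm (L (L x)).
have q0 : 0 <= t ^+ 2 * q by rewrite mulr_ge0 ?sqr_ge0 ?nrm_ge0.
(* Partial sum of a geometric series, in closed form so that the induction on [j] goes through;
   [2^-k] is finally weakened to [1/(k+1)]. *)
have : nrm (Gk (k + j) t x - Gk k t x) <=
    2 * (t ^+ 2 * q) * ((2 ^ k)%:R^-1 - (2 ^ (k + j))%:R^-1).
  elim: j => [|j IH]; first by rewrite addn0 !subrr nrm0 mulr0.
  apply: le_trans (nrmB_le _ (Gk (k + j) t x) _) _; rewrite addnS.
  have := cayley_approx_step (k + j) t D2x; rewrite -/q.
  rewrite [(2 ^ (k + j).+1)%N]expnS natrM invfM => h.
  apply: le_trans (lerD h IH) _.
  by move: ((2 ^ (k + j))%:R^-1) ((2 ^ k)%:R^-1) => a b; lra.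
move=> /le_trans; apply; rewrite mulrA ler_wpM2l//.
  by rewrite -mulrA mulr_ge0.
apply: le_trans (pow2_inv k); rewrite gerDl oppr_le0 invr_ge0; exact: ltW.
Qed.

Lemma cayley_approx_cvg t x : exists l, lims (fun k => Gk k t x) l.
Proof.
apply: nrm_complete => r r0; have r4 : 0 < r / 4 by rewrite divr_gt0.
have [y D2y xy] := dom2_dense x r4.
set q := 2 * t ^+ 2 * nrm (L (L y)).
have q0 : 0 <= q by rewrite /q mulr_ge0 ?nrm_ge0// mulr_ge0 ?sqr_ge0.
have q1 : 0 < q + 1 by lra.
have [N hN] := invS_small (divr_gt0 r4 q1).
have near n : (N <= n)%N -> nrm (Gk n t x - Gk N t y) < r / 2.
  move=> Nn; apply: le_lt_trans (nrmB_le _ (Gk n t y) _) _.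
  rewrite (isom_dist _ _ (cayley_approx_isom n t)).
  have := cayley_approx_cauchy N (n - N) t D2y; rewrite subnKC// -/q => h.
  have := hN _ (leqnn N); rewrite ltr_pdivlMr//.
  move: h (invr_gt0 (N.+1%:R : R)); rewrite ltr0Sn.
  move: (N.+1%:R^-1 : R) => u; nra.
exists N => m n /near hm /near hn; apply: le_lt_trans (nrmB_le _ (Gk N t y) _) _.
rewrite (nrmBC _ (Gk n t x)); lra.
Qed.

Definition stone_group t x : H := xget 0 [set l | lims (fun k => Gk k t x) l].
Let G := stone_group.

Lemma stoneP t x : lims (fun k => Gk k t x) (G t x).
Proof.
rewrite /G /stone_group; case: xgetP => [l _ //|h].
by have [l hl] := cayley_approx_cvg t x; case: (h l).
Qed.

Lemma stone_isom t : isom (G t).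
Proof.
split=> [a x y|x].
  apply: lims_unique (stoneP t _) _.
  have := limsD (limsZ a (stoneP t x)) (stoneP t y) => l r /l[N hN].
  by exists N => n /hN; rewrite (cayley_approx_isom n t).1.
by apply: lims_nrm (stoneP t x) _ => n; rewrite (cayley_approx_isom n t).2.
Qed.

(** Since Cayley transforms commute, the factors of step [s/2^k] can be paired with those of step
    [t/2^k]; on [D(L^2)] each pair differs from the transform of step [(s+t)/2^k] by [O(4^-k)]. *)
Lemma stoneD s t : G (s + t) = G s \o G t.
Proof.
apply: (isom_ext_dense (stone_isom _) (isom_comp (stone_isom s) (stone_isom t)) dom2_dense).
move=> x D2x; apply: lims_unique (stoneP _ _) _.
have p1 : lims (fun k => Gk k s (Gk k t x)) (G s (G t x)).
  move=> r r0; have r2 : 0 < r / 2 by rewrite divr_gt0.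
  have [N hN] := stoneP t x r2; have [N' hN'] := stoneP s (G t x) r2.
  exists (maxn N N') => n; rewrite geq_max => /andP[/hN h1 /hN' h2].
  apply: le_lt_trans (nrmB_le _ (Gk n s (G t x)) _) _.
  rewrite (isom_dist _ _ (cayley_approx_isom n s)); lra.
set q := (`|s| + `|t|) ^+ 2 * nrm (L (L x)).
have q0 : 0 <= q by rewrite mulr_ge0 ?sqr_ge0 ?nrm_ge0.
apply: (lims_squeeze (b := q)) p1 _ => // k.
have pk := pow2_gt0 k.
rewrite nrmBC {1 2}/Gk /cayley_approx -iter_commute; last first.
  by move=> y; exact: cayley_commute.
rewrite {1}/Gk /cayley_approx mulrDl; apply: le_trans (cayley_iter_semi _ _ _ D2x) _.
rewrite !normf_div normr_nat -mulrDl exprMn.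
apply: le_trans (_ : q * (2 ^ k)%:R^-1 <= _); last by rewrite ler_wpM2l.
by rewrite /q le_eqVlt; apply/orP; left; apply/eqP; field; rewrite gt_eqF.
Qed.

Lemma stone0 : G 0 = id.
Proof.
apply/funext => x; apply: lims_unique (stoneP 0 x) _.
move=> r r0; exists 0 => n _; rewrite /Gk /cayley_approx mul0r.
have -> : iter (2 ^ n) (C 0) x = x.
  elim: (2 ^ n)%N => //= m ->.
  by rewrite /C /cayley mul0r /J /resolvent eqxx scale2 addrK.
by rewrite subrr nrm0.
Qed.

(** Surjectivity does not pass to the limit; it comes from the inverse [G (- t)]. *)
Lemma stone_unitary t : unitary (G t).
Proof.
split; first exact: (stone_isom t).1.
- by move=> x y; exact: isom_dot (stone_isom t).
- move=> y; exists (G (- t) y).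
  by rewrite -[G t (G _ y)]/((G t \o G (- t)) y) -stoneD subrr stone0.
Qed.

Lemma stone_le t x : D x -> nrm (G t x - x) <= `|t| * nrm (L x).
Proof.
move=> Dx; apply: lims_le (stoneP t x) _ => k.
apply: le_trans (cayley_iter_le _ _ Dx) _.
rewrite normf_div normr_nat mulrCA mulfV ?mulr1// gt_eqF//; exact: pow2_gt0.
Qed.

Lemma stone_taylor2 t x : D2 x ->
  nrm (G t x - x - t%:C *: L x) <= t ^+ 2 * nrm (L (L x)).
Proof.
move=> D2x; rewrite -addrA -opprD; apply: lims_le (stoneP t x) _ => k.
rewrite opprD addrA; have := cayley_iter_taylor (2 ^ k) (t / (2 ^ k)%:R) D2x.
have p0 := pow2_gt0 k.
rewrite mulrCA mulfV ?gt_eqF// mulr1 exprMn.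
move=> /le_trans; apply; rewrite ler_wpM2r ?nrm_ge0//.
by rewrite le_eqVlt; apply/orP; left; apply/eqP; field; rewrite gt_eqF.
Qed.

Lemma stone_der x (r : R) : D x -> 0 < r ->
  exists2 d, 0 < d & forall h, `|h| < d ->
    nrm (G h x - x - h%:C *: L x) <= r * `|h|.
Proof.
move=> Dx r0; have r4 : 0 < r / 4 by rewrite divr_gt0.
have [y [D2y xy Lxy]] := dom2_core Dx r4; have [Dy DLy] := D2y.
have q0 : 0 <= nrm (L (L y)) by exact: nrm_ge0.
set q := nrm (L (L y)) in q0; have q1 : 0 < q + 1 by lra.
exists (r / 4 / (q + 1)); first by rewrite divr_gt0.
move=> h; rewrite ltr_pdivlMr// => hq; have h0 := normr_ge0 h.
have h1 := stone_taylor2 h D2y; rewrite -/q -(real_normK (num_real h)) in h1.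
have h2 := stone_le h (skew_domB Dx Dy); rewrite (skewB Dx Dy) in h2.
have -> : G h x - x - h%:C *: L x = (G h y - y - h%:C *: L y) +
    ((G h (x - y) - (x - y)) - h%:C *: (L x - L y)).
  by rewrite (isomB _ _ (stone_isom h)); vec.
apply: le_trans (nrmD _ _) _; apply: le_trans (lerD h1 (nrmB_le _ 0 _)) _.
rewrite subr0 sub0r nrmN nrmZr; move: h2 Lxy hq.
move: (nrm (G h (x - y) - (x - y))) (nrm (L x - L y)) => u v h2 Lxy hq.
have h3 : `|h| * v <= `|h| * (r / 4) by rewrite ler_wpM2l// ltW.
have h4 : `|h| * (`|h| * (q + 1)) <= `|h| * (r / 4) by rewrite ler_wpM2l// ltW.
nra.
Qed.

Lemma stone_unitary_group : unitary_group G.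
Proof.
split; [exact: stone_unitary | exact: stone0 | exact: stoneD |].
move=> x t; apply/cvg_nrmP => r r0; have r4 : 0 < r / 4 by rewrite divr_gt0.
have [_ dD _] := sL; have [y Dy xy] := dense_nrm x dD r4.
have p1 : 0 < nrm (L y) + 1 by have := nrm_ge0 (L y); lra.
have d0 : 0 < r / 4 / (nrm (L y) + 1) by rewrite divr_gt0.
near=> s.
have st : `|t - s| < r / 4 / (nrm (L y) + 1).
  by near: s; exact: (@cvgr_dist_lt _ _ _ _ _ id _ cvg_id).
rewrite ltr_pdivlMr// in st.
have : G t y = G s (G (t - s) y).
  by rewrite -[RHS]/((G s \o G (t - s)) y) -stoneD addrC subrK.
have h1 := stone_le (t - s) Dy; have n0 := nrm_ge0 (L y).
move=> E; apply: le_lt_trans (nrmB_le _ (G t y) _) _.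
apply: le_lt_trans (lerD (lexx _) (nrmB_le _ (G s y) _)) _.
rewrite (isom_dist _ _ (stone_isom t)) (isom_dist _ _ (stone_isom s)).
rewrite E (isom_dist _ _ (stone_isom s)) (nrmBC y).
have := normr_ge0 (t - s); nra.
Unshelve. all: by end_near.
Qed.

(** If the difference quotients at [x] converge to [y], pairing them with [w] in the domain and
    moving [G t] to [G (- t) w] puts [x] in the domain of the adjoint, which is that of [L]. So the
    generator is [L] itself, not a proper extension. *)
Lemma stone_generator : generator G L.
Proof.
move=> x y; split=> [cv|[Dx ->]].
  have [_ _ /(_ x (- y))[h _]] := sL.
  suff /h[Dx /oppr_inj] : op_adjoint L x (- y) by [].
  move=> w Dw; apply/eqP; rewrite -subr_eq0; apply/eqP/Normc.eq0_normc/eqP.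
  rewrite eq_le normc_ge0 andbT; apply/ler_addgt0Pr => r r0; rewrite add0r.
  pose b := nrm x + nrm w + 1.
  have xp := nrm_ge0 x; have wp := nrm_ge0 w.
  have b0 : 0 < b by rewrite /b; lra.
  have rb : 0 < r / b by rewrite divr_gt0.
  have /cvg_nrmP/(_ _ rb)/nbhs_ballP[d /= d0 dP] := cv.
  have [d' d'0 d'P] := stone_der Dw rb.
  pose t := Num.min d d' / 2.
  have m0 : 0 < Num.min d d' by rewrite lt_min d0.
  have t0 : 0 < t by rewrite divr_gt0.
  have tm : t < Num.min d d' by rewrite /t; lra.
  move: tm; rewrite lt_min => /andP[td td'].
  have h1 := dP t; rewrite /ball /= sub0r normrN gtr0_norm// in h1.
  have {h1} h1 := h1 td (lt0r_neq0 t0).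
  have h2 := d'P (- t); rewrite normrN gtr0_norm// in h2.
  have {h2} h2 := h2 td'.
  have E : dotp (L w) x - dotp w (- y) =
      (t^-1)%:C * dotp (G (- t) w - w - (- t)%:C *: L w) x
      + dotp w (y - (t^-1)%:C *: (G t x - x)).
    rewrite !dotBl dotZl dotNr dotBr dotZr conjc_real dotBr.
    have -> : dotp (G (- t) w) x = dotp w (G t x).
      rewrite -[RHS](isom_dot _ _ (stone_isom (- t))).
      rewrite -[G (- t) (G t x)]/((G (- t) \o G t) x) -stoneD addNr stone0//.
    rewrite rmorphN /= fmorphV; field.
    by rewrite (inj_eq (@complexI R)) lt0r_neq0.
  rewrite E; apply: le_trans (le_normcD _ _) _.
  rewrite Normc.normcM normcR gtr0_norm ?invr_gt0//.
  have h3 := cauchy_schwarz (G (- t) w - w - (- t)%:C *: L w) x.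
  have h4 := cauchy_schwarz w (y - (t^-1)%:C *: (G t x - x)).
  have -> : r = b * (r / b) by field; rewrite gt_eqF.
  have h5 : t^-1 * normc (dotp (G (- t) w - w - (- t)%:C *: L w) x) <= r / b * nrm x.
    rewrite mulrC ler_pdivrMr//; apply: le_trans h3 _.
    by rewrite mulrAC ler_wpM2r.
  apply: le_trans (lerD h5 h4) _.
  apply: le_trans (_ : r / b * nrm x + nrm w * (r / b) <= _).
    by rewrite lerD2l ler_wpM2l// ltW.
  rewrite /b; move: (r / b) rb => u u0; nra.
apply/cvg_nrmP => r r0; have [d d0 dP] := stone_der Dx (divr_gt0 r0 (ltr0n _ 2)).
apply/nbhs_ballP; exists d => //= h; rewrite /ball /= sub0r normrN => hd h0.
have {dP}dP := dP _ hd.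
have hp : 0 < `|h| by rewrite normr_gt0.
have -> : L x - (h^-1)%:C *: (G h x - x) =
    - ((h^-1)%:C *: (G h x - x - h%:C *: L x)).
  have hh : (h^-1)%:C * h%:C = 1 :> R[i] by rewrite -rmorphM mulVf.
  rewrite [in RHS]scalerBr scalerA hh; vec.
rewrite nrmN nrmZr normfV mulrC ltr_pdivrMr//.
by apply: le_lt_trans dP _; rewrite ltr_pM2r//; lra.
Qed.

(** The group built from Cayley transforms shows that the choice in [op_exp] is not made by default.
    Later facts on [op_exp] come from these two properties alone, without uniqueness. *)
Lemma op_expP : unitary_group (op_exp L) /\ generator (op_exp L) L.
Proof.
rewrite /op_exp; case: xgetP => [g _ //|/(_ G)]; case.
by split; [exact: stone_unitary_group | exact: stone_generator].
Qed.

Lemma op_exp_unitary t : unitary (op_exp L t).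
Proof. by have [[]] := op_expP. Qed.
Lemma op_exp_isom t : isom (op_exp L t).
Proof. exact/unitary_isom/op_exp_unitary. Qed.
Lemma op_exp0 : op_exp L 0 = id.
Proof. by have [[]] := op_expP. Qed.
Lemma op_expD s t x : op_exp L (s + t) x = op_exp L s (op_exp L t x).
Proof. by have [[_ _ h _] _] := op_expP; rewrite h. Qed.

Lemma op_exp_cont x (r : R) : 0 < r ->
  exists2 d, 0 < d & forall h, `|h| < d -> nrm (op_exp L h x - x) < r.
Proof.
move=> r0; have [[_ E0 _ /(_ x 0) h] _] := op_expP.
have /cvg_nrmP/(_ _ r0)/nbhs_ballP[d /= d0 dP] := h.
exists d => // t td; have := dP t; rewrite /ball /= sub0r normrN => /(_ td).
by rewrite E0 nrmBC.
Qed.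

Lemma op_exp_der x (r : R) : D x -> 0 < r ->
  exists2 d, 0 < d & forall h, `|h| < d ->
    nrm (op_exp L h x - x - h%:C *: L x) <= r * `|h|.
Proof.
move=> Dx r0; have [[_ E0 _ _] /(_ x (L x))[_ g]] := op_expP.
have /cvg_nrmP/(_ _ r0)/nbhs_ballP[d /= d0 dP] := g (conj Dx erefl).
exists d => // h hd; have [->|h0] := eqVneq h 0.
  by rewrite E0 subrr scale0r subrr nrm0 normr0 mulr0.
have := dP h; rewrite /ball /= sub0r normrN => /(_ hd h0).
have hp : 0 < `|h| by rewrite normr_gt0.
have -> : L x - (h^-1)%:C *: (op_exp L h x - x) =
    - ((h^-1)%:C *: (op_exp L h x - x - h%:C *: L x)).
  have hh : (h^-1)%:C * h%:C = 1 :> R[i] by rewrite -rmorphM mulVf.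
  rewrite [in RHS]scalerBr scalerA hh; vec.
by rewrite nrmN nrmZr normfV mulrC ltr_pdivrMr// => /ltW.
Qed.

End Stone.

(** * Strong limits of a semigroup of isometries *)

Section Tracking.
Context (R : realType) (H : hilbertType R) (phi : nat -> H).
Hypothesis bphi : orthonormal_basis phi.
Variable S : set (H -> H).
Hypothesis S_isom : forall V, S V -> isom V.
Hypothesis S_comp : forall V W, S V -> S W -> S (V \o W).
Implicit Types (x y z : H) (U V : H -> H) (W : set H) (m : nat -> H) (h r t : R).
Local Notation F := (inF phi).

Lemma seq_bound (T : eqType) (s : seq T) (f : T -> R) :
  exists2 M, 0 <= M & forall x : T, x \in s -> f x <= M.
Proof.
elim: s => [|a s [M M0 hM]]; first by exists 0.
exists (Num.max M (f a)); first by rewrite le_max M0.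
by move=> x; rewrite inE le_max => /predU1P[->|/hM->//]; rewrite lexx orbT.
Qed.

Lemma nat_bound N (f : nat -> R) : exists2 M, 0 <= M & forall j, (j < N)%N -> f j <= M.
Proof.
have [M M0 hM] := seq_bound (iota 0 N) f; exists M => // j jN.
by apply: hM; rewrite mem_iota.
Qed.

Lemma small_all N (P : nat -> R -> Prop) :
  (forall j, (j < N)%N -> exists2 d, 0 < d & forall h, 0 < h < d -> P j h) ->
  exists2 d, 0 < d & forall h, 0 < h < d -> forall j, (j < N)%N -> P j h.
Proof.
elim: N => [|N IH] hP; first by exists 1.
have [|d d0 hd] := IH; first by move=> j jN; apply: hP; exact: ltnW.
have [d' d'0 hd'] := hP N (ltnSn N).
exists (Num.min d d'); first by rewrite lt_min d0.
move=> h /andP[h0]; rewrite lt_min => /andP[h1 h2] j.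
rewrite ltnS leq_eqVlt => /predU1P[->|jN]; first by apply: hd'; rewrite h0.
by apply: hd => //; rewrite h0.
Qed.

(** Membership in the closure of [S] for the strong operator topology, tested on vectors of [W]
    only: finite lists of vectors and radii give the basic neighbourhoods. *)
Definition tracks W U := forall (s : seq H), (forall x, x \in s -> W x) ->
  forall r, 0 < r -> exists2 V, S V & forall x, x \in s -> nrm (V x - U x) <= r.

Lemma tracksS W W' U : W `<=` W' -> tracks W' U -> tracks W U.
Proof. by move=> WW' h s hs; apply: h => x /hs/WW'. Qed.

Lemma tracks_mem W V : S V -> tracks W V.
Proof. by move=> SV s _ r r0; exists V => // x _; rewrite subrr nrm0 ltW. Qed.

Lemma tracks_comp W W' U U' : tracks W U -> tracks W' U' ->
  (forall x, W' x -> W (U' x)) -> tracks W' (U \o U').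
Proof.
move=> hU hU' WW s hs r r0; have r2 : 0 < r / 2 by rewrite divr_gt0.
have [V' SV' hV'] := hU' s hs _ r2.
have [|V SV hV] := hU [seq U' x | x <- s] _ _ r2.
  by move=> _ /mapP[x xs ->]; exact/WW/hs.
exists (V \o V'); first exact: S_comp.
move=> x xs /=; apply: le_trans (nrmB_le _ (V (U' x)) _) _.
rewrite (isom_dist _ _ (S_isom SV)).
have := hV' x xs; have := hV _ (map_f U' xs); lra.
Qed.

Lemma tracks_closed W U :
  (forall s : seq H, (forall x, x \in s -> W x) -> forall r, 0 < r ->
     exists2 U', tracks W U' & forall x, x \in s -> nrm (U' x - U x) <= r) ->
  tracks W U.
Proof.
move=> h s hs r r0; have r2 : 0 < r / 2 by rewrite divr_gt0.
have [U' hU' U'U] := h s hs _ r2; have [V SV hV] := hU' s hs _ r2.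
exists V => // x xs; apply: le_trans (nrmB_le _ (U' x) _) _.
have := hV x xs; have := U'U x xs; lra.
Qed.

Lemma isom_seq_close N (s : seq H) r : (forall x, x \in s -> F N x) -> 0 < r ->
  exists2 d, 0 < d & forall U V, isom U -> isom V ->
    (forall j, (j < N)%N -> nrm (V (phi j) - U (phi j)) <= d) ->
    forall x, x \in s -> nrm (V x - U x) <= r.
Proof.
move=> hs r0; have [M M0 hM] := seq_bound s (@nrm R H).
have q0 : 0 < N%:R * M + 1 by rewrite ltr_wpDl// mulr_ge0.
exists (r / (N%:R * M + 1)); first by rewrite divr_gt0.
move=> U V hU hV h x xs.
have d0 : 0 < r / (N%:R * M + 1) by rewrite divr_gt0.
apply: le_trans (nrm_diff_inF bphi hU hV h (hs x xs)) _.
have rE : r = (N%:R * M + 1) * (r / (N%:R * M + 1)) by field; rewrite gt_eqF.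
rewrite [leRHS]rE; move: (r / _) d0 => d d0; rewrite mulrAC ler_pM2r//.
by apply: le_trans (_ : N%:R * M <= _); rewrite ?ler_wpM2l ?hM// lerDl.
Qed.

Lemma tracks_basis N U : isom U ->
  (forall r, 0 < r -> exists2 V, S V &
     forall j, (j < N)%N -> nrm (V (phi j) - U (phi j)) <= r) ->
  tracks (F N) U.
Proof.
move=> hU h s hs r r0; have [d d0 hd] := isom_seq_close hs r0.
by have [V SV hV] := h d d0; exists V => //; apply: hd => //; exact: S_isom.
Qed.

Lemma tracks_on_basis N U r : tracks (F N) U -> 0 < r ->
  exists2 V, S V & forall j, (j < N)%N -> nrm (V (phi j) - U (phi j)) <= r.
Proof.
move=> h r0; have [|V SV hV] := h [seq phi j | j <- iota 0 N] _ r r0.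
  move=> _ /mapP[j jN ->]; apply: inF_basis => //.
  by move: jN; rewrite mem_iota.
by exists V => // j jN; apply: hV; apply: map_f; rewrite mem_iota.
Qed.

(** Isometries are equicontinuous, so it is enough to approximate on truncations of the given
    vectors. *)
Lemma tracks_full U : isom U -> (forall N, tracks (F N) U) -> tracks setT U.
Proof.
move=> hU h s _ r r0; have r3 : 0 < r / 3 by rewrite divr_gt0.
have [N hN] : exists N, forall x, x \in s -> nrm (x - proj phi N x) <= r / 3.
  suff [N hN] : exists N, forall M, (N <= M)%N -> forall x, x \in s ->
      nrm (x - proj phi M x) <= r / 3 by exists N => x; exact: hN.
  elim: s => [|a s [N hN]]; first by exists 0.
  have [N' hN'] := proj_approx bphi a r3; exists (maxn N N') => M.
  rewrite geq_max => /andP[NM N'M] x; rewrite inE => /predU1P[->|xs].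
    exact/ltW/hN'.
  exact: hN.
have [|V SV hV] := h N [seq proj phi N x | x <- s] _ _ r3.
  by move=> _ /mapP[x _ ->]; exact: inF_proj.
exists V => // x xs; have hx := hN x xs; have vx := hV _ (map_f _ xs).
apply: le_trans (nrmB_le _ (V (proj phi N x)) _) _.
apply: le_trans (lerD (lexx _) (nrmB_le _ (U (proj phi N x)) _)) _.
rewrite (isom_dist _ _ (S_isom SV)) (isom_dist _ _ hU) (nrmBC (proj _ _ _)).
lra.
Qed.

(** [m] prescribes a right derivative at 0 on the first [N] basis vectors. The approximants may
    depend on [h] and [r] without forming a group, and [m j] may leave [inF phi N]. *)
Definition infinitesimal N m := forall r, 0 < r ->
  exists2 d, 0 < d & forall h, 0 < h < d -> exists2 V, S V &
    forall j, (j < N)%N -> nrm (V (phi j) - phi j - h%:C *: m j) <= r * h.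

(* Chernoff's product formula: V^n approximates g(t) = g(t/n)^n when V is
   o(t/n)-close to g(t/n). *)
Lemma infinitesimal_tracks N m (g : R -> H -> H) :
  (forall t, isom (g t)) -> g 0 = id -> (forall s t, g (s + t) = g s \o g t) ->
  (forall t j, (j < N)%N -> F N (g t (phi j))) ->
  (forall r j, 0 < r -> (j < N)%N -> exists2 d, 0 < d & forall h, 0 < h < d ->
     nrm (g h (phi j) - phi j - h%:C *: m j) <= r * h) ->
  infinitesimal N m -> forall t, 0 < t -> tracks (F N) (g t).
Proof.
move=> gi g0 gD gF gder hm t t0; apply: tracks_basis => // r r0.
have gFx s x : F N x -> F N (g s x).
  move=> <-; rewrite (isom_sum _ _ _ (gi s)); apply: inF_sum => k _.
  by rewrite (isomZ _ _ (gi s)); apply: inFZ; exact: gF.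
have giter h n : g (n%:R * h) = iter n (g h).
  apply/funext => x; elim: n x => [|n IH] x; first by rewrite mul0r g0.
  by rewrite iterS -IH -natr1 mulrDl mul1r addrC gD.
have q0 : 0 < 2 * (N%:R + 1) * t by rewrite !mulr_gt0// ltr_wpDl.
(* [n] steps of length [h = t/n], each with defect at most [2 N e h] along the orbit, accumulate to
   [2 N t e], which is at most [r]. *)
pose e := r / (2 * (N%:R + 1) * t).
have e0 : 0 < e by rewrite divr_gt0.
have [d1 d10 hd1] := hm e e0.
have [d2 d20 hd2] := small_all (fun j => gder e j e0).
have dm : 0 < Num.min d1 d2 by rewrite lt_min d10.
pose n := (Num.trunc (t / Num.min d1 d2)).+1.
have n0 : 0 < n%:R :> R by rewrite ltr0Sn.
pose h := t / n%:R; have h0 : 0 < h by rewrite divr_gt0.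
have nh : n%:R * h = t by rewrite mulrC divfK// gt_eqF.
have : h < Num.min d1 d2.
  by rewrite ltr_pdivrMr// mulrC -ltr_pdivrMr// truncnS_gt.
rewrite lt_min => /andP[h1 h2].
have [|V SV hV] := hd1 h; first by rewrite h0.
have {}hd2 := hd2 h; rewrite h0 h2 in hd2; have {}hd2 := hd2 isT.
have Vg j : (j < N)%N -> nrm (V (phi j) - g h (phi j)) <= 2 * e * h.
  move=> jN; have := hV j jN; have := hd2 j jN.
  set a := g h (phi j) - _ - _; set b := V (phi j) - _ - _ => ha hb.
  have -> : V (phi j) - g h (phi j) = b - a by rewrite /a /b; vec.
  apply: le_trans (nrmB_le _ 0 _) _; rewrite subr0 sub0r nrmN; lra.
exists (iter n V).
  by rewrite /n; elim: (Num.trunc _) => //= k IH; exact: S_comp.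
move=> j jN; rewrite -nh giter.
(* The orbit of [g] stays in [F N], where the defect on basis vectors controls the defect on
   [g (i h) (phi j)]. *)
apply: le_trans (isom_iter_diff (d := N%:R * (2 * e * h)) (S_isom SV) _) _.
  move=> i _; rewrite -giter.
  have := nrm_diff_inF bphi (gi h) (S_isom SV) Vg (gFx (i%:R * h) _ (inF_basis bphi jN)).
  by rewrite (gi _).2 nrm_basis// mulr1.
have -> : n%:R * (N%:R * (2 * e * h)) = 2 * N%:R * (n%:R * h) * e by ring.
rewrite nh /e mulrA ler_pdivrMr// mulrC ler_wpM2l ?(ltW r0)//.
by rewrite ler_pM2r// ler_pM2l// lerDl.
Qed.

(** Derivatives of a composition add up. The approximant [V] is known to be near the identity only
    on [F N], whence the hypothesis on [m']: it makes [V (m' j) - m' j] of order [h]. *)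
Lemma infinitesimalD N m m' : infinitesimal N m -> infinitesimal N m' ->
  (forall j, (j < N)%N -> F N (m' j)) -> infinitesimal N (fun j => m j + m' j).
Proof.
move=> hm hm' Fm' r r0.
have [M M0 hM] := nat_bound N (fun j => nrm (m j)).
have [M' M'0 hM'] := nat_bound N (fun j => nrm (m' j)).
pose e := Num.min 1 (r / 3); have e0 : 0 < e by rewrite lt_min ltr01 divr_gt0.
have e1 : e <= 1 by rewrite ge_min lexx.
have e2 : e <= r / 3 by rewrite ge_min lexx orbT.
have [d d0 hd] := hm e e0; have [d' d'0 hd'] := hm' e e0.
pose q := N%:R * (M + 1) * M'.
have q0 : 0 <= q by rewrite /q !mulr_ge0// addr_ge0.
have q1 : 0 < q + 1 by lra.
pose d3 := r / 3 / (q + 1); have d30 : 0 < d3 by rewrite !divr_gt0.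
exists (Num.min (Num.min d d') d3); first by rewrite !lt_min d0 d'0.
move=> h /andP[h0]; rewrite !lt_min => /andP[/andP[h1 h2] h3].
have [|V SV hV] := hd h; first by rewrite h0.
have [|V' SV' hV'] := hd' h; first by rewrite h0.
exists (V \o V') => [|j jN]; first exact: S_comp.
have iV := S_isom SV.
have -> : (V \o V') (phi j) - phi j - h%:C *: (m j + m' j) =
    V (V' (phi j) - phi j - h%:C *: m' j) + (V (phi j) - phi j - h%:C *: m j)
    + h%:C *: (V (m' j) - m' j).
  by rewrite /= 2!(isomB _ _ iV) (isomZ _ _ iV); vec.
have Vid k : (k < N)%N -> nrm (V (phi k) - id (phi k)) <= h * (M + 1).
  move=> kN; have := hV k kN; set a := V _ - _ - _ => ha.
  have -> : V (phi k) - id (phi k) = a + h%:C *: m k by rewrite /a subrK.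
  apply: le_trans (nrmD _ _) _; rewrite nrmZr gtr0_norm//.
  have := ler_wpM2l (ltW h0) (hM k kN); have := ler_wpM2r (ltW h0) e1; lra.
have := nrm_diff_inF bphi (@isom_id _ _) iV Vid (Fm' j jN) => h4.
apply: le_trans (nrmD _ _) _; apply: le_trans (lerD (nrmD _ _) (lexx _)) _.
rewrite iV.2 nrmZr gtr0_norm//.
have h5 : nrm (V (m' j) - m' j) <= r / 3.
  apply: le_trans h4 _; apply: le_trans (_ : h * q <= _).
    have -> : h * q = N%:R * (h * (M + 1)) * M' by rewrite /q; ring.
    apply: ler_wpM2l; first by rewrite !mulr_ge0 ?addr_ge0// ltW.
    exact: hM'.
  move: h3; rewrite /d3 ltr_pdivlMr// => h3.
  by apply: le_trans (ltW h3); rewrite ler_pM2l//; lra.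
have := hV j jN; have := hV' j jN.
have := ler_wpM2l (ltW h0) h5; have := ler_wpM2r (ltW h0) e2; lra.
Qed.

Lemma infinitesimal_der N m (G : R -> H -> H) :
  (forall h, 0 < h -> tracks (F N) (G h)) ->
  (forall r j, 0 < r -> (j < N)%N -> exists2 d, 0 < d & forall h, 0 < h < d ->
     nrm (G h (phi j) - phi j - h%:C *: m j) <= r * h) ->
  infinitesimal N m.
Proof.
move=> hG der r r0; have r2 : 0 < r / 2 by rewrite divr_gt0.
have [d d0 hd] := small_all (fun j => der _ j r2).
exists d => // h hh; have /andP[h0 _] := hh.
have [V SV hV] := tracks_on_basis (hG h h0) (mulr_gt0 r2 h0).
exists V => // j jN; have -> : V (phi j) - phi j - h%:C *: m j =
   (V (phi j) - G h (phi j)) + (G h (phi j) - phi j - h%:C *: m j) by vec.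
apply: le_trans (nrmD _ _) _.
have := hV j jN; have := hd h hh j jN; lra.
Qed.

Lemma infinitesimal_lim N m :
  (forall r, 0 < r -> exists2 m', infinitesimal N m' &
     forall j, (j < N)%N -> nrm (m' j - m j) <= r) -> infinitesimal N m.
Proof.
move=> hm r r0; have r2 : 0 < r / 2 by rewrite divr_gt0.
have [m' im' mm'] := hm _ r2; have [d d0 hd] := im' _ r2.
exists d => // h hh; have /andP[h0 _] := hh; have [V SV hV] := hd h hh.
exists V => // j jN; have -> : V (phi j) - phi j - h%:C *: m j =
   (V (phi j) - phi j - h%:C *: m' j) + h%:C *: (m' j - m j) by vec.
apply: le_trans (nrmD _ _) _; rewrite nrmZr gtr0_norm//.
have := hV j jN; have := ler_wpM2l (ltW h0) (mm' j jN); lra.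
Qed.

Lemma infinitesimalZ N m c : 0 < c -> infinitesimal N m ->
  infinitesimal N (fun j => c%:C *: m j).
Proof.
move=> c0 hm r r0; have [d d0 hd] := hm _ (divr_gt0 r0 c0).
exists (d / c); first by rewrite divr_gt0.
move=> h /andP[h0 hdc]; have [|V SV hV] := hd (h * c).
  by rewrite mulr_gt0//= -ltr_pdivlMr.
exists V => // j jN; have := hV j jN.
by rewrite rmorphM -scalerA [h * c]mulrC mulrA divfK// gt_eqF.
Qed.

End Tracking.

(** * Phases, recurrence and nonresonance *)

Section ComplexExponential.
Context (R : realType).
Implicit Types (x y t r : R).

Definition expi x : R[i] := cos x +i* sin x.

Lemma expi0 : expi 0 = 1.
Proof. by rewrite /expi cos0 sin0. Qed.

Lemma expiD x y : expi (x + y) = expi x * expi y.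
Proof.
by rewrite /expi cosD sinD; apply/eqP; rewrite eq_complex /= [cos x * sin y + _]addrC !eqxx.
Qed.

Lemma expiN x : expi (- x) = (expi x)^*%C.
Proof. by rewrite /expi cosN sinN. Qed.

Lemma normc_expi x : normc (expi x) = 1.
Proof. by rewrite /= cos2Dsin2 sqrtr1. Qed.

Lemma expi_nat n x : expi (n%:R * x) = expi x ^+ n.
Proof.
elim: n => [|n IH]; first by rewrite mul0r expi0 expr0.
by rewrite -natr1 mulrDl mul1r expiD IH exprSr.
Qed.

Lemma expi_2pi : expi (2 * pi) = 1.
Proof. by rewrite /expi mulr_natl cos2pi sin2pi. Qed.

Lemma expi_int_2pi (k : int) : expi (k%:~R * (2 * pi)) = 1.
Proof.
case: k => n; first by rewrite -[n%:~R]/(n%:R) expi_nat expi_2pi expr1n.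
rewrite NegzE mulrNz mulNr expiN -[n.+1%:~R]/(n.+1%:R) expi_nat expi_2pi expr1n.
exact: conjc1.
Qed.

Lemma floor_frac x : 0 <= x - (Num.floor x)%:~R < 1.
Proof.
by rewrite subr_ge0 ge_floor/= ltrBlDl -intrD1 floorD1_gt.
Qed.

(** Subtracting a multiple of [2 pi] and halving leaves [y] in [[0, pi)] with [sin y = 0], hence
    [y = 0]. *)
Lemma expi_eq1 x : expi x = 1 -> exists k : int, x = k%:~R * (2 * pi).
Proof.
move=> h; have pi0 := pi_gt0 R; have p2 : 0 < 2 * pi :> R by rewrite mulr_gt0.
pose k := Num.floor (x / (2 * pi)); exists k.
have /andP[f1 f2] := floor_frac (x / (2 * pi)); rewrite -/k in f1 f2.
pose y := (x - k%:~R * (2 * pi)) / 2.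
have yE : y = (x / (2 * pi) - k%:~R) * pi 
  by rewrite /y; move: (pi) pi0 => p p0; field; exact: lt0r_neq0.
have y0 : 0 <= y by rewrite yE mulr_ge0// ltW.
have y1 : y < pi by rewrite yE -[ltRHS]mul1r ltr_pM2r.
have : cos (y *+ 2) = 1.
  have : expi (y *+ 2) = 1.
    rewrite (_ : y *+ 2 = x + - (k%:~R * (2 * pi))) ?expiD ?expiN ?expi_int_2pi ?h.
      by rewrite conjc1 mulr1.
    by rewrite /y -mulr_natr divfK.
  by case.
rewrite cos_mulr2n cos2sin2 => hc.
have s0 : sin y ^+ 2 = 0 by move: hc; rewrite mulr2n; lra.
have [y00|] := ltP 0 y.
  have /gt_eqF : 0 < sin y ^+ 2 by rewrite exprn_gt0// sin_gt0_pi// y00.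
  by rewrite s0 eqxx.
move=> y2; have : y = 0 by lra.
by rewrite /y => /eqP; rewrite mulf_eq0 invr_eq0 pnatr_eq0 orbF subr_eq0 => /eqP.
Qed.

Lemma expi_surj (z : R[i]) : normc z = 1 -> exists x, z = expi x.
Proof.
case: z => a b /= h.
have ab : a ^+ 2 + b ^+ 2 = 1.
  have p0 : 0 <= a ^+ 2 + b ^+ 2 by rewrite addr_ge0 ?sqr_ge0.
  by rewrite -[LHS]sqr_sqrtr// h expr1n.
have a1 : -1 <= a <= 1.
  rewrite -ler_norml -(ler_pXn2r (n:=2)) ?nnegrE// expr1n real_normK ?num_real//.
  by rewrite -ab lerDl sqr_ge0.
have bE : Num.sqrt (1 - a ^+ 2) = `|b|.
  by rewrite -ab addrAC subrr add0r sqrtr_sqr.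
have [b0|b0] := leP 0 b.
  exists (acos a); rewrite /expi acosK ?in_itv//= sin_acos//.
  by rewrite bE ger0_norm.
exists (- acos a); rewrite /expi cosN sinN acosK ?in_itv//= sin_acos// bE.
by rewrite ltr0_norm// opprK.
Qed.

Lemma is_derive_taylor (f : R -> R) (df : R) r : is_derive (0 : R) 1 f df -> 0 < r ->
  exists2 d, 0 < d & forall h, `|h| < d -> `|f h - f 0 - h * df| <= r * `|h|.
Proof.
move=> [dv de] r0.
have cv : h^-1 *: ((f \o shift 0) (h *: 1) - f 0) @[h --> 0^'] --> df.
  by rewrite -de; exact: dv.
have /cvgrPdist_lt/(_ _ r0)/nbhs_ballP[d /= d0 dP] := cv.
exists d => // h hd; have [->|h0] := eqVneq h 0.
  by rewrite subrr mul0r subr0 normr0 mulr0.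
have := dP h; rewrite /ball /= sub0r normrN => /(_ hd h0).
rewrite addr0 -[h *: 1]/(h * 1) mulr1 -[_ *: _]/(_ * _).
have hp : 0 < `|h| by rewrite normr_gt0.
have -> : df - h^-1 * (f h - f 0) = - (f h - f 0 - h * df) / h by field.
by rewrite normf_div normrN ltr_pdivrMr// => /ltW.
Qed.

Lemma normc_le_sum (a b : R) : normc (a +i* b) <= `|a| + `|b|.
Proof.
rewrite /= -(ler_pXn2r (n:=2)) ?nnegrE ?sqrtr_ge0 ?addr_ge0//.
rewrite sqr_sqrtr ?addr_ge0 ?sqr_ge0//.
rewrite -[a ^+ 2](real_normK (num_real a)) -[b ^+ 2](real_normK (num_real b)).
have := normr_ge0 a; have := normr_ge0 b; nra.
Qed.

Lemma expi_taylor r : 0 < r ->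
  exists2 d, 0 < d & forall h, `|h| < d -> normc (expi h - 1 - (0 +i* h)) <= r * `|h|.
Proof.
move=> r0; have r2 : 0 < r / 2 by rewrite divr_gt0.
have [d d0 hd] := is_derive_taylor (is_derive_cos (0 : R)) r2.
have [d' d'0 hd'] := is_derive_taylor (is_derive_sin (0 : R)) r2.
exists (Num.min d d'); first by rewrite lt_min d0.
move=> h; rewrite lt_min => /andP[/hd + /hd'].
rewrite cos0 sin0 oppr0 mulr0 mulr1 !subr0 addr0 => h1 h2.
have -> : expi h - 1 - (0 +i* h) = (cos h - 1) +i* (sin h - h).
  by rewrite /expi; apply/eqP; rewrite eq_complex /= !subr0 !eqxx.
by apply: le_trans (normc_le_sum _ _) _; lra.
Qed.

Lemma expi_cont r : 0 < r ->
  exists2 d, 0 < d & forall h, `|h| < d -> normc (expi h - 1) <= r.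
Proof.
move=> r0; have [d d0 hd] := expi_taylor (@ltr01 R).
exists (Num.min d (r / 2)); first by rewrite lt_min d0 divr_gt0.
move=> h; rewrite lt_min => /andP[/hd h1 h2].
rewrite -[X in normc X](subrK (0 +i* h)).
apply: le_trans (le_normcD _ _) _.
have -> : normc (0 +i* h) = `|h| by rewrite /= expr0n add0r sqrtr_sqr.
lra.
Qed.

(** Dirichlet's pigeonhole argument: two multiples of [theta] whose fractional parts, in units of
    [2 pi], fall in the same cell of a grid of mesh [1/K] differ by almost a period in every
    coordinate. *)
Lemma recurrence N (theta : nat -> R) r : 0 < r ->
  exists2 m, (1 < m)%N & forall k, (k < N)%N -> normc (expi (m%:R * theta k) - 1) <= r.
Proof.
move=> r0; have [d d0 hd] := expi_cont r0.
have pi0 := pi_gt0 R; have p2 : 0 < 2 * pi :> R by rewrite mulr_gt0.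
pose K := (Num.trunc (2 * pi / d)).+1.
have K0 : 0 < K%:R :> R by rewrite ltr0Sn.
have Kd : 2 * pi / K%:R < d.
  by rewrite ltr_pdivrMr// [d * _]mulrC -ltr_pdivrMr// truncnS_gt.
pose u m k := m%:R * theta k / (2 * pi).
pose fr m k := u m k - (Num.floor (u m k))%:~R.
have fr01 m k : 0 <= fr m k < 1 by exact: floor_frac.
have cellP m k : (Num.trunc (fr m k * K%:R) < K)%N.
  have /andP[f0 f1] := fr01 m k.
  by rewrite truncn_lt_nat ?mulr_ge0// -[ltRHS]mul1r ltr_pM2r.
pose cell m : {ffun 'I_N -> 'I_K} := [ffun k : 'I_N => Ordinal (cellP m k)].
pose T : finType := {ffun 'I_N -> 'I_K}.
(* Only even multiples are compared, so that the difference [m] is at least 2 and [m - 1] is still a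
   positive number of steps. *)
have [i [j [ij cij]]] : exists i j : nat, (i < j)%N /\ cell i.*2 = cell j.*2.
  pose f (i : 'I_(#|T|.+1)) : T := cell i.*2.
  have /injectivePn[i [j ij fij]] : ~~ injectiveb f.
    by apply/negP => /injectiveP/leq_card; rewrite card_ord ltnn.
  have [lij|lji|eij] := ltngtP i j.
  - by exists i, j.
  - by exists j, i.
  - by move: ij; rewrite (ord_inj eij) eqxx.
exists (j.*2 - i.*2)%N.
  by move: ij; rewrite -subn_gt0 -doubleB; case: (j - i)%N.
move=> k kN; pose a := fr i.*2 k; pose b := fr j.*2 k.
have cE : Num.trunc (a * K%:R) = Num.trunc (b * K%:R).
  have := congr1 (fun f : T => val (f (Ordinal kN))) cij.
  by rewrite /cell !ffunE.
have fb : `|b - a| * K%:R < 1.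
  have /andP[a0 _] := fr01 i.*2 k; have /andP[b0 _] := fr01 j.*2 k.
  have := truncn_itv (mulr_ge0 a0 (ltW K0)); have := truncn_itv (mulr_ge0 b0 (ltW K0)).
  rewrite -/a -/b -cE -natr1 => /andP[b1 b2] /andP[a1 a2].
  rewrite -(ger0_norm (ltW K0)) -normrM ltr_norml; apply/andP; split; lra.
have -> : (j.*2 - i.*2)%:R * theta k = (b - a) * (2 * pi) +
    (Num.floor (u j.*2 k) - Num.floor (u i.*2 k))%:~R * (2 * pi).
  rewrite natrB ?leq_double ?(ltnW ij)// /b /a /fr intrB /u.
  move: (pi) pi0 => p p0; field; exact: lt0r_neq0.
rewrite expiD expi_int_2pi mulr1; apply: hd.
rewrite normrM (gtr0_norm p2); apply: lt_trans Kd.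
by rewrite ltr_pdivlMr// mulrAC -[ltRHS]mul1r ltr_pM2r.
Qed.

Lemma geometric_sum_le (z : R[i]) n : normc z = 1 -> z != 1 ->
  normc (\sum_(i < n) z ^+ i) <= 2 / normc (z - 1).
Proof.
move=> z1 zn1; have p0 : 0 < normc (z - 1).
  rewrite lt_neqAle normc_ge0 andbT eq_sym; apply: contra zn1 => /eqP/Normc.eq0_normc.
  by move/eqP; rewrite subr_eq0.
rewrite ler_pdivlMr// mulrC -Normc.normcM -subrX1.
apply: le_trans (le_normcD _ _) _; rewrite normcN Normc.normc1.
suff -> : normc (z ^+ n) = 1 by [].
by elim: n => [|n IH]; rewrite ?expr0 ?Normc.normc1// exprS Normc.normcM z1 IH mulr1.
Qed.

(** * Nonresonance of the spectral gaps *)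

Variable lambda : nat -> R.
Hypothesis Qind : Q_linearly_independent (fun n => lambda n.+1 - lambda n).

(** [lambda j - lambda k] is the sum of the gaps of index [k] to [j - 1]. By independence it can
    equal [m] times the gap of index [p] only if it has that single term. *)
Lemma gap_combination k j p (m : int) : (k < j)%N ->
  lambda j - lambda k = m%:~R * (lambda p.+1 - lambda p) ->
  [/\ k = p, j = p.+1 & m = 1].
Proof.
move=> kj E; pose N := maxn j p.+1.
pose q (i : nat) : rat := ((k <= i < j)%N%:R - m%:~R * (i == p)%:R).
have jN : (j <= N)%N by exact: leq_maxl.
have pN : (p < N)%N by exact: leq_maxr.
have q0 i : (i < N)%N -> q i = 0.
  move=> iN; apply/eqP/negPn/negP => qi.
  have /negP := Qind (q := fun i : 'I_N => q i) (ex_intro _ (Ordinal iN) qi); apply.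
  have -> : \sum_(n < N) ratr (q n) * (lambda n.+1 - lambda n) =
      \sum_(n < N) (k <= n < j)%N%:R * (lambda n.+1 - lambda n)
      - \sum_(n < N) m%:~R * (n == p :> nat)%:R * (lambda n.+1 - lambda n) :> R.
    rewrite -sumrB; apply: eq_bigr => n _.
    by rewrite /q rmorphB rmorphM /= ratr_int !ratr_nat mulrBl.
  rewrite subr_eq0; apply/eqP; transitivity (lambda j - lambda k).
    rewrite -(telescope_sumr lambda (ltnW kj)) (big_nat_widenl _ 0)// [RHS](big_nat_widen _ _ N)//.
    rewrite [RHS]big_mkord [RHS]big_mkcond; apply: eq_bigr => n _ /=.
    by case: ifP; rewrite ?mul1r ?mul0r.
  rewrite E; rewrite (bigD1 (Ordinal pN))//= eqxx mulr1 big1 ?addr0//.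
  by move=> n; rewrite -val_eqE /= => /negPf->; rewrite mulr0 mul0r.
have kN : (k < N)%N by exact: leq_trans jN.
(* The coefficient at [k] forces [k = p] and [m = 1]; the one at [p + 1] excludes [p + 1 < j]. *)
have := q0 k kN; rewrite /q leqnn kj /=.
have [kp|_] := eqVneq k p; last by rewrite mulr0 subr0 => /eqP; rewrite oner_eq0.
rewrite mulr1 => /eqP; rewrite subr_eq0 -[1]/(1%:~R) eqr_int => /eqP m1.
split=> //; apply/eqP; rewrite eqn_leq -{2}kp kj andbT leqNgt; apply/negP => pj.
have := q0 p.+1 (leq_trans pj jN); rewrite /q pj kp leqnSn /= gtn_eqF//.
by rewrite mulr0 subr0 => /eqP; rewrite oner_eq0.
Qed.

End ComplexExponential.

(** * Diagonal unitaries and plane rotations *)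

Section BasisMaps.
Context (R : realType) (H : hilbertType R) (phi : nat -> H).
Hypothesis bphi : orthonormal_basis phi.
Implicit Types (x y z : H) (U V : H -> H) (f : nat -> H) (N p : nat).
Local Notation F := (inF phi).

Lemma isom_ext_basis U V : isom U -> isom V ->
  (forall k, U (phi k) = V (phi k)) -> U = V.
Proof.
move=> hU hV UV; have [_ dphi] := bphi.
apply: (isom_ext_dense (D := span_seq phi)) => // [x r r0|_ [N [c ->]]].
  exact: dense_nrm.
by rewrite !isom_sum//; apply: eq_bigr => k _; rewrite !isomZ// UV.
Qed.

(** The identity on the orthogonal complement of [F N]: matrices on finite spans thus become
    isometries of [H], comparable with propagators. *)
Definition basis_map N f x : H :=
  \sum_(k < N) dotp x (phi k) *: f k + (x - proj phi N x).

Lemma basis_mapE N f k :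
  basis_map N f (phi k) = if (k < N)%N then f k else phi k.
Proof.
rewrite /basis_map; case: ltnP => kN.
  rewrite [proj _ _ _](inF_basis bphi kN) subrr addr0.
  rewrite (bigD1 (Ordinal kN))//= big1 => [|l].
    by rewrite dot_basis// eqxx scale1r addr0.
  by rewrite -val_eqE /= => /negPf kl; rewrite dot_basis// eq_sym kl scale0r.
have kl (l : 'I_N) : (k == l :> nat) = false.
  by rewrite gtn_eqF// (leq_trans (ltn_ord l)).
rewrite big1 => [|l _]; last by rewrite dot_basis// kl scale0r.
rewrite /proj big1 => [|l _]; last by rewrite dot_basis// kl scale0r.
by rewrite add0r subr0.
Qed.

Lemma basis_map_isom N f :
  (forall k l, (k < N)%N -> (l < N)%N -> dotp (f k) (f l) = (k == l)%:R) ->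
  (forall k, (k < N)%N -> F N (f k)) -> isom (basis_map N f).
Proof.
move=> of_ Ff; split=> [a x y|x].
  rewrite /basis_map proj_lin.
  have -> : \sum_(k < N) dotp (a *: x + y) (phi k) *: f k =
      a *: (\sum_(k < N) dotp x (phi k) *: f k) + \sum_(k < N) dotp y (phi k) *: f k.
    rewrite scaler_sumr -big_split; apply: eq_bigr => k _ /=.
    by rewrite dotDl dotZl scalerDl scalerA.
  vec.
rewrite /basis_map; set y := \sum_(k < N) _; pose z := x - proj phi N x.
have Fy : F N y by apply: inF_sum => k _; apply: inFZ; exact: Ff.
have yz v : F N v -> nrm (v + z) ^+ 2 = nrm v ^+ 2 + nrm z ^+ 2.
  by move=> Fv; rewrite nrmD_sq dot_Re_sym dot_subproj// Re0 mulr0 addr0.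
apply/eqP; rewrite -(eqrXn2 (n:=2)) ?nrm_ge0// -/z yz//.
rewrite -[in X in _ == X](subrK (proj phi N x) x) -/z [z + _]addrC yz; last exact: inF_proj.
rewrite (inj_eq (addIr _)) !nrm_sq; apply/eqP; congr complex.Re.
transitivity (\sum_(k < N) dotp x (phi k) * (dotp x (phi k))^*%C).
  rewrite dot_suml; apply: eq_bigr => k _; rewrite dotZl (dotC (f k)); congr (_ * _^*%C).
  rewrite dot_suml (bigD1 k)//= big1 ?addr0 => [|l lk].
    by rewrite dotZl of_// eqxx mulr1.
  by rewrite dotZl of_// [(_ == _ :> nat)](negPf lk) mulr0.
rewrite dot_suml; apply: eq_bigr => k _; rewrite dotZl (dotC (phi k)) dot_proj//.
by rewrite ltn_ord.
Qed.

Definition diag N (mu : nat -> R) t :=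
  basis_map N (fun k => expi (mu k * t) *: phi k).

Lemma diag_isom N mu t : isom (diag N mu t).
Proof.
apply: basis_map_isom => [k l _ _|k kN]; last exact/inFZ/inF_basis.
rewrite dotZl dotZr dot_basis//; have [->|_] := eqVneq k l; last by rewrite !mulr0.
by rewrite mulr1 mul_conjc normc_expi expr1n.
Qed.

Lemma diagE N mu t k : (k < N)%N -> diag N mu t (phi k) = expi (mu k * t) *: phi k.
Proof. by move=> kN; rewrite /diag basis_mapE kN. Qed.

Lemma diag0 N mu : diag N mu 0 = id.
Proof.
apply: isom_ext_basis => [||k]; [exact: diag_isom|exact: isom_id|].
by rewrite /diag basis_mapE; case: ifP => // _; rewrite mulr0 expi0 scale1r.
Qed.

Lemma diagD N mu s t : diag N mu (s + t) = diag N mu s \o diag N mu t.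
Proof.
apply: isom_ext_basis => [||k]; [exact: diag_isom|by apply: isom_comp; exact: diag_isom|].
rewrite /= /diag !basis_mapE; case: ifP => kN; last by rewrite basis_mapE kN.
rewrite -/(diag N mu s) (isomZ _ _ (diag_isom _ _ _)) diagE// scalerA -expiD.
by rewrite mulrDr addrC.
Qed.

(** For [|c| = 1], the exponential of [t] times the skew-Hermitian matrix that sends [phi p] to
    [c phi (p+1)] and [phi (p+1)] to [- c^* phi p]. *)
Definition rot_fun p (t : R) (c : R[i]) (k : nat) : H :=
  if k == p then (cos t)%:C *: phi p + (c * (sin t)%:C) *: phi p.+1
  else if k == p.+1 then (cos t)%:C *: phi p.+1 - (c^*%C * (sin t)%:C) *: phi p
  else phi k.

Definition rot p t c := basis_map p.+2 (rot_fun p t c).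

Lemma rotE p t c k : rot p t c (phi k) = rot_fun p t c k.
Proof.
rewrite /rot basis_mapE; case: ltnP => // pk; rewrite /rot_fun.
by rewrite gtn_eqF ?gtn_eqF// ltnW.
Qed.

Lemma rotE0 p t c :
  rot p t c (phi p) = (cos t)%:C *: phi p + (c * (sin t)%:C) *: phi p.+1.
Proof. by rewrite rotE /rot_fun eqxx. Qed.

Lemma rotE1 p t c :
  rot p t c (phi p.+1) = (cos t)%:C *: phi p.+1 - (c^*%C * (sin t)%:C) *: phi p.
Proof. by rewrite rotE /rot_fun gtn_eqF// eqxx. Qed.

Lemma rotE2 p t c k : k != p -> k != p.+1 -> rot p t c (phi k) = phi k.
Proof. by move=> /negPf kp /negPf kp1; rewrite rotE /rot_fun kp kp1. Qed.

Lemma rot_isom p t c : normc c = 1 -> isom (rot p t c).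
Proof.
move=> c1; have cc : c * c^*%C = 1 by rewrite mul_conjc c1 expr1n.
have csn : (cos t)%:C * (cos t)%:C + (sin t)%:C * (sin t)%:C = 1 :> R[i].
  by rewrite -!rmorphM -rmorphD -!expr2 cos2Dsin2.
have d01 : dotp (phi p) (phi p.+1) = 0 by rewrite dot_basis// ltn_eqF.
have d10 : dotp (phi p.+1) (phi p) = 0 by rewrite dot_basis// gtn_eqF.
have d00 k : dotp (phi k) (phi k) = 1 by rewrite dot_basis// eqxx.
apply: basis_map_isom => [k l kp lp|k kp]; rewrite /rot_fun; last first.
  have F0 : F p.+2 (phi p) by apply: inF_basis.
  have F1 : F p.+2 (phi p.+1) by apply: inF_basis.
  case: ifP => _; first by apply: inFD; exact: inFZ.
  case: ifP => _; last exact: inF_basis.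
  by rewrite -scaleNr; apply: inFD; exact: inFZ.
have small q : (q < p.+2)%N -> q != p -> q != p.+1 -> (q < p)%N.
  by move=> qp /negPf q0 /negPf q1; move: qp; rewrite ltnS leq_eqVlt q1 /= ltnS leq_eqVlt q0.
have lt0 q : (q < p)%N -> [/\ dotp (phi q) (phi p) = 0, dotp (phi q) (phi p.+1) = 0,
    dotp (phi p) (phi q) = 0 & dotp (phi p.+1) (phi q) = 0].
  move=> qp; rewrite !dot_basis// !(ltn_eqF qp) !(gtn_eqF qp).
  by rewrite (ltn_eqF (leqW qp)) (gtn_eqF (leqW qp)).
have [ke|k0] := eqVneq k p; have [le|l0] := eqVneq l p.
- subst k l; rewrite eqxx !(dotDl, dotDr, dotZl, dotZr) d01 d10 !d00 !conjcM !conjc_real.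
  rewrite !mulr0 !mulr1 addr0 add0r -csn.
  rewrite mulr1n.
  apply/eqP; rewrite -subr_eq0 (_ : _ - _ = (c * c^*%C - 1) * ((sin t)%:C * (sin t)%:C)); last by ring.
  by rewrite cc subrr mul0r.
- subst k; have [le|l1] := eqVneq l p.+1.
    subst l; rewrite ltn_eqF// !(dotDl, dotBr, dotZl, dotZr) d01 d10 !d00 !conjcM !conjc_real conjcK.
    rewrite mulr0n; ring.
  have [_ _ h1 h2] := lt0 _ (small _ lp l0 l1).
  by rewrite eq_sym (negPf l0) dotDl !dotZl h1 h2 !mulr0 addr0.
- subst l; have [ke|k1] := eqVneq k p.+1.
    subst k; rewrite gtn_eqF// !(dotBl, dotDr, dotZl, dotZr) d01 d10 !d00 !conjcM !conjc_real.
    rewrite mulr0n; ring.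
  have [h1 h2 _ _] := lt0 _ (small _ kp k0 k1).
  by rewrite (negPf k0) dotDr !dotZr h1 h2 !mulr0 addr0.
- have [ke|k1] := eqVneq k p.+1; have [le|l1] := eqVneq l p.+1.
  + subst k l; rewrite eqxx !(dotBl, dotBr, dotZl, dotZr) d01 d10 !d00 !conjcM !conjc_real conjcK.
    rewrite mulr1n -[RHS]csn.
    apply/eqP; rewrite -subr_eq0 (_ : _ - _ = (c * c^*%C - 1) * ((sin t)%:C * (sin t)%:C)); last by ring.
    by rewrite cc subrr mul0r.
  + subst k; have [_ _ h1 h2] := lt0 _ (small _ lp l0 l1).
    by rewrite eq_sym (negPf l1) dotBl !dotZl h1 h2 !mulr0 subr0.
  + subst l; have [h1 h2 _ _] := lt0 _ (small _ kp k0 k1).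
    by rewrite (negPf k1) dotBr !dotZr h1 h2 !mulr0 subr0.
  + by rewrite dot_basis.
Qed.

Lemma rot0 p c : normc c = 1 -> rot p 0 c = id.
Proof.
move=> c1; apply: isom_ext_basis => [||k]; [exact: rot_isom|exact: isom_id|].
rewrite rotE /rot_fun cos0 sin0 !mulr0 !scale0r !scale1r addr0 subr0.
by case: ifP => [/eqP->//|_]; case: ifP => [/eqP->|].
Qed.

Lemma rotD p c s t : normc c = 1 -> rot p (s + t) c = rot p s c \o rot p t c.
Proof.
move=> c1; have cc : c * c^*%C = 1 by rewrite mul_conjc c1 expr1n.
have ri u := rot_isom p u c1.
apply: isom_ext_basis => [||k]; [exact: ri|exact: isom_comp|] => /=.
have [->|k0] := eqVneq k p.
  rewrite !rotE0 (isomD _ _ (ri s)) !(isomZ _ _ (ri s)) rotE0 rotE1 cosD sinD !rmorphB !rmorphD !rmorphM.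
  apply: dot_extl => w; rewrite ?(dotDl, dotNl, dotZl, dot0l) /=.
  apply/eqP; rewrite -subr_eq0 (_ : _ - _ = (c * c^*%C - 1) * ((sin s)%:C * (sin t)%:C * dotp (phi p) w)); last by ring.
  by rewrite cc subrr mul0r.
have [->|k1] := eqVneq k p.+1; last by rewrite !rotE2.
rewrite !rotE1 (isomB _ _ (ri s)) !(isomZ _ _ (ri s)) rotE0 rotE1 cosD sinD !rmorphB !rmorphD !rmorphM.
apply: dot_extl => w; rewrite ?(dotDl, dotNl, dotZl, dot0l) /=.
apply/eqP; rewrite -subr_eq0 (_ : _ - _ = (c * c^*%C - 1) * ((sin s)%:C * (sin t)%:C * dotp (phi p.+1) w)); last by ring.
by rewrite cc subrr mul0r.
Qed.

Lemma rot_unitary p t c : normc c = 1 -> unitary (rot p t c).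
Proof.
move=> c1; split; first exact: (rot_isom p t c1).1.
- by move=> x y; exact: isom_dot (rot_isom p t c1).
- move=> y; exists (rot p (- t) c y).
  by rewrite -[LHS]/((rot p t c \o rot p (- t) c) y) -rotD// subrr rot0.
Qed.

End BasisMaps.

(** * Strong limits of propagators *)

Section Control.
Context (R : realType) (H : hilbertType R) (delta : R) (A B : operator H)
  (phi : nat -> H) (lambda : nat -> R).
Hypothesis delta_gt0 : 0 < delta.
Hypothesis sys : skew_adjoint_discrete_spectrum_system A B `]0, delta[%classic phi.
Hypothesis wd : controlled_op_well_defined A B `]0, delta[%classic phi.
Hypothesis eig : forall n, A (phi n) = (0 +i* lambda n) *: phi n.
Hypothesis Qind : Q_linearly_independent (fun n => lambda n.+1 - lambda n).
Hypothesis conn : forall n, dotp (B (phi n)) (phi n.+1) != 0.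
Implicit Types (x y z : H) (U V : H -> H) (m : nat -> H) (h r s t u : R) (N j k p : nat).
Local Notation F := (inF phi).

Let bphi : orthonormal_basis phi. Proof. by have [_ ? _ _] := sys. Qed.
Let sA : skew_adjoint A. Proof. by have [[? _] _ _ _] := sys. Qed.
Let domA j : op_dom A (phi j). Proof. by have [_ _ /(_ j)[? _] _] := sys. Qed.

Definition reachable V := exists (k : nat) (t u : nat -> R),
  [/\ (0 < k)%N, forall j, (j < k)%N -> 0 < t j,
      forall j, (j < k)%N -> 0 < u j < delta & V = propagator A B phi t u k].

Lemma controlled_opP u : 0 < u < delta ->
  skew_adjoint_extension (pre_controlled_op A B phi u) (controlled_op A B phi u).
Proof.
move=> hu; have [|L Lext _] := wd (u := u); first by rewrite /= in_itv.
rewrite /controlled_op /skew_adjoint_closure; case: xgetP => [L' _ //|/(_ L)].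
by case.
Qed.

Lemma controlled_op_skew u : 0 < u < delta -> skew_adjoint (controlled_op A B phi u).
Proof. by case/controlled_opP. Qed.

Lemma controlled_op_basis u j : 0 < u < delta ->
  op_dom (controlled_op A B phi u) (phi j) /\
  controlled_op A B phi u (phi j) = A (phi j) + u%:C *: B (phi j).
Proof.
move=> /controlled_opP[_ [dom val]].
have D0 : op_dom (pre_controlled_op A B phi u) (phi j).
  have [_ _ _ /(_ j) domB] := sys.
  by split; split=> //; exact: (span_basis bphi).
by split; [exact: dom | rewrite val].
Qed.

Local Notation E u t := (op_exp (controlled_op A B phi u) t).

Lemma propagator_isom (t u : nat -> R) k : (forall j, (j < k)%N -> 0 < u j < delta) ->
  isom (propagator A B phi t u k).
Proof.
elim: k => [|k IH] hu; first exact: isom_id.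
apply: isom_comp; last by apply: IH => j jk; apply: hu; exact: ltnW.
by apply/op_exp_isom/controlled_op_skew/hu.
Qed.

Lemma propagator_unitary (t u : nat -> R) k : (forall j, (j < k)%N -> 0 < u j < delta) ->
  unitary (propagator A B phi t u k).
Proof.
elim: k => [|k IH] hu; first exact: unitary_id.
apply: unitary_comp; last by apply: IH => j jk; apply: hu; exact: ltnW.
by apply/op_exp_unitary/controlled_op_skew/hu.
Qed.

Lemma propagator_eq (t t' u u' : nat -> R) k :
  (forall j, (j < k)%N -> t j = t' j) -> (forall j, (j < k)%N -> u j = u' j) ->
  propagator A B phi t u k = propagator A B phi t' u' k.
Proof.
elim: k => //= k IH ht hu; rewrite ht// hu// IH// => j jk; [apply: ht|apply: hu];
  exact: ltnW.
Qed.

Lemma propagator_cat (t u t' u' : nat -> R) k k' :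
  propagator A B phi (fun j => if (j < k)%N then t j else t' (j - k)%N)
    (fun j => if (j < k)%N then u j else u' (j - k)%N) (k' + k) =
  propagator A B phi t' u' k' \o propagator A B phi t u k.
Proof.
elim: k' => [|k' IH]; last first.
  by rewrite addSn /= IH ltnNge leq_addl /= addnK.
by rewrite add0n; apply: propagator_eq => j ->.
Qed.

Lemma reachable_comp V V' : reachable V -> reachable V' -> reachable (V \o V').
Proof.
move=> [k' [t' [u' [k'0 ht' hu' ->]]]] [k [t [u [k0 ht hu ->]]]].
exists (k' + k)%N, (fun j => if (j < k)%N then t j else t' (j - k)%N),
  (fun j => if (j < k)%N then u j else u' (j - k)%N).
split; [by rewrite addn_gt0 k0 orbT| | |by rewrite propagator_cat].
  by move=> j jk; case: ltnP => [/ht//|kj]; apply: ht'; rewrite ltn_subLR// addnC.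
by move=> j jk; case: ltnP => [/hu//|kj]; apply: hu'; rewrite ltn_subLR// addnC.
Qed.

Lemma reachable_isom V : reachable V -> isom V.
Proof. by move=> [k [t [u [_ _ hu ->]]]]; exact: propagator_isom. Qed.

Lemma reachable_exp u t : 0 < u < delta -> 0 < t -> reachable (E u t).
Proof. by move=> hu ht; exists 1, (fun=> t), (fun=> u). Qed.

Local Notation trk := (tracks reachable).
Local Notation inft := (infinitesimal phi reachable).
Let Sc := reachable_comp.
Let Si := reachable_isom.

(* For m with e^{i m mu_k t} close to 1, g ((m - 1) t) is close to g (- t). *)
Lemma recurrent_tracks N (mu : nat -> R) (g : R -> H -> H) t :
  (forall t, isom (g t)) ->
  (forall t k, (k < N)%N -> g t (phi k) = expi (mu k * t) *: phi k) ->
  (forall t, 0 < t -> trk (F N) (g t)) -> 0 < t -> trk (F N) (g (- t)).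
Proof.
move=> gi ge gt t0; apply: tracks_closed => s hs r r0.
have [d d0 hd] := isom_seq_close bphi hs r0.
have [m m1 hm] := recurrence N (fun k => mu k * t) d0.
exists (g (m.-1%:R * t)).
  by apply: gt; rewrite mulr_gt0// ltr0n -ltnS prednK// ltnW.
apply: hd => // k kN; rewrite !ge// -scalerBl nrmZ nrm_basis// mulr1.
have -> : mu k * (m.-1%:R * t) = m%:R * (mu k * t) + mu k * (- t).
  by rewrite -{2}(prednK (ltnW m1)) -natr1; ring.
rewrite expiD -{2}[expi (mu k * - t)]mul1r -mulrBl Normc.normcM normc_expi mulr1.
exact: hm.
Qed.

Lemma expi_basis_der (mu : R) j r : 0 < r -> exists2 d, 0 < d & forall h, `|h| < d ->
  nrm (expi (mu * h) *: phi j - phi j - h%:C *: ((0 +i* mu) *: phi j)) <= r * `|h|.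
Proof.
move=> r0; have m0 : 0 < `|mu| + 1 by rewrite ltr_wpDl.
have [d d0 hd] := expi_taylor (divr_gt0 r0 m0).
exists (d / (`|mu| + 1)); first by rewrite divr_gt0.
move=> h; rewrite ltr_pdivlMr// => hh.
have -> : expi (mu * h) *: phi j - phi j - h%:C *: ((0 +i* mu) *: phi j) =
    (expi (mu * h) - 1 - (0 +i* (mu * h))) *: phi j.
  have -> : (0 +i* (mu * h)) = h%:C * (0 +i* mu).
    by apply/eqP; rewrite eq_complex /= !mulr0 !mul0r subrr addr0 mulrC !eqxx.
  vec.
rewrite nrmZ nrm_basis// mulr1.
have mh : `|mu * h| <= `|h| * (`|mu| + 1).
  by rewrite normrM mulrC ler_wpM2l// lerDl.
apply: le_trans (hd _ (le_lt_trans mh hh)) _.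
rewrite -mulrA ler_pM2l// mulrC ler_pdivrMr//.
Qed.

(** * The free evolution and its inverse *)

Local Notation GA t := (op_exp A t).

(** Only the derivative of the group at 0 is known. Both sides come from [n] steps of length [t/n],
    with defect at most [2 r |t|/n] each, which adds up to at most [e]. *)
Lemma expA_basis t j : GA t (phi j) = expi (lambda j * t) *: phi j.
Proof.
apply/eqP; rewrite -subr_eq0; apply/eqP/nrm_eps => e e0.
have t1 : 0 < `|t| + 1 by rewrite ltr_wpDl.
pose r := e / (`|t| + 1) / 2; have r0 : 0 < r by rewrite !divr_gt0.
have [d d0 hd] := op_exp_der sA (domA j) r0.
have [d' d'0 hd'] := expi_basis_der (lambda j) j r0.
have dm : 0 < Num.min d d' by rewrite lt_min d0.
pose n := (Num.trunc (`|t| / Num.min d d')).+1.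
have n0 : 0 < n%:R :> R by rewrite ltr0Sn.
pose h := t / n%:R; have nh : n%:R * h = t by rewrite mulrC divfK// gt_eqF.
have hE : `|h| = `|t| / n%:R by rewrite normf_div normr_nat.
have : `|h| < Num.min d d'.
  by rewrite hE ltr_pdivrMr// [_ * n%:R]mulrC -ltr_pdivrMr// truncnS_gt.
rewrite lt_min => /andP[h1 h2].
pose V x := expi (lambda j * h) *: x.
have VE i : iter i V (phi j) = expi (lambda j * (i%:R * h)) *: phi j.
  elim: i => [|i IH]; first by rewrite mul0r mulr0 expi0 scale1r.
  by rewrite iterS IH /V scalerA -expiD -natr1; congr (expi _ *: _); ring.
have giter i : GA (i%:R * h) = iter i (GA h).
  apply/funext => x; elim: i x => [|i IH] x; first by rewrite mul0r op_exp0.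
  by rewrite iterS -IH -natr1 mulrDl mul1r addrC op_expD.
rewrite -nh giter -VE.
apply: le_trans (isom_iter_diff (d := 2 * r * `|h|) (op_exp_isom sA h) _) _.
  move=> i _; rewrite VE (isomZ _ _ (op_exp_isom sA h)) /V scalerA [expi _ * expi _]mulrC -scalerA.
  rewrite -scalerBr nrmZ normc_expi mul1r.
  have := hd _ h1; have := hd' _ h2; rewrite eig.
  set a := _ - _ - _ => ha; set b := _ - _ - _ => hb.
  have -> : GA h (phi j) - expi (lambda j * h) *: phi j = b - a by rewrite /a /b; vec.
  apply: le_trans (nrmB_le _ 0 _) _; rewrite subr0 sub0r nrmN; lra.
rewrite hE mulrCA [n%:R * _]mulrC divfK ?gt_eqF//.
have -> : 2 * r * `|t| = e * (`|t| / (`|t| + 1)) by rewrite /r; field; rewrite gt_eqF.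
by rewrite -[leRHS]mulr1 ler_pM2l// ler_pdivrMr// mul1r lerDl.
Qed.

Lemma ctrl_bound j u : 0 < u < delta ->
  forall r, 0 < r -> exists2 d, 0 < d & forall h, 0 < h < d ->
    nrm (E u h (phi j) - phi j - h%:C *: (A (phi j) + u%:C *: B (phi j))) <= r * h.
Proof.
move=> hu r r0; have [D0 vE] := controlled_op_basis j hu.
have [d d0 hd] := op_exp_der (controlled_op_skew hu) D0 r0.
exists d => // h /andP[h0 h1]; have := hd h; rewrite gtr0_norm// vE; exact.
Qed.

(** On [phi j], the admissible generator [A + uB] is within [u |B phi_j|] of [A]; finitely many [j]
    enter, so one small [u] serves. *)
Lemma infinitesimal_A N : inft N (fun j => A (phi j)).
Proof.
apply: infinitesimal_lim => r r0.
have [M M0 hM] := nat_bound N (fun j => nrm (B (phi j))).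
have M1 : 0 < M + 1 by lra.
pose u := Num.min (delta / 2) (r / (M + 1)).
have u0 : 0 < u by rewrite lt_min !divr_gt0.
have ud : 0 < u < delta by rewrite u0 gt_min ltr_pdivrMr// ltr_pMr// ltr1n.
exists (fun j => A (phi j) + u%:C *: B (phi j)).
  apply: (infinitesimal_der bphi (G := fun h => E u h)) => [h h0|r' j r'0 jN].
    by apply: tracks_mem; exact: reachable_exp.
  exact: ctrl_bound.
move=> j jN; rewrite addrC addKr nrmZr gtr0_norm//.
have : u <= r / (M + 1) by rewrite ge_min lexx orbT.
rewrite ler_pdivlMr//; apply: le_trans; apply: ler_wpM2l; first exact: ltW.
by apply: le_trans (hM j jN) _; lra.
Qed.

Lemma tracks_expA t : trk setT (GA t).
Proof.
have gi s := op_exp_isom sA s.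
have pos s : 0 < s -> trk setT (GA s).
  move=> s0; apply: (tracks_full bphi Si) => // N.
  apply: (infinitesimal_tracks bphi Si Sc (m := fun j => A (phi j)) (g := fun t => GA t)) => //.
  - exact: op_exp0.
  - by move=> a b; apply/funext => x; exact: op_expD.
  - by move=> a j jN; rewrite expA_basis; apply: inFZ; exact: inF_basis.
  - move=> r j r0 jN; have [d d0 hd] := op_exp_der sA (domA j) r0.
    by exists d => // h /andP[h0 h1]; have := hd h; rewrite gtr0_norm//; exact.
  - exact: infinitesimal_A.
have neg s : 0 < s -> trk setT (GA (- s)).
  move=> s0; apply: (tracks_full bphi Si) => // N.
  apply: (recurrent_tracks (mu := lambda) (g := fun t => GA t)) => //.
    by move=> a k _; exact: expA_basis.
  by move=> a a0; apply: tracksS (pos a a0).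
have [t0|t0|<-] := ltgtP 0 t; first exact: pos.
  by rewrite -(opprK t); apply: neg; rewrite oppr_gt0.
(* Propagators have at least one factor, so the identity is obtained by composing limits. *)
have -> : GA 0 = GA 1 \o GA (- 1).
  by apply/funext => x /=; rewrite -op_expD// subrr.
by apply: (tracks_comp Si Sc (W := setT)) => //; [exact: pos|exact: neg].
Qed.


Definition generates (G : R -> H -> H) m := [/\ forall h, 0 < h -> trk setT (G h),
  forall h, isom (G h),
  forall x r, 0 < r -> exists2 d, 0 < d & forall h, 0 < h < d -> nrm (G h x - x) <= r &
  forall j r, 0 < r -> exists2 d, 0 < d & forall h, 0 < h < d ->
    nrm (G h (phi j) - phi j - h%:C *: m j) <= r * h].

Lemma generates_comp G G' m m' : generates G m -> generates G' m' ->
  generates (fun h => G h \o G' h) (fun j => m j + m' j).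
Proof.
move=> [tG iG cG dG] [tG' iG' cG' dG']; split.
- by move=> h h0; apply: (tracks_comp Si Sc (W := setT)); [exact: tG|exact: tG'|].
- by move=> h; exact: isom_comp.
- move=> x r r0; have r2 : 0 < r / 2 by rewrite divr_gt0.
  have [d d0 hd] := cG x _ r2; have [d' d'0 hd'] := cG' x _ r2.
  exists (Num.min d d'); first by rewrite lt_min d0.
  move=> h /andP[h0]; rewrite lt_min => /andP[h1 h2] /=.
  apply: le_trans (nrmB_le _ (G h x) _) _; rewrite isom_dist//.
  have := hd h; have := hd' h; rewrite h0 h1 h2 => /(_ isT) + /(_ isT); lra.
- move=> j r r0; have r3 : 0 < r / 3 by rewrite divr_gt0.
  have [d d0 hd] := dG j _ r3; have [d' d'0 hd'] := dG' j _ r3.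
  have [d2 d20 hd2] := cG (m' j) _ r3.
  exists (Num.min (Num.min d d') d2); first by rewrite !lt_min d0 d'0.
  move=> h /andP[h0]; rewrite !lt_min => /andP[/andP[h1 h2] h3] /=.
  have {}hd := hd h; have {}hd' := hd' h; have {}hd2 := hd2 h.
  rewrite h0 h1 in hd; rewrite h0 h2 in hd'; rewrite h0 h3 in hd2.
  have {}hd := hd isT; have {}hd' := hd' isT; have {}hd2 := hd2 isT.
  have -> : G h (G' h (phi j)) - phi j - h%:C *: (m j + m' j) =
      G h (G' h (phi j) - phi j - h%:C *: m' j) + (G h (phi j) - phi j - h%:C *: m j)
      + h%:C *: (G h (m' j) - m' j).
    by rewrite 2!(isomB _ _ (iG h)) (isomZ _ _ (iG h)); vec.
  apply: le_trans (nrmD _ _) _; apply: le_trans (lerD (nrmD _ _) (lexx _)) _.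
  rewrite (iG h).2 nrmZr gtr0_norm//.
  have := ler_wpM2l (ltW h0) hd2; lra.
Qed.

(** Any value in [(0, delta)] would do: averaging isolates the couplings without varying [u]. *)
Let u := delta / 2.
Let hu : 0 < u < delta.
Proof. by rewrite divr_gt0//= ltr_pdivrMr// ltr_pMr// ltr1n. Qed.
Let w j := A (phi j) + u%:C *: B (phi j).

(* e^{-sA}(A + uB)e^{sA} phi_j *)
Definition rotated s j : H := expi (lambda j * s) *: GA (- s) (w j).

(** [phi j] being an eigenvector, [e^{sA}] acts on it by a phase, so the derivative of the flow of
    [A + uB] is taken at [phi j] itself, which lies in the domain. *)
Lemma generates_conj s :
  generates (fun h => GA (- s) \o (E u h \o GA s)) (rotated s).
Proof.
have iE h := op_exp_isom (controlled_op_skew hu) h.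
have iA h := op_exp_isom sA h.
split.
- move=> h h0; apply: (tracks_comp Si Sc (W := setT)) => //; first exact: tracks_expA.
  apply: (tracks_comp Si Sc (W := setT)) => //; last exact: tracks_expA.
  by apply: tracks_mem; exact: reachable_exp.
- by move=> h; do 2 apply: isom_comp => //.
- move=> x r r0; have [d d0 hd] := op_exp_cont (controlled_op_skew hu) (GA s x) r0.
  exists d => // h /andP[h0 h1] /=.
  have xE : x = GA (- s) (GA s x) by rewrite -op_expD// addNr op_exp0.
  by rewrite [X in _ - X]xE isom_dist// ltW// hd// gtr0_norm.
- move=> j r r0; have [d d0 hd] := ctrl_bound j hu r0.
  exists d => // h hh; have := hd h hh; rewrite /= -/(w j).
  have e1 : expi (lambda j * s) *: GA (- s) (phi j) = phi j.
    by rewrite expA_basis scalerA -expiD mulrN subrr expi0 scale1r.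
  have -> : GA (- s) (E u h (GA s (phi j))) - phi j - h%:C *: rotated s j =
      expi (lambda j * s) *: GA (- s) (E u h (phi j) - phi j - h%:C *: w j).
    rewrite expA_basis (isomZ _ _ (iE h)) (isomZ _ _ (iA (- s))).
    rewrite 2!(isomB _ _ (iA (- s))) (isomZ _ _ (iA (- s))) /rotated !scalerBr e1.
    vec.
  by rewrite nrmZ normc_expi mul1r (iA (- s)).2.
Qed.

Lemma generates_sum (s : nat -> R) n :
  exists G, generates G (fun j => \sum_(i < n.+1) rotated (s i) j).
Proof.
elim: n => [|n [G hG]].
  exists (fun h => GA (- s 0%N) \o (E u h \o GA (s 0%N))).
  have -> : (fun j => \sum_(i < 1) rotated (s i) j) = rotated (s 0%N).
    by apply/funext => j; rewrite big_ord1.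
  exact: generates_conj.
exists (fun h => G h \o (GA (- s n.+1) \o (E u h \o GA (s n.+1)))).
have -> : (fun j => \sum_(i < n.+2) rotated (s i) j) =
    (fun j => \sum_(i < n.+1) rotated (s i) j + rotated (s n.+1) j).
  by apply/funext => j; rewrite big_ord_recr.
by apply: generates_comp => //; exact: generates_conj.
Qed.

(** Sums come from composing the conjugated flows, the factor [1/(n+1)] from rescaling time. *)
Lemma infinitesimal_avg N (s : nat -> R) n :
  inft N (fun j => (n.+1%:R^-1)%:C *: \sum_(i < n.+1) rotated (s i) j).
Proof.
have [G [tG iG cG dG]] := generates_sum s n.
apply: infinitesimalZ; first by rewrite invr_gt0 ltr0Sn.
apply: (infinitesimal_der bphi (G := G)) => [h h0|r j r0 jN]; last exact: dG.
exact: tracksS (tG h h0).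
Qed.

Lemma phase_avg (mu s0 P : R) :
  exists2 C, 0 <= C & forall n,
    normc ((n.+1%:R^-1)%:C * (\sum_(i < n.+1) expi (mu * (s0 + i%:R * P))) -
      (if expi (mu * P) == 1 then expi (mu * s0) else 0)) <= C / n.+1%:R.
Proof.
have E0 n : \sum_(i < n.+1) expi (mu * (s0 + i%:R * P)) =
    expi (mu * s0) * \sum_(i < n.+1) expi (mu * P) ^+ i.
  rewrite mulr_sumr; apply: eq_bigr => i _.
  by rewrite -expi_nat -expiD; congr expi; ring.
case: ifP => [/eqP e|/negbT e].
  exists 0 => // n; rewrite E0 e.
  under eq_bigr do rewrite expr1n.
  rewrite sumr_const card_ord mulrCA fmorphV rmorph_nat mulVf ?pnatr_eq0//.
  by rewrite mulr1 subrr Normc.normc0 mul0r.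
exists (2 / normc (expi (mu * P) - 1)).
  by rewrite divr_ge0// normc_ge0.
move=> n; rewrite subr0 E0 !Normc.normcM normc_expi mul1r normcR.
rewrite ger0_norm ?invr_ge0// mulrC ler_wpM2r ?invr_ge0//.
by apply: geometric_sum_le => //; exact: normc_expi.
Qed.

Definition resonant (P : R) j k := expi ((lambda j - lambda k) * P) == 1.

(* Mean ergodic theorem for the unitary e^{i lambda_j P} e^{-PA}, whose fixed
   vectors are spanned by the phi_k resonant with phi_j. *)
Lemma rotated_avg (s0 P : R) j (T : H) :
  (forall k, dotp T (phi k) = if resonant P j k then
     expi ((lambda j - lambda k) * s0) * dotp (w j) (phi k) else 0) ->
  forall r, 0 < r -> exists n0, forall n, (n0 <= n)%N ->
    nrm ((n.+1%:R^-1)%:C *: (\sum_(i < n.+1) rotated (s0 + i%:R * P) j) - T) <= r.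
Proof.
move=> hT r r0; have r4 : 0 < r / 4 by rewrite divr_gt0.
have iA h := op_exp_isom sA h.
have [M1 hM1] := proj_approx bphi (w j) r4; have [M2 hM2] := proj_approx bphi T r4.
pose M := maxn M1 M2.
have {hM1} hw := hM1 M (leq_maxl _ _); have {hM2} hTM := hM2 M (leq_maxr _ _).
pose avg n x := (n.+1%:R^-1)%:C *: (\sum_(i < n.+1)
   expi (lambda j * (s0 + i%:R * P)) *: GA (- (s0 + i%:R * P)) x).
have avgB n x y : avg n (x - y) = avg n x - avg n y.
  rewrite /avg -scalerBr -sumrB; congr (_ *: _); apply: eq_bigr => i _.
  by rewrite (isomB _ _ (iA _)) scalerBr.
have avg_le n x : nrm (avg n x) <= nrm x.
  rewrite /avg nrmZr ger0_norm ?invr_ge0// ler_pdivrMl ?ltr0Sn//.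
  apply: le_trans (nrm_sum _ _ _) _.
  rewrite (eq_bigr (fun=> nrm x)); first by rewrite sumr_const card_ord mulr_natl.
  by move=> i _; rewrite nrmZ normc_expi mul1r (iA _).2.
have avg_proj n : avg n (proj phi M (w j)) = \sum_(k < M)
    (dotp (w j) (phi k) * ((n.+1%:R^-1)%:C *
      (\sum_(i < n.+1) expi ((lambda j - lambda k) * (s0 + i%:R * P))))) *: phi k.
  rewrite /avg.
  transitivity ((n.+1%:R^-1)%:C *: (\sum_(i < n.+1) \sum_(k < M)
     (dotp (w j) (phi k) * expi ((lambda j - lambda k) * (s0 + i%:R * P))) *: phi k)).
    congr (_ *: _); apply: eq_bigr => i _.
    rewrite (isom_sum _ _ _ (iA _)) scaler_sumr; apply: eq_bigr => k _.
    rewrite (isomZ _ _ (iA _)) expA_basis !scalerA mulrAC -expiD.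
    congr (_ *: _); rewrite [LHS]mulrC; congr (_ * expi _); ring.
  rewrite exchange_big scaler_sumr; apply: eq_bigr => k _ /=.
  by rewrite -scaler_suml scalerA -mulr_sumr mulrCA.
(* On the truncation to [F M], the finitely many coefficients converge at a common rate; [avg] being
   a contraction, the tail of [w j] costs at most [r/4]. *)
have [C [C0 hC]] : exists C, 0 <= C /\ forall n,
    nrm (avg n (proj phi M (w j)) - proj phi M T) <= C / n.+1%:R.
  have /choice[c hc] : forall k, exists C, 0 <= C /\ forall n,
      normc ((n.+1%:R^-1)%:C * (\sum_(i < n.+1) expi ((lambda j - lambda k) * (s0 + i%:R * P))) -
      (if resonant P j k then expi ((lambda j - lambda k) * s0) else 0)) <= C / n.+1%:R.
    by move=> k; have [C C0 hC] := phase_avg (lambda j - lambda k) s0 P; exists C.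
  have c0 k : 0 <= c k by have [] := hc k.
  have cP k := (hc k).2.
  exists (\sum_(k < M) normc (dotp (w j) (phi k)) * c k); split.
    by apply: sumr_ge0 => k _; rewrite mulr_ge0 ?normc_ge0.
  move=> n; rewrite avg_proj /proj -sumrB; apply: le_trans (nrm_sum _ _ _) _.
  rewrite mulr_suml; apply: ler_sum => k _.
  rewrite -scalerBl nrmZ nrm_basis// mulr1 hT.
  have -> : (if resonant P j k then
     expi ((lambda j - lambda k) * s0) * dotp (w j) (phi k) else 0) =
     dotp (w j) (phi k) * (if resonant P j k then expi ((lambda j - lambda k) * s0) else 0).
    by case: ifP => _; rewrite ?mulr0// mulrC.
  by rewrite -mulrBr Normc.normcM -mulrA ler_wpM2l ?normc_ge0.
have C1 : 0 < C + 1 by lra.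
have [n0 hn0] := invS_small (divr_gt0 r4 C1).
exists n0 => n /hn0; rewrite ltr_pdivlMr// => hn.
have -> : (n.+1%:R^-1)%:C *: (\sum_(i < n.+1) rotated (s0 + i%:R * P) j) - T =
    avg n (w j - proj phi M (w j)) + (avg n (proj phi M (w j)) - proj phi M T)
    + (proj phi M T - T).
  by rewrite avgB -/(avg n (w j)); vec.
apply: le_trans (nrmD _ _) _; apply: le_trans (lerD (nrmD _ _) (lexx _)) _.
have := avg_le n (w j - proj phi M (w j)); have := hC n.
rewrite (nrmBC (proj _ _ _) T); have : C / n.+1%:R <= r / 4.
  apply: le_trans (ltW hn); rewrite mulrC ler_wpM2l ?invr_ge0//; lra.
move: (C / n.+1%:R) => v; lra.
Qed.

Lemma infinitesimal_resonant N (s0 P : R) (T : nat -> H) :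
  (forall j k, (j < N)%N -> dotp (T j) (phi k) = if resonant P j k then
     expi ((lambda j - lambda k) * s0) * dotp (w j) (phi k) else 0) ->
  inft N T.
Proof.
move=> hT; apply: infinitesimal_lim => r r0.
have [n hn] : exists n0, forall n, (n0 <= n)%N -> forall j, (j < N)%N ->
    nrm ((n.+1%:R^-1)%:C *: (\sum_(i < n.+1) rotated (s0 + i%:R * P) j) - T j) <= r.
  elim: N hT => [|N IH] hT; first by exists 0.
  have [n1 h1] := IH (fun j k jN => hT j k (leqW jN)).
  have [n2 h2] := rotated_avg (fun k => hT N k (ltnSn N)) r0.
  exists (maxn n1 n2) => n; rewrite geq_max => /andP[n1n n2n] j.
  by rewrite ltnS leq_eqVlt => /predU1P[->|jN]; [exact: h2|exact: h1].
exists (fun j => (n.+1%:R^-1)%:C *: \sum_(i < n.+1) rotated (s0 + i%:R * P) j).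
  exact: (infinitesimal_avg N (fun i => s0 + i%:R * P) n).
exact: hn.
Qed.

(** * Selecting couplings by nonresonance *)

Let cf k j := dotp (w j) (phi k).

Lemma coupling_skew k j : cf k j = - (cf j k)^*%C.
Proof.
have [Dj Ej] := controlled_op_basis j hu; have [Dk Ek] := controlled_op_basis k hu.
have := skewE (controlled_op_skew hu) Dj Dk; rewrite Ej Ek => e.
by rewrite /cf /w e -dotC.
Qed.

Let mu j := complex.Im (cf j j).

Lemma coupling_diag j : cf j j = 0 +i* mu j.
Proof.
have := coupling_skew j j; rewrite /mu; case: (cf j j) => a b [h _].
by congr (_ +i* _); lra.
Qed.

Lemma coupling_neq0 p : cf p.+1 p != 0.
Proof.
rewrite /cf /w dotDl eig !dotZl dot_basis// ltn_eqF// mulr0 add0r mulf_neq0//.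
by rewrite -[0]/(0%:C) (inj_eq (@complexI R)) lt0r_neq0//; have /andP[] := hu.
Qed.

Lemma gap_neq0 p : lambda p.+1 - lambda p != 0.
Proof.
apply/eqP => e; have [|_ _] := gap_combination Qind (p := p) (m := 0) (ltnSn p).
  by rewrite e mulr0.
by [].
Qed.

Lemma gap_multiple p j k (m : int) : lambda j - lambda k = m%:~R * (lambda p.+1 - lambda p) ->
  j != k -> (m == 1) && ((j == p.+1) && (k == p)) || (m == -1) && ((j == p) && (k == p.+1)).
Proof.
move=> e; rewrite neq_ltn => /orP[jk|kj].
  have [|-> -> m1] := gap_combination Qind (p := p) (m := - m) jk.
    by rewrite mulrNz mulNr -e opprB.
  by rewrite -(opprK m) m1 !eqxx orbT.
by have [-> -> ->] := gap_combination Qind kj e; rewrite !eqxx.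
Qed.

(* The step 2 pi / (q gap) is used with q = 1, to keep the transition between p
   and p + 1, and with q = 2, to average it out. *)
Lemma resonantP p (q : nat) j k : (0 < q)%N ->
  resonant (2 * pi / (q%:R * (lambda p.+1 - lambda p))) j k ->
  exists m : int, lambda j - lambda k = (m * q%:Z)%:~R * (lambda p.+1 - lambda p).
Proof.
move=> q0 /eqP/expi_eq1[m e]; exists m; move: e (gap_neq0 p) (pi_gt0 R).
move: (pi) (lambda p.+1 - lambda p) (lambda j - lambda k) => c a b e a0 c0.
have q1 : q%:R != 0 :> R by rewrite pnatr_eq0 -lt0n.
have c1 := lt0r_neq0 c0; rewrite intrM.
have {1}-> : b = b * (2 * c / (q%:R * a)) * (q%:R * a) / (2 * c).
  by field; rewrite c1 q1 a0.
rewrite e -[q%:~R]/(q%:R); field; exact: c1.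
Qed.

(** For [j != k], resonance would make [lambda j - lambda k] an even multiple of the gap, whereas
    [gap_multiple] only allows 1 and -1. *)
Lemma resonant_diag p j k :
  resonant (2 * pi / (2%:R * (lambda p.+1 - lambda p))) j k = (j == k).
Proof.
apply/idP/eqP => [h|->]; last by rewrite /resonant subrr mul0r expi0.
have [m e] := resonantP (q := 2) isT h; apply/eqP/negPn/negP => jk.
have := gap_multiple e jk.
by case/orP => /andP[/eqP m1 _]; move: m1; case: m {e} => [[|m]|[|m]].
Qed.

Lemma resonant_pair p j k : resonant (2 * pi / (1%:R * (lambda p.+1 - lambda p))) j k =
  [|| j == k, (j == p) && (k == p.+1) | (j == p.+1) && (k == p)].
Proof.
have g0 := gap_neq0 p.
apply/idP/idP => [h|].
  have [m e] := resonantP (q := 1) isT h; have [//|jk] := eqVneq j k.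
  by have := gap_multiple e jk; case/orP => /andP[_ ->]; rewrite ?orbT.
case/or3P => [/eqP->|/andP[/eqP-> /eqP->]|/andP[/eqP-> /eqP->]].
- by rewrite /resonant subrr mul0r expi0.
- have -> : resonant (2 * pi / (1%:R * (lambda p.+1 - lambda p))) p p.+1 =
      (expi (- (2 * (pi : R))) == 1).
    rewrite /resonant; congr (expi _ == _); move: g0 (pi) => g0 c; field.
    exact: g0.
  by rewrite expiN expi_2pi conjc1.
- have -> : resonant (2 * pi / (1%:R * (lambda p.+1 - lambda p))) p.+1 p =
      (expi (2 * (pi : R)) == 1).
    rewrite /resonant; congr (expi _ == _); move: g0 (pi) => g0 c; field.
    exact: g0.
  by rewrite expi_2pi.
Qed.

Lemma infinitesimal_diag N : inft N (fun j => (0 +i* mu j) *: phi j).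
Proof.
(* Any gap would do: half the step attached to one of them already removes all transitions. *)
apply: (infinitesimal_resonant (s0 := 0) (P := 2 * pi / (2%:R * (lambda 1 - lambda 0%N)))).
move=> j k _; rewrite resonant_diag dotZl dot_basis// mulr0 expi0 mul1r.
by case: eqVneq => [->|_]; rewrite ?mulr0// mulr1 -coupling_diag.
Qed.

Lemma infinitesimal_diagN N : inft N (fun j => - ((0 +i* mu j) *: phi j)).
Proof.
have der r j : 0 < r -> (j < N)%N -> exists2 d, 0 < d & forall h, `|h| < d ->
    nrm (diag phi N mu h (phi j) - phi j - h%:C *: ((0 +i* mu j) *: phi j)) <= r * `|h|.
  move=> r0 jN; have [d d0 hd] := expi_basis_der (mu j) j r0; exists d => // h hh.
  by rewrite diagE//; exact: hd.
have pos t : 0 < t -> trk (F N) (diag phi N mu t).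
  apply: (infinitesimal_tracks bphi Si Sc (m := fun j => (0 +i* mu j) *: phi j)).
  - exact: diag_isom.
  - exact: diag0.
  - exact: diagD.
  - by move=> a j jN; rewrite diagE//; apply: inFZ; exact: inF_basis.
  - move=> r j r0 jN; have [d d0 hd] := der r j r0 jN.
    by exists d => // h /andP[h0 h1]; have := hd h; rewrite gtr0_norm//; exact.
  - exact: infinitesimal_diag.
apply: (infinitesimal_der bphi (G := fun h => diag phi N mu (- h))) => [h h0|r j r0 jN].
  apply: (recurrent_tracks (mu := mu) (g := diag phi N mu)) => //.
  - exact: diag_isom.
  - by move=> a k kN; exact: diagE.
have [d d0 hd] := der r j r0 jN; exists d => // h /andP[h0 h1].
have := hd (- h); rewrite normrN gtr0_norm// => /(_ h1).
by rewrite rmorphN scaleNr scalerN.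
Qed.

Let transfer p (a : R[i]) j : H :=
  if j == p then a *: phi p.+1 else if j == p.+1 then - (a^*%C *: phi p) else 0.

(** The full step gives the diagonal plus the coupling of [p] and [p+1]; the opposite diagonal,
    whose values stay in [F N], can be added by [infinitesimalD] and cancels the former. *)
Lemma infinitesimal_transfer N p s0 : (p.+1 < N)%N ->
  inft N (transfer p (expi (- ((lambda p.+1 - lambda p) * s0)) * cf p.+1 p)).
Proof.
move=> pN; set a := _ * _.
have h1 : inft N (fun j => (0 +i* mu j) *: phi j + transfer p a j).
  apply: (infinitesimal_resonant (s0 := s0)
    (P := 2 * pi / (1%:R * (lambda p.+1 - lambda p)))) => j k _.
  rewrite resonant_pair dotDl dotZl dot_basis// -coupling_diag /transfer.
  have [->|jp] := eqVneq j p.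
    rewrite dotZl dot_basis// [p == p.+1]ltn_eqF// orbF /=.
    have [<-|pk] := eqVneq p k.
      by rewrite gtn_eqF// mulr1 mulr0 addr0 subrr mul0r expi0 mul1r.
    rewrite eq_sym mulr0 add0r; have [->|_] := eqVneq k p.+1; last by rewrite mulr0.
    by rewrite mulr1 /a -mulNr opprB.
  have [->|jp1] := eqVneq j p.+1.
    rewrite dotNl dotZl dot_basis//=.
    have [<-|pk] := eqVneq p.+1 k.
      by rewrite ltn_eqF// mulr1 mulr0 oppr0 addr0 subrr mul0r expi0 mul1r.
    rewrite eq_sym mulr0 add0r; have [->|_] := eqVneq k p; last by rewrite mulr0 oppr0.
    by rewrite mulr1 /a conjcM -expiN opprK -mulrN -coupling_skew.
  rewrite dot0l addr0 /=; have [<-|_] := eqVneq j k; last by rewrite mulr0.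
  by rewrite mulr1 subrr mul0r expi0 mul1r.
have h2 := infinitesimalD bphi Si Sc h1 (infinitesimal_diagN N).
have <- : (fun j => (0 +i* mu j) *: phi j + transfer p a j - (0 +i* mu j) *: phi j) =
   transfer p a by apply/funext => j; rewrite addrC addKr.
apply: h2 => j jN; rewrite -scaleNr; apply: inFZ; exact: inF_basis.
Qed.

Lemma tracks_rot p t (z : R[i]) : normc z = 1 -> 0 < t -> trk setT (rot phi p t z).
Proof.
move=> z1 t0; have ri s := rot_isom bphi p s z1.
apply: (tracks_full bphi Si) => // N.
pose M := maxn N p.+2.
suff : trk (F M) (rot phi p t z).
  by apply: tracksS => x; apply: inFW => //; exact: leq_maxl.
have pM : (p.+1 < M)%N by exact: leq_maxr.
pose c := cf p.+1 p; pose kap := normc c.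
have k0 : 0 < kap.
  rewrite lt_neqAle normc_ge0 andbT eq_sym.
  by apply: contra (coupling_neq0 p) => /eqP/Normc.eq0_normc/eqP.
(* The origin [- x / gap] of the progression turns the phase of the coupling [c] into that of [z];
   its modulus [kap] only sets the speed of the rotation. *)
have [x hx] : exists x : R, z * kap%:C / c = expi x.
  apply: expi_surj; rewrite Normc.normcM Normc.normcM Normc.normcV z1 mul1r normcR.
  by rewrite gtr0_norm// divff// gt_eqF.
have aE : expi (- ((lambda p.+1 - lambda p) * (- x / (lambda p.+1 - lambda p)))) * c = z * kap%:C.
  have -> : - ((lambda p.+1 - lambda p) * (- x / (lambda p.+1 - lambda p))) = x.
    by field; exact: gap_neq0.
  by rewrite -hx divfK// coupling_neq0.
have ht := infinitesimal_transfer (- x / (lambda p.+1 - lambda p)) pM.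
rewrite -/c aE in ht.
pose g s := rot phi p (kap * s) z.
have -> : rot phi p t z = g (t / kap) by rewrite /g mulrC divfK// gt_eqF.
apply: (infinitesimal_tracks bphi Si Sc (m := transfer p (z * kap%:C)) (g := g)).
- by move=> s; exact: ri.
- by rewrite /g mulr0; exact: rot0.
- by move=> s s'; rewrite /g mulrDr; exact: rotD.
- move=> s j jM; rewrite /g (rotE bphi) /rot_fun.
  have F0 : F M (phi p) by apply: inF_basis => //; exact: ltnW.
  have F1 : F M (phi p.+1) by apply: inF_basis.
  case: ifP => _; first by apply: inFD; exact: inFZ.
  case: ifP => _; last exact: inF_basis.
  by rewrite -scaleNr; apply: inFD; exact: inFZ.
- move=> r j r0 jM; rewrite /transfer /g.
  (* The factor 2 splits the allowance [r h] between the errors on [cos] and [sin]. *)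
  have [d d0 hd] := expi_taylor (divr_gt0 r0 (mulr_gt0 (ltr0n _ 2) k0)).
  exists (d / kap); first by rewrite divr_gt0.
  move=> h /andP[h0]; rewrite ltr_pdivlMr// mulrC => h1.
  have kh : 0 < kap * h by rewrite mulr_gt0.
  have := hd (kap * h); rewrite gtr0_norm// => /(_ h1).
  set e := expi _ - 1 - _ => he.
  have hc : `|cos (kap * h) - 1| <= r / (2 * kap) * (kap * h).
    by apply: le_trans he; have := Re_normc e; rewrite /e /= subr0.
  have hs : `|sin (kap * h) - kap * h| <= r / (2 * kap) * (kap * h).
    apply: le_trans he; rewrite -(ler_pXn2r (n:=2)) ?nnegrE ?normc_ge0//.
    rewrite normc_sq real_normK ?num_real// /e /=.
    by rewrite !subr0 lerDr sqr_ge0.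
  have rk : r / (2 * kap) * (kap * h) = r * h / 2 by field; rewrite gt_eqF.
  rewrite rk in hc hs.
  have bound (b c0 : H) (z' : R[i]) : nrm b = 1 -> nrm c0 = 1 -> normc z' = 1 ->
      nrm (((cos (kap * h))%:C - 1) *: b + (z' * ((sin (kap * h))%:C - (kap * h)%:C)) *: c0) <= r * h.
    move=> b1 c1 z'1; apply: le_trans (nrmD _ _) _; rewrite !nrmZ b1 c1 !mulr1.
    have -> : (cos (kap * h))%:C - 1 = (cos (kap * h) - 1)%:C by rewrite rmorphB rmorph1.
    rewrite Normc.normcM z'1 mul1r -rmorphB !normcR; lra.
  rewrite (rotE bphi) /rot_fun; case: ifP => [/eqP->|jp].
    set X := (X in nrm X); suff -> : X = ((cos (kap * h))%:C - 1) *: phi p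
        + (z * ((sin (kap * h))%:C - (kap * h)%:C)) *: phi p.+1.
      by apply: bound => //; exact: nrm_basis.
    by rewrite /X rmorphM; vec.
  case: ifP => [/eqP->|jp1].
    set X := (X in nrm X); suff -> : X = ((cos (kap * h))%:C - 1) *: phi p.+1
        + (- z^*%C * ((sin (kap * h))%:C - (kap * h)%:C)) *: phi p.
      by apply: bound; rewrite ?nrm_basis// normcN normc_conj.
    by rewrite /X conjcM conjc_real rmorphM; vec.
  by rewrite subrr scaler0 subrr nrm0 mulr_ge0// ltW.
- exact: ht.
- by rewrite divr_gt0.
Qed.

End Control.

(** * Products of plane rotations *)

Section Rotations.
Context (R : realType) (H : hilbertType R) (phi : nat -> H).
Hypothesis bphi : orthonormal_basis phi.
Implicit Types (x y z : H) (U V : H -> H) (n p : nat) (t r : R).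
Local Notation F := (inF phi).

(** The lower bound [n] on the planes makes these products fix [phi j] for [j < n], so that columns
    already adjusted are not disturbed. Angles are positive because [tracks_rot] asks for it. *)
Inductive rotations n : (H -> H) -> Prop :=
| rotations_id : rotations n id
| rotations_cons p t (c : R[i]) U : (n <= p)%N -> 0 < t -> normc c = 1 ->
    rotations n U -> rotations n (rot phi p t c \o U).

Lemma rotations1 n p t (c : R[i]) : (n <= p)%N -> 0 < t -> normc c = 1 ->
  rotations n (rot phi p t c).
Proof. by move=> np t0 c1; apply: rotations_cons np t0 c1 (rotations_id n). Qed.

Lemma rotations_comp n U V : rotations n U -> rotations n V -> rotations n (U \o V).
Proof. by move=> hU hV; elim: hU => // p t c W np t0 c1 _ IH; exact: rotations_cons. Qed.

Lemma rotationsW m n U : (n <= m)%N -> rotations m U -> rotations n U.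
Proof.
move=> nm; elim=> [|p t c W np t0 c1 _ IH]; first exact: rotations_id.
by apply: rotations_cons => //; exact: leq_trans np.
Qed.

Lemma rotations_unitary n U : rotations n U -> unitary U.
Proof.
elim=> [|p t c W np t0 c1 _ IH]; first exact: unitary_id.
by apply: unitary_comp => //; exact: rot_unitary.
Qed.

Lemma rotations_fix n U j : rotations n U -> (j < n)%N -> U (phi j) = phi j.
Proof.
move=> + jn; elim=> // p t c W np t0 c1 _ /= ->.
have jp : (j < p)%N by exact: leq_trans np.
by rewrite rotE2// ?ltn_eqF// ltnW.
Qed.

Lemma phase_exists (a : R[i]) : exists2 c : R[i], normc c = 1 & a = c * (normc a)%:C.
Proof.
have [->|a0] := eqVneq a 0.
  by exists 1; rewrite ?Normc.normc1// Normc.normc0 mulr0.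
have n0 : normc a != 0 by apply: contra a0 => /eqP/Normc.eq0_normc->.
have n1 : (normc a)%:C != 0 by rewrite -[0]/(0%:C) (inj_eq (@complexI R)).
exists (a / (normc a)%:C); last by rewrite divfK.
by rewrite Normc.normcM Normc.normcV normcR ger0_norm ?normc_ge0// divff.
Qed.

(* Two quarter-turns with different phases multiply phi_p by any phase; a third
   rotation then gives both components their moduli and relative phase. *)
Lemma rotations_column p (a b : R[i]) : normc a ^+ 2 + normc b ^+ 2 = 1 ->
  exists2 U, rotations p U & U (phi p) = a *: phi p + b *: phi p.+1.
Proof.
move=> ab; have [ca ca1 aE] := phase_exists a; have [cb cb1 bE] := phase_exists b.
have a1 : -1 <= normc a <= 1.
  have := normc_ge0 a; have := sqr_ge0 (normc b); nra.
have pi0 := pi_gt0 R.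
(* A full turn is added to keep the angle positive when [b = 0]. *)
pose t := acos (normc a) + pi *+ 2.
have t0 : 0 < t by rewrite ltr_wpDl ?acos_ge0// pmulrn_rgt0.
have ct : cos t = normc a by rewrite /t cosD2pi acosK// in_itv.
have st : sin t = normc b.
  rewrite /t sinD2pi sin_acos// (_ : 1 - _ = normc b ^+ 2); last by rewrite -ab; ring.
  by rewrite sqrtr_sqr ger0_norm ?normc_ge0.
have ca0 : ca != 0.
  by apply/eqP => e; move: ca1; rewrite e Normc.normc0 => /eqP; rewrite eq_sym oner_eq0.
have cc : normc (cb / ca) = 1 by rewrite Normc.normcM Normc.normcV ca1 cb1 invr1 mulr1.
have h0 : 0 < pi / 2 :> R by rewrite divr_gt0.
have c1 : normc (1 : R[i]) = 1 by rewrite Normc.normc1.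
have cN : normc (- ca) = 1 by rewrite normcN.
exists (rot phi p t (cb / ca) \o (rot phi p (pi / 2) 1 \o rot phi p (pi / 2) (- ca))).
  by do 2 (apply: rotations_comp; first exact: rotations1); exact: rotations1.
have i1 := rot_isom bphi p t cc; have i2 := rot_isom bphi p (pi / 2) c1.
rewrite /= (rotE0 bphi) cos_pihalf sin_pihalf scale0r add0r mulr1.
rewrite (isomZ _ _ i2) (rotE1 bphi) cos_pihalf sin_pihalf scale0r add0r mulr1 conjc1.
rewrite scale1r scaleNr scalerN opprK (isomZ _ _ i1) (rotE0 bphi) ct st scalerDr !scalerA.
by rewrite -aE mulrA [ca * _]mulrC divfK// -bE.
Qed.

(** Induction on the number [L] of basis vectors after [phi n]: one step gives [phi n] its component
    [c] and puts the norm of the rest on [phi (n+1)], which a product fixing [phi n] spreads as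
    required. For [L = 0] the plane still involves [phi (n+1)], to produce the phase. *)
Lemma rotations_transitive L n y : F (n + L).+1 y ->
  (forall j, (j < n)%N -> dotp y (phi j) = 0) -> nrm y = 1 ->
  exists2 U, rotations n U & U (phi n) = y.
Proof.
elim: L n y => [|L IH] n y Fy y0 y1.
  have yE : y = dotp y (phi n) *: phi n.
    rewrite -{1}Fy addn0 /proj big_ord_recr /= big1 ?add0r// => k _.
    by rewrite y0 ?scale0r// ltn_ord.
  have [|U hU Un] := @rotations_column n (dotp y (phi n)) 0.
    rewrite Normc.normc0 [0 ^+ 2]expr0n addr0; move: y1.
    by rewrite {1}yE nrmZ nrm_basis// mulr1 => ->; rewrite expr1n.
  by exists U => //; rewrite Un scale0r addr0 -yE.
set c := dotp y (phi n); pose y' := y - c *: phi n.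
have y'0 j : (j < n.+1)%N -> dotp y' (phi j) = 0.
  rewrite dotBl dotZl dot_basis// ltnS leq_eqVlt => /predU1P[->|jn].
    by rewrite eqxx mulr1 subrr.
  by rewrite y0// gtn_eqF// mulr0 subrr.
have Fy' : F (n.+1 + L).+1 y'.
  rewrite addSnnS; rewrite /y' -scaleNr addrC; apply: inF_lin => //.
  by apply: inF_basis => //; rewrite ltnS leq_addr.
have pyth : normc c ^+ 2 + nrm y' ^+ 2 = 1.
  have yE : y = y' + c *: phi n by rewrite subrK.
  rewrite -[RHS](expr1n _ 2) -y1 [in RHS]yE (nrmD_sq y').
  by rewrite dotZr y'0// mulr0 Re0 mulr0 addr0 nrmZ nrm_basis// mulr1 addrC.
have [s0|s0] := eqVneq (nrm y') 0.
  have [|U hU Un] := @rotations_column n c 0.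
    by rewrite Normc.normc0 -pyth s0.
  exists U => //; rewrite Un scale0r addr0.
  by have /eqP := nrm_eq0 s0; rewrite subr_eq0 eq_sym => /eqP.
have s1 : 0 < nrm y' by rewrite lt_neqAle eq_sym s0 nrm_ge0.
have [||| V hV Vn] := IH n.+1 ((nrm y')^-1%:C *: y').
- exact: inFZ.
- by move=> j /y'0 e; rewrite dotZl e mulr0.
- by rewrite nrmZr gtr0_norm ?invr_gt0// mulVf.
have [|U hU Un] := @rotations_column n c (nrm y')%:C.
  by rewrite normcR gtr0_norm.
exists (V \o U); first by apply: rotations_comp => //; exact: rotationsW hV.
have iV := unitary_isom (rotations_unitary hV).
rewrite /= Un (isomD _ _ iV) !(isomZ _ _ iV) Vn (rotations_fix hV)//.
by rewrite scalerA -rmorphM mulfV// scale1r /y' addrC subrK.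
Qed.

(** The vector [U (phi n)] is pulled back by the product [G] already found. The resulting [y] is
    almost orthogonal to [phi j], [j < n]; truncated, made exactly orthogonal and normalized, it is
    reached from [phi n] by a product that fixes these vectors. *)
Lemma rotations_approx U n r : isom U -> 0 < r ->
  exists2 G, rotations 0 G & forall j, (j < n)%N -> nrm (G (phi j) - U (phi j)) <= r.
Proof.
move=> iU; elim: n r => [|n IH] r r0; first by exists id => //; exact: rotations_id.
have n2 : 0 < 2 * (n%:R + 2) :> R by rewrite mulr_gt0// ltr_wpDl.
(* Ensures [2 (n + 1) e <= r], the total error on [phi n], and [(n + 1) e < 1], so that [y1] is not
   zero. *)
pose e := Num.min r 1 / (2 * (n%:R + 2)).
have m0 : 0 < Num.min r 1 by rewrite lt_min r0 ltr01.
have e0 : 0 < e by rewrite divr_gt0.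
have eE : 2 * (n%:R + 2) * e = Num.min r 1 by rewrite mulrC divfK// gt_eqF.
have en : (0 : R) <= n%:R * e by rewrite mulr_ge0// ltW.
have [mr m1] : Num.min r 1 <= r /\ Num.min r 1 <= 1 by rewrite !ge_min !lexx orbT.
have [G hG GU] := IH _ e0.
have uG := rotations_unitary hG; have iG := unitary_isom uG.
have [_ _ /(_ (U (phi n)))[y yE]] := uG.
have ny : nrm y = 1 by rewrite -iG.2 yE iU.2 nrm_basis.
have yj j : (j < n)%N -> normc (dotp y (phi j)) <= e.
  move=> jn; rewrite -(isom_dot _ _ iG) yE.
  have -> : dotp (U (phi n)) (G (phi j)) = dotp (U (phi n)) (G (phi j) - U (phi j)).
    by rewrite dotBr (isom_dot _ _ iU) dot_basis// gtn_eqF// subr0.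
  apply: le_trans (cauchy_schwarz _ _) _.
  by rewrite iU.2 nrm_basis// mul1r GU.
have [M0 hM0] := proj_approx bphi y e0; pose M := maxn M0 n.
have hM := hM0 M (leq_maxl _ _).
pose y1 := proj phi M y - proj phi n y.
have hn : nrm (proj phi n y) <= n%:R * e.
  apply: le_trans (nrm_sum _ _ _) _.
  have -> : n%:R * e = \sum_(k < n) e by rewrite sumr_const card_ord mulr_natl.
  by apply: ler_sum => k _; rewrite nrmZ nrm_basis// mulr1 yj.
have yy1 : nrm (y - y1) <= (n%:R + 1) * e.
  have -> : y - y1 = (y - proj phi M y) + proj phi n y by rewrite /y1; vec.
  apply: le_trans (nrmD _ _) _; rewrite mulrDl mul1r; lra.
have y1n : 1 - nrm y1 <= (n%:R + 1) * e.
  have := nrmD (y - y1) y1; rewrite subrK ny; lra.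
have y1n' : nrm y1 - 1 <= (n%:R + 1) * e.
  have := nrmD (y1 - y) y; rewrite subrK ny nrmBC; lra.
have y10 : 0 < nrm y1 by lra.
pose y2 := (nrm y1)^-1%:C *: y1.
have y21 : nrm (y2 - y1) <= (n%:R + 1) * e.
  have -> : y2 - y1 = ((nrm y1)^-1 - 1)%:C *: y1.
    by rewrite rmorphB rmorph1 scalerBl scale1r.
  rewrite nrmZr -[X in _ * X](ger0_norm (ltW y10)) -normrM mulrBl mulVf ?gt_eqF// mul1r.
  by rewrite ler_norml; lra.
have [||| V hV Vn] := @rotations_transitive (M - n) n y2.
- rewrite subnKC ?leq_maxr//; apply: inFZ; rewrite /y1 addrC -scaleN1r; apply: inF_lin => //.
    by apply: inFW (inF_proj bphi n y) => //; rewrite leqW// leq_maxr.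
  by apply: inFW (inF_proj bphi M y) => //.
- move=> j jn; rewrite dotZl dotBl !dot_proj// jn (leq_trans jn) ?leq_maxr//.
  by rewrite subrr mulr0.
- by rewrite nrmZr gtr0_norm ?invr_gt0// mulVf// gt_eqF.
exists (G \o V); first by apply: rotations_comp => //; exact: rotationsW hV.
move=> j; rewrite ltnS leq_eqVlt => /predU1P[->|jn] /=.
  rewrite Vn -yE (isom_dist _ _ iG).
  apply: le_trans (nrmB_le _ y1 _) _; rewrite (nrmBC y1); lra.
rewrite (rotations_fix hV)//; apply: le_trans (GU j jn) _; lra.
Qed.

End Rotations.

(** * Density matrices *)

Section DensityMatrices.
Context (R : realType) (H : hilbertType R) (phi : nat -> H).
Hypothesis bphi : orthonormal_basis phi.
Implicit Types (x y z : H) (U V : H -> H) (n : nat) (r : R).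

Lemma unitary_adjoint U y : unitary U -> U (adjoint U y) = y.
Proof.
move=> hU; have iU := unitary_isom hU; have [_ _ /(_ y)[z zy]] := hU.
rewrite /adjoint; case: xgetP => [w _ wP|/(_ z) h].
  rewrite -zy; congr (U _); apply: dot_ext => x; rewrite -wP -zy.
  exact: isom_dot.
by case: h => x; rewrite -zy; exact: isom_dot.
Qed.

Lemma adjoint_dot U x y : unitary U -> dotp x (adjoint U y) = dotp (U x) y.
Proof.
move=> hU; rewrite -[in RHS](unitary_adjoint y hU).
by rewrite (isom_dot _ _ (unitary_isom hU)).
Qed.

Lemma adjoint_nrm U y : unitary U -> nrm (adjoint U y) = nrm y.
Proof.
by move=> hU; rewrite -[in RHS](unitary_adjoint y hU) (unitary_isom hU).2.
Qed.

Variable rho : H -> H.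
Hypothesis hrho : density_matrix rho.

Let diag_rho k := complex.Re (dotp (rho (phi k)) (phi k)).

Lemma density_diag_sum : (forall m, \sum_(0 <= k < m) diag_rho k <= 1) /\
  forall r, 0 < r -> exists n, forall m, \sum_(n <= k < m) diag_rho k <= r.
Proof.
have [pos _ _ tr] := hrho.
have d0 k : 0 <= diag_rho k by have := pos (phi k); rewrite lecE => /andP[].
pose S n := \sum_(0 <= k < n) diag_rho k.
have SE n : S n = complex.Re (series (fun n => dotp (rho (phi n)) (phi n) : R[i]^o) n).
  rewrite /S /series /=; elim: n => [|n IH]; first by rewrite !big_geq.
  by rewrite !big_nat_recr//= IH ReD.
have Scvg e : 0 < e -> exists N, forall n, (N <= n)%N -> `|1 - S n| < e.
  move=> e0; have /cvgrPdist_lt/(_ e%:C) := tr _ bphi.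
  rewrite ltcR => /(_ e0)[N _ hN]; exists N => n /hN; rewrite /= normr_normc ltcR.
  apply: le_lt_trans; rewrite SE; set z := series _ _.
  by have := Re_normc (1 - z); rewrite ReB.
have Smono n m : (n <= m)%N -> S n <= S m.
  move=> nm; rewrite /S (big_cat_nat _ nm)//= lerDl.
  by apply: sumr_ge0 => k _; exact: d0.
have S1 n : S n <= 1.
  apply/ler_addgt0Pr => e e0; have [N hN] := Scvg e e0.
  have := hN _ (leq_maxl N n); have := Smono _ _ (leq_maxr N n).
  rewrite ltr_norml => h1 /andP[h2 h3]; lra.
split=> // r r0; have [N hN] := Scvg r r0; exists N => m.
have [Nm|mN] := leqP N m; last by rewrite big_geq ?ltW// ltnW.
have := S1 m; rewrite /S (big_cat_nat _ Nm)//= -/(S N).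
have := hN N (leqnn N); rewrite ltr_norml => /andP[h1 h2]; lra.
Qed.

Lemma density_form_ge0 y : 0 <= complex.Re (dotp (rho y) y).
Proof. by have [/(_ y) + _ _ _] := hrho; rewrite lecE => /andP[]. Qed.

(** Cauchy-Schwarz for the form [<rho x, z>] bounds each term by [<rho y, y> <rho phi_k, phi_k>],
    and the second factors sum to a piece of the trace. *)
Lemma density_coef_sum i m y r : \sum_(i <= k < m) diag_rho k <= r ->
  \sum_(i <= k < m) normc (dotp (rho y) (phi k)) ^+ 2 <=
  complex.Re (dotp (rho y) y) * r.
Proof.
move=> hr; have [pos sa [[lin _] _] _] := hrho.
apply: le_trans (ler_wpM2l (density_form_ge0 y) hr).
rewrite mulr_sumr; apply: ler_sum => k _.
apply: (@cauchy_schwarz_psd _ _ (fun x z => dotp (rho x) z)) => //.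
- by move=> a x1 x2 z; rewrite lin dotDl dotZl.
- by move=> x z; rewrite sa dotC.
Qed.

(** [|rho y|^2 <= <rho y, y> <= |rho y| |y|], the first inequality because the trace is 1. *)
Lemma density_le y : nrm (rho y) <= nrm y.
Proof.
have [sum1 _] := density_diag_sum; have q0 := density_form_ge0 y.
set q := complex.Re _ in q0; have sq : Num.sqrt q ^+ 2 = q by rewrite sqr_sqrtr.
have nq : nrm (rho y) ^+ 2 <= q.
  rewrite -sq ler_pXn2r ?nnegrE ?nrm_ge0 ?sqrtr_ge0//.
  have -> : rho y = rho y - proj phi 0 (rho y) by rewrite /proj big_ord0 subr0.
  apply: (parseval_tail bphi); first exact: sqrtr_ge0.
  by move=> m _; rewrite sq -[leRHS]mulr1; exact: density_coef_sum.
have qn : q <= nrm (rho y) * nrm y.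
  by apply: le_trans (cauchy_schwarz _ _); apply: le_trans (ler_norm _) (Re_normc _).
have [/eqP e|n0] := eqVneq (nrm (rho y)) 0; first by rewrite (eqP e) nrm_ge0.
have p0 : 0 < nrm (rho y) by rewrite lt_neqAle eq_sym n0 nrm_ge0.
by rewrite -(ler_pM2l p0) -expr2; exact: le_trans qn.
Qed.

(** Finite-rank approximation in operator norm: one [n] serves all [y] because the error is
    controlled by a tail of the trace. *)
Lemma density_tail r : 0 < r ->
  exists n, forall y, nrm (rho y - proj phi n (rho y)) <= r * nrm y.
Proof.
move=> r0; have [_ tail] := density_diag_sum.
have [n hn] := tail _ (exprn_gt0 2 r0); exists n => y.
apply: (parseval_tail bphi) => [|m _]; first by rewrite mulr_ge0 ?nrm_ge0// ltW.
apply: le_trans (density_coef_sum _ (hn m)) _.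
rewrite exprMn [leRHS]mulrC ler_wpM2r ?sqr_ge0//.
apply: le_trans (ler_norm _) _; apply: le_trans (Re_normc _) _.
apply: le_trans (cauchy_schwarz _ _) _.
by rewrite expr2 ler_wpM2r ?nrm_ge0// density_le.
Qed.

(** The hypothesis compares [U rho] with [V rho], on the left only. On the right,
    [|rho d|^2 = <rho (rho d), d>] with [d = U^* x - V^* x]; moving the adjoints turns it into the
    same comparison at [rho d]. *)
Lemma conjugation_close U V r : unitary U -> unitary V -> 0 <= r ->
  (forall y, nrm (U (rho y) - V (rho y)) <= r * nrm y) ->
  forall x, nrm (U (rho (adjoint U x)) - V (rho (adjoint V x))) <= 2 * r * nrm x.
Proof.
move=> hU hV r0 hUV x; have [_ sa [[lin _] _] _] := hrho.
have iU := unitary_isom hU; have iV := unitary_isom hV.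
pose d := adjoint U x - adjoint V x.
have rhoB y z : rho (y - z) = rho y - rho z.
  by rewrite addrC -scaleN1r lin scaleN1r addrC.
have dle : nrm (rho d) <= r * nrm x.
  have [/eqP e|n0] := eqVneq (nrm (rho d)) 0.
    by rewrite (eqP e) mulr_ge0 ?nrm_ge0.
  have p0 : 0 < nrm (rho d) by rewrite lt_neqAle eq_sym n0 nrm_ge0.
  rewrite -(ler_pM2l p0) -expr2 nrm_sq sa dotC.
  have -> : dotp (rho (rho d)) d = dotp (U (rho (rho d)) - V (rho (rho d))) x.
    by rewrite /d dotBr !adjoint_dot// dotBl.
  apply: le_trans (ler_norm _) _; apply: le_trans (Re_normc _) _; rewrite normc_conj.
  apply: le_trans (cauchy_schwarz _ _) _; rewrite mulrA [nrm (rho d) * r]mulrC.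
  by rewrite ler_wpM2r ?nrm_ge0.
have -> : U (rho (adjoint U x)) - V (rho (adjoint V x)) =
    U (rho d) + (U (rho (adjoint V x)) - V (rho (adjoint V x))).
  by rewrite /d rhoB (isomB _ _ iU); vec.
apply: le_trans (nrmD _ _) _; rewrite iU.2.
have := hUV (adjoint V x); rewrite adjoint_nrm//; lra.
Qed.

End DensityMatrices.

(** * Operator norm and conclusion *)

Lemma op_norm_le (R : realType) (H : hilbertType R) (T : H -> H) (r : R) :
  0 <= r -> (forall x, nrm (T x) <= r * nrm x) -> (op_norm T <= r%:E)%E.
Proof.
move=> r0 hT; apply: ub_ereal_sup => _ [x /= x1 <-]; rewrite lee_fin.
apply: le_trans (hT x) _; rewrite -[leRHS]mulr1 ler_wpM2l//.
by move: x1; rewrite nrmE -[1]/(1%:C) lecR.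
Qed.

Theorem theorem5p2 (R : realType) (H : hilbertType R) (delta : R)
    (A B : operator H) (phi : nat -> H) (lambda : nat -> R)
    (rho0 rho1 : H -> H) :
  0 < delta ->
  skew_adjoint_discrete_spectrum_system A B `]0, delta[%classic phi ->
  controlled_op_well_defined A B `]0, delta[%classic phi ->
  (forall n, A (phi n) = (0 +i* lambda n) *: phi n) ->
  Q_linearly_independent (fun n => lambda n.+1 - lambda n) ->
  (forall n, dotp (B (phi n)) (phi n.+1) != 0) ->
  density_matrix rho0 ->
  density_matrix rho1 ->
  unitarily_equivalent rho0 rho1 ->
  forall eps : R, 0 < eps ->
  exists (k : nat) (t u : nat -> R),
    [/\ (0 < k)%N,
        forall j, (j < k)%N -> 0 < t j,
        forall j, (j < k)%N -> 0 < u j < delta &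
        let V := propagator A B phi t u k in
        (op_norm (rho1 \- (V \o rho0 \o adjoint V))%R < eps%:E)%E].
Proof.
move=> delta0 sys wd eig Qind conn hrho0 _ [U hU ->] eps eps0.
have [_ bphi _ _] := sys; have iU := unitary_isom hU.
(* Two tails of [eps/16] and [2 n d <= eps/16] stay below [eps/4] in [key]; [conjugation_close]
   doubles it to [eps/2], which leaves room for the strict inequality. *)
have e16 : 0 < eps / 16 by rewrite divr_gt0.
have [n hn] := density_tail bphi hrho0 e16.
have n1 : 0 < n%:R + 1 :> R by rewrite ltr_wpDl.
pose d := eps / 32 / (n%:R + 1); have d0 : 0 < d by rewrite !divr_gt0.
have dE : (n%:R + 1) * d = eps / 32 by rewrite mulrC divfK// gt_eqF.
have [G hG GU] := rotations_approx bphi n iU d0.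
have Sc := @reachable_comp R H delta A B phi.
have Si V : reachable delta A B phi V -> isom V by exact: reachable_isom.
have tG : tracks (reachable delta A B phi) setT G.
  elim: hG => [|p t c W _ t0 c1 _ IH].
    have -> : id = op_exp A 0.
      by have [[sA _] _ _ _] := sys; rewrite op_exp0.
    exact: (tracks_expA delta0 sys wd eig).
  apply: (tracks_comp Si Sc (W := setT)) => //.
  exact: (tracks_rot delta0 sys wd eig Qind conn).
have [V SV VG] := tracks_on_basis bphi (tracksS (fun x _ => I) tG : tracks _ (inF phi n) G) d0.
have [k [t [u [k0 ht hu VE]]]] := SV; exists k, t, u; split=> //.
have uV : unitary V by rewrite VE; exact: (propagator_unitary wd).
have iV := unitary_isom uV; rewrite -VE /=.
have VU j : (j < n)%N -> nrm (V (phi j) - U (phi j)) <= 2 * d.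
  move=> jn; apply: le_trans (nrmB_le _ (G (phi j)) _) _.
  have := VG j jn; have := GU j jn; lra.
have key y : nrm (U (rho0 y) - V (rho0 y)) <= eps / 4 * nrm y.
  pose z := proj phi n (rho0 y).
  have y0 := nrm_ge0 y; have := hn y; rewrite -/z => hz.
  have -> : U (rho0 y) - V (rho0 y) = U (rho0 y - z) - (V z - U z) - V (rho0 y - z).
    by rewrite (isomB _ _ iU) (isomB _ _ iV); vec.
  apply: le_trans (nrmB_le _ 0 _) _; rewrite subr0 sub0r nrmN iV.2.
  apply: le_trans (lerD (nrmB_le _ 0 _) (lexx _)) _; rewrite subr0 sub0r nrmN iU.2.
  have hvz := nrm_diff_inF bphi iU iV VU (inF_proj bphi n (rho0 y)).
  have zy : nrm z <= nrm y.
    by apply: le_trans (nrm_proj_le bphi _ _) (density_le bphi hrho0 y).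
  have nd : n%:R * (2 * d) <= eps / 16 by have := ltW d0; lra.
  have nd0 : 0 <= n%:R * (2 * d) by rewrite mulr_ge0// mulr_ge0// ltW.
  have ey := mulr_ge0 (ltW eps0) y0; rewrite -/z in hvz.
  have := ler_pM nd0 (nrm_ge0 z) nd zy; lra.
apply: le_lt_trans (_ : (eps / 2)%:E < _)%E; last by rewrite lte_fin ltr_pdivrMr//; lra.
apply: op_norm_le => [|x]; first by rewrite divr_ge0// ltW.
rewrite /= (_ : eps / 2 = 2 * (eps / 4)); last by field.
by apply: (conjugation_close hrho0) => //; rewrite divr_ge0// ltW.
Qed.
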